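(* There exists a continuous map $f:\mathbb{R}^3\to\mathbb{R}^3$ with the following property. For any map $\varphi:\mathbb{N}\to\mathcal{K}$, where $\mathcal{K}$ is the set of all oriented tame knot types in $\mathbb{R}^3$, there exists a tame (oriented) knot $k\subset\mathbb{R}^3$ that is iteratively injective with respect to $f$ such that $f^{n-1}(k)$ is a tame knot in $\mathbb{R}^3$ and $f^{n-1}(k)\in\varphi(n)$ for each $n\in\mathbb{N}$.
   Context: $\mathbb{N}$ is the set of positive integers. A knot in $\mathbb{R}^3$ is a subset homeomorphic to a circle. An oriented knot type is an ambient isotopy class of oriented knots in $\mathbb{R}^3$; it is tame if it contains a smooth or polygonal knot (polygonal: a union of finitely many straight line segments), and a knot is tame if it is ambient isotopic to a smooth or polygonal knot. $\mathcal{K}$ denotes the set of all oriented tame knot types; an element of $K\in\mathcal{K}$ is an oriented knot. Here $k$ is not required to be itself polygonal or smooth. For a map $f:X\to X$, $f^0=\mathrm{id}_X$ and $f^n=f\circ f^{n-1}$ for $n\ge 1$. A subset $A\subset X$ is iteratively injective with respect to $f$ if $f^n|_A:A\to X$ is injective for every non-negative integer $n$. If $f$ is continuous and $k$ is an oriented knot that is iteratively injective with respect to $f$, each $f^n(k)$ is regarded as an oriented knot with the orientation carried over from $k$ by $f^n$. *)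

(* Defs.v *)
From HB Require Import structures.
From mathcomp Require Import all_boot all_order all_algebra.
From mathcomp Require Import all_classical all_reals all_analysis.
Import Order.TTheory GRing.Theory Num.Theory numFieldNormedType.Exports.

Set Implicit Arguments.
Unset Strict Implicit.
Unset Printing Implicit Defensive.

Local Open Scope classical_set_scope.
Local Open Scope ring_scope.

Notation space3 R := 'rV[R]_3.

Definition homeomorphism (X Y : topologicalType) (f : X -> Y) : Prop :=
  continuous f /\
  exists g : Y -> X, [/\ continuous g, cancel f g & cancel g f].

Definition iteratively_injective (X : Type) (f : X -> X) (A : set X) : Prop :=
  forall n : nat, set_inj A (iter n f).

Definition circle (R : realType) : set (R * R) :=
  [set z | z.1 ^+ 2 + z.2 ^+ 2 = 1].
Arguments circle R : clear implicits.

Lemma cos_sin_circle (R : realType) (t : R) : (cos t, sin t) \in circle R.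
Proof. by apply/mem_set; rewrite /circle /= cos2Dsin2. Qed.

Definition circle_angle (R : realType) (t : R) : circle R :=
  exist _ (cos t, sin t) (cos_sin_circle t).

(* The subtypes [circle R] and [K] carry the subspace topology. *)
Definition parametrizes (R : realType) (p : circle R -> space3 R)
    (K : set (space3 R)) : Prop :=
  exists h : circle R -> K,
    homeomorphism h /\ forall z : circle R, p z = val (h z).

Definition is_knot (R : realType) (K : set (space3 R)) : Prop :=
  exists h : circle R -> K, homeomorphism h.

(* A homeomorphism of the circle preserves orientation when it lifts to an
   increasing map of the universal cover t |-> (cos t, sin t). *)
Definition orientation_preserving (R : realType)
    (h : circle R -> circle R) : Prop :=
  homeomorphism h /\
  exists H : R -> R,
    [/\ continuous H,
        {homo H : s t / s < t} &
        forall t : R, h (circle_angle t) = circle_angle (H t)].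

(* An orientation of a knot is an equivalence class of parametrizations by the
   circle, modulo orientation-preserving homeomorphisms of the circle; it is
   represented by the set of its members. [oriented_set] is the raw data and
   [is_oriented_knot] the validity condition, so that images under arbitrary
   maps are total. *)
Record oriented_set (R : realType) := OrientedSet {
  carrier : set (space3 R) ;
  orientation : set (circle R -> space3 R)
}.

Definition is_oriented_knot (R : realType) (k : oriented_set R) : Prop :=
  exists p : circle R -> space3 R,
    parametrizes p (carrier k) /\
    orientation k = [set p \o h | h in @orientation_preserving R].

Definition oriented_image (R : realType) (g : space3 R -> space3 R)
    (k : oriented_set R) : oriented_set R :=
  OrientedSet (g @` carrier k) [set g \o p | p in orientation k].

(* The parametrization is required to be an immersion, so that the knot is a
   smooth submanifold; without it, wild knots would be allowed. *)
Definition smooth_knot (R : realType) (K : set (space3 R)) : Prop :=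
  exists p : circle R -> space3 R,
    [/\ parametrizes p K,
        forall (n : nat) (t : R),
          derivable (derive1n n (fun s : R => p (circle_angle s))) t 1 &
        forall t : R, derive1 (fun s : R => p (circle_angle s)) t != 0].

Definition line_segment (R : realType) (a b : space3 R) : set (space3 R) :=
  [set (1 - t) *: a + t *: b | t in `[0 : R, 1]].

Definition polygonal_knot (R : realType) (K : set (space3 R)) : Prop :=
  is_knot K /\
  exists s : seq (space3 R * space3 R),
    K = \bigcup_(ab in [set` s]) line_segment ab.1 ab.2.

Definition ambient_isotopy (R : realType)
    (F : R -> space3 R -> space3 R) : Prop :=
  [/\ {within `[0 : R, 1] `*` [set: space3 R],
        continuous (fun z : R * space3 R => F z.1 z.2)},
      forall t : R, t \in `[0, 1] -> homeomorphism (F t) &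
      forall x : space3 R, F 0 x = x].

Definition tame_knot (R : realType) (K : set (space3 R)) : Prop :=
  is_knot K /\
  exists F : R -> space3 R -> space3 R,
    ambient_isotopy F /\
    (smooth_knot (F 1 @` K) \/ polygonal_knot (F 1 @` K)).

Definition ambient_isotopic (R : realType) (k k' : oriented_set R) : Prop :=
  exists F : R -> space3 R -> space3 R,
    ambient_isotopy F /\ oriented_image (F 1) k = k'.

Definition oriented_knot_type (R : realType)
    (C : set (oriented_set R)) : Prop :=
  exists k : oriented_set R,
    is_oriented_knot k /\
    C = [set k' | is_oriented_knot k' /\ ambient_isotopic k k'].

Definition tame_oriented_knot_type (R : realType)
    (C : set (oriented_set R)) : Prop :=
  oriented_knot_type C /\
  exists k : oriented_set R,
    C k /\ (smooth_knot (carrier k) \/ polygonal_knot (carrier k)).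

(* Main.v *)
Require Import Defs.
From HB Require Import structures.
From mathcomp Require Import all_boot all_order all_algebra.
From mathcomp Require Import all_classical all_reals all_analysis.
From mathcomp Require Import ring lra zify.
Import Order.TTheory GRing.Theory Num.Theory numFieldNormedType.Exports.

(** The idea is to let one map act as the shift on sequences of knot types, with
    the sequence written into the shape of the knot.

    There are countably many tame types. A smooth or polygonal knot has a
    bi-Lipschitz parametrization that polygons with rational vertices approximate
    in the Lipschitz sense, and such an approximation is ambient isotopic to the
    knot ([tame_rat_curve]). Indeed its displacement is Lipschitz along the knot,
    with a constant so small that McShane's extension to the whole space is a
    contraction, and adding a contraction to the identity is the end of an
    ambient isotopy ([bilip_curve_stable], [isotopy_end_lip]).

    So the types have indices m, and each is represented by a hanging curve
    ([hanging_curves], by [deforms_tent] and [hanging_deformation]): from the apex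
    0 the left edge runs to (-1/3, 0, -1/3) and the right edge to
    (1/3, 0, -1/3), and the knotted part joins their ends below the base of this
    triangle, in a sector at a depth of order 2^-m. Knotted parts of different
    indices are disjoint and tend to the base as m grows. To obtain a highest
    vertex with straight edges, a polygon is sheared so that a vertex farthest
    from some point becomes the highest one; then everything else is shrunk into
    the sector.

    A sequence phi of indices becomes the curve [coded]: its knotted part is the
    one of index phi 0, and in the window of depths from 2^-j/6 to 2^-j/3 its
    right edge carries a tent whose height is 2^-(phi (j + 1)) times a fixed
    multiple of 2^-j. The tents are made by an ambient isotopy, so they leave the
    type of index phi 0 unchanged.

    The map f doubles the distance from the apex along the right edge. This takes
    window j + 1 to window j and window 0 to the middle third of the curve of
    index phi 1; the left edge and the old knotted part are compressed into the
    left edge ([zoom]). The point of the coded curve with parameter t thus goes to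
    the point of the curve coded by the shifted sequence with parameter [zoom t].
    This is well defined, as a point reveals the part of the code that its image
    depends on ([model_zoom]): in the knotted part through the sector, on the
    right edge through the height of the tent, and where the tent vanishes the
    image is common to all codes. The points in question fill countably many
    arcs converging to a triangle, a compact set on which the assignment is
    continuous, and Tietze's theorem extends it ([extend_family]).

    By [shifting_map_iter] the n-th iterate of f maps the knot coded by phi onto
    the knot coded by the n-fold shift of phi, up to an increasing change of
    parameter. Hence it is injective on the knot, and the image has the type of
    index phi n ([coded_isotopic]). *)

Set Implicit Arguments.
Unset Strict Implicit.
Unset Printing Implicit Defensive.

Local Open Scope classical_set_scope.
Local Open Scope ring_scope.

(** * Continuity and coordinates *)

Section Basics.
Context {R : realType}.

Lemma continuous_at_dist (X Y : normedModType R) (f : X -> Y) (x : X) :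
  {for x, continuous f} <-> forall e, 0 < e ->
    exists2 d, 0 < d & forall y, `|x - y| < d -> `|f x - f y| < e.
Proof.
split.
  move=> fx e e0; have /cvgrPdist_lt /(_ e e0) /nbhs_normP[d d0 H] := fx.
  by exists d => // y; exact: H.
move=> H; apply/cvgrPdist_lt => e e0; apply/nbhs_normP.
by have [d d0 Hd] := H e e0; exists d.
Qed.

Lemma continuous_real_max (T : topologicalType) (f g : T -> R) :
  continuous f -> continuous g -> continuous (fun t => Num.max (f t) (g t)).
Proof. by move=> cf cg t; apply: continuous_max; [exact: cf|exact: cg]. Qed.

Lemma continuous_real_min (T : topologicalType) (f g : T -> R) :
  continuous f -> continuous g -> continuous (fun t => Num.min (f t) (g t)).
Proof. by move=> cf cg t; apply: continuous_min; [exact: cf|exact: cg]. Qed.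

Lemma continuous_real_add (T : topologicalType) (f g : T -> R) :
  continuous f -> continuous g -> continuous (fun t => f t + g t).
Proof. by move=> cf cg t; apply: cvgD; [exact: cf|exact: cg]. Qed.

Lemma continuous_real_sub (T : topologicalType) (f g : T -> R) :
  continuous f -> continuous g -> continuous (fun t => f t - g t).
Proof. by move=> cf cg t; apply: cvgB; [exact: cf|exact: cg]. Qed.

Lemma continuous_real_opp (T : topologicalType) (f : T -> R) :
  continuous f -> continuous (fun t => - f t).
Proof. by move=> cf t; apply: cvgN; exact: cf. Qed.

Lemma continuous_real_mul (T : topologicalType) (f g : T -> R) :
  continuous f -> continuous g -> continuous (fun t => f t * g t).
Proof. by move=> cf cg t; apply: cvgM; [exact: cf|exact: cg]. Qed.

Lemma continuous_real_inv (T : topologicalType) (f : T -> R) :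
  (forall t, f t != 0) -> continuous f -> continuous (fun t => (f t)^-1).
Proof. by move=> f0 cf t; apply: cvgV; [exact: f0|exact: cf]. Qed.

Lemma continuous_comp_fun (T U W : topologicalType) (f : T -> U) (g : U -> W) :
  continuous f -> continuous g -> continuous (fun t => g (f t)).
Proof. by move=> cf cg t; apply: continuous_comp; [exact: cf|exact: cg]. Qed.

Definition vec3 (x y z : R) : space3 R := \row_j [:: x; y; z]`_j.

Definition xco (p : space3 R) := p 0 0.
Definition yco (p : space3 R) := p 0 1.
Definition zco (p : space3 R) := p 0 2.

Lemma xco_vec3 x y z : xco (vec3 x y z) = x. Proof. by rewrite /xco mxE. Qed.
Lemma yco_vec3 x y z : yco (vec3 x y z) = y. Proof. by rewrite /yco mxE. Qed.
Lemma zco_vec3 x y z : zco (vec3 x y z) = z. Proof. by rewrite /zco mxE. Qed.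
Definition co_vec3 := (xco_vec3, yco_vec3, zco_vec3).

Lemma vec3_eta (p : space3 R) : p = vec3 (xco p) (yco p) (zco p).
Proof.
apply/rowP => j; rewrite mxE /xco /yco /zco.
case: j => -[|[|[|//]]] ij /=; congr (p _ _); exact: val_inj.
Qed.

Lemma vec3P (p q : space3 R) :
  xco p = xco q -> yco p = yco q -> zco p = zco q -> p = q.
Proof. by move=> h1 h2 h3; rewrite (vec3_eta p) (vec3_eta q) h1 h2 h3. Qed.

Lemma xcoD p q : xco (p + q) = xco p + xco q. Proof. by rewrite /xco mxE. Qed.
Lemma ycoD p q : yco (p + q) = yco p + yco q. Proof. by rewrite /yco mxE. Qed.
Lemma zcoD p q : zco (p + q) = zco p + zco q. Proof. by rewrite /zco mxE. Qed.
Lemma xcoN p : xco (- p) = - xco p. Proof. by rewrite /xco mxE. Qed.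
Lemma ycoN p : yco (- p) = - yco p. Proof. by rewrite /yco mxE. Qed.
Lemma zcoN p : zco (- p) = - zco p. Proof. by rewrite /zco mxE. Qed.
Lemma xcoZ k p : xco (k *: p) = k * xco p. Proof. by rewrite /xco mxE. Qed.
Lemma ycoZ k p : yco (k *: p) = k * yco p. Proof. by rewrite /yco mxE. Qed.
Lemma zcoZ k p : zco (k *: p) = k * zco p. Proof. by rewrite /zco mxE. Qed.
Lemma xco0 : xco 0 = 0. Proof. by rewrite /xco mxE. Qed.
Lemma yco0 : yco 0 = 0. Proof. by rewrite /yco mxE. Qed.
Lemma zco0 : zco 0 = 0. Proof. by rewrite /zco mxE. Qed.
Definition coE := (co_vec3, xcoD, ycoD, zcoD, xcoN, ycoN, zcoN,
  xcoZ, ycoZ, zcoZ, xco0, yco0, zco0).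

Lemma coord_norm_le (p : space3 R) j : `|p 0 j| <= `|p|.
Proof.
rewrite /Num.norm /= mx_normrE.
exact: (le_bigmax _ (fun i : 'I_1 * 'I_3 => `|p i.1 i.2|) (0, j)).
Qed.

Lemma row_norm_le (p : space3 R) r : 0 <= r ->
  (forall j, `|p 0 j| <= r) -> `|p| <= r.
Proof.
move=> r0 H; rewrite {1}/Num.norm /= mx_normrE; apply/bigmax_leP; split => //.
by move=> -[i j] _ /=; rewrite (ord1 i).
Qed.

Lemma vec3_norm_le (p : space3 R) r : 0 <= r ->
  `|xco p| <= r -> `|yco p| <= r -> `|zco p| <= r -> `|p| <= r.
Proof.
move=> r0 h1 h2 h3; apply: row_norm_le => // j.
rewrite (vec3_eta p) mxE; case: j => -[|[|[|//]]] ij //=.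
Qed.

Lemma xco_norm p : `|xco p| <= `|p|. Proof. exact: coord_norm_le. Qed.
Lemma yco_norm p : `|yco p| <= `|p|. Proof. exact: coord_norm_le. Qed.
Lemma zco_norm p : `|zco p| <= `|p|. Proof. exact: coord_norm_le. Qed.

Lemma continuous_xco : continuous xco. Proof. exact: coord_continuous. Qed.
Lemma continuous_yco : continuous yco. Proof. exact: coord_continuous. Qed.
Lemma continuous_zco : continuous zco. Proof. exact: coord_continuous. Qed.

Lemma continuous_row (T : topologicalType) (f : T -> space3 R) :
  (forall j, continuous (fun t => f t 0 j)) -> continuous f.
Proof.
move=> H t; apply/cvgrPdist_le => e e0.
have : forall j, \forall s \near t, `|f t 0 j - f s 0 j| <= e.
  by move=> j; have /cvgrPdist_le := H j t; apply.
move=> /(_ _) Hj; near=> s; apply: row_norm_le; first exact: ltW.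
by move=> j; rewrite !mxE; move: j; near: s; exact: filter_forall.
Unshelve. all: end_near. Qed.

Lemma continuous_vec3 (T : topologicalType) (f g h : T -> R) :
  continuous f -> continuous g -> continuous h ->
  continuous (fun t => vec3 (f t) (g t) (h t)).
Proof.
move=> cf cg ch; apply: continuous_row => j.
rewrite [X in continuous X](_ : _ = (fun t => [:: f t; g t; h t]`_j)).
  by case: j => -[|[|[|//]]] ij /=.
by apply/funext => t; rewrite mxE.
Qed.

End Basics.

(** * The circle as a quotient of the line *)

Lemma compact_bijection_inverse (X Y : topologicalType) (f : X -> Y) (g : Y -> X) :
  compact [set: X] -> hausdorff_space Y -> continuous f ->
  cancel f g -> cancel g f -> continuous g.
Proof.
move=> cX hY cf fK gK; apply/continuous_closedP => C clC.
have -> : g @^-1` C = f @` C.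
  apply/seteqP; split => y /=.
    by move=> Cgy; exists (g y) => //; exact: gK.
  by move=> [x Cx <-]; rewrite fK.
apply: compact_closed => //.
apply: continuous_compact; first exact/continuous_subspaceT.
exact: (subclosed_compact clC cX).
Qed.

Section Circle.
Context {R : realType}.

Definition turn_point (t : R) : circle R := circle_angle (2 * pi * t).

Lemma val_turn_point t :
  set_val (turn_point t) = (cos (2 * pi * t), sin (2 * pi * t)) :> R * R.
Proof. by []. Qed.

Lemma continuous_turn_point : continuous turn_point.
Proof.
have c2 : continuous (fun t : R => 2 * pi * t).
  by move=> t; apply: cvgM; [exact: cvg_cst|exact: cvg_id].
have := @continuous_comp_initial (circle R) R (R * R)%type
  (@set_val _ (circle R)) turn_point.
apply.
rewrite [X in continuous X](_ : _ =
  (fun t : R => (cos (2 * pi * t), sin (2 * pi * t)))); last exact/funext.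
move=> t; apply: (@cvg_pair _ _ _ _ (nbhs (cos (2 * pi * t)))
  (nbhs (sin (2 * pi * t))) _ _ _ (fun t => cos (2 * pi * t)) (fun t => sin (2 * pi * t))).
  by apply: (continuous_comp_fun c2); exact: continuous_cos.
by apply: (continuous_comp_fun c2); exact: continuous_sin.
Qed.

Lemma circle_val_inj (z w : circle R) : set_val z = set_val w :> R * R -> z = w.
Proof. by move=> h; apply: val_inj. Qed.

Lemma turn_point_add1 t : turn_point (t + 1) = turn_point t.
Proof.
apply: circle_val_inj; rewrite !val_turn_point mulrDr mulr1.
by rewrite mulr_natl sinD2pi cosD2pi.
Qed.

Lemma cos_eq1_turn (r : R) : 0 <= r < 1 -> cos (2 * pi * r) = 1 -> r = 0.
Proof.
move=> /andP[r0 r1] c1; have p0 := @pi_gt0 R.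
have [rh|rh] := leP r 2^-1.
  have : 2 * pi * r = 0.
    apply: cos_inj; rewrite ?in_itv /= ?lexx ?pi_ge0 ?c1 ?cos0 //.
    by apply/andP; split; nra.
  by move/eqP; rewrite mulf_eq0 => /orP[/eqP|/eqP]; nra.
have : 2 * pi * (1 - r) = 0.
  apply: cos_inj; rewrite ?in_itv /= ?lexx ?pi_ge0 //.
    by apply/andP; split; nra.
  rewrite cos0; transitivity (cos (2 * pi * r)) => //.
  by rewrite -[RHS]cosN -[RHS]cosD2pi; congr cos; ring.
by move/eqP; rewrite mulf_eq0 => /orP[/eqP|/eqP]; nra.
Qed.

Lemma turn_point_inj s t : 0 <= s < 1 -> 0 <= t < 1 ->
  turn_point s = turn_point t -> s = t.
Proof.
have H a b : 0 <= a < 1 -> 0 <= b < 1 -> b <= a ->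
    turn_point a = turn_point b -> a = b.
  move=> a01 b01 ba ab; suff : a - b = 0 by lra.
  apply: cos_eq1_turn; first by lra.
  have /(congr1 set_val) := ab; rewrite !val_turn_point => -[ec es].
  by rewrite mulrBr cosB ec es -!expr2 cos2Dsin2.
move=> s01 t01 st; have [ts|/ltW ts] := leP t s; first exact: H.
by apply/esym/H.
Qed.

Lemma turn_point_surj z : exists2 t, 0 <= t < 1 & turn_point t = z.
Proof.
have p0 := @pi_gt0 R; have pn0 : 2 * pi != 0 :> R by lra.
case: z => -[x y] xyS; have := set_mem xyS; rewrite /circle /= => xy1.
have x11 : -1 <= x <= 1 by apply/andP; split; nra.
have ac : cos (acos x) = x by apply: acosK; rewrite in_itv /=.
have a0 := acos_ge0 x11; have api := acos_lepi x11.
have as_ : sin (acos x) = `|y|.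
  by rewrite sin_acos // -xy1 addrAC subrr add0r sqrtr_sqr.
have [y0|y0] := leP 0 y.
  exists (acos x / (2 * pi)).
    by rewrite divr_ge0 ?ltr_pdivrMr //=; lra.
  apply: circle_val_inj; rewrite val_turn_point /= /set_val /=.
  by rewrite mulrC divfK // ac as_ ger0_norm.
have xN1 : acos x != 0.
  apply/eqP => a00; move: as_; rewrite a00 sin0 ltr0_norm // => /eqP.
  by rewrite eq_sym oppr_eq0 lt_eqF.
exists (1 - acos x / (2 * pi)).
  have h : acos x / (2 * pi) < 1 by rewrite ltr_pdivrMr; lra.
  have h2 : 0 < acos x / (2 * pi) by rewrite divr_gt0 // ?lt_neqAle 1?eq_sym ?xN1 //; lra.
  by apply/andP; split; lra.
apply: circle_val_inj; rewrite val_turn_point /= /set_val /=.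
rewrite mulrBr mulr1 [2 * pi * (_ / _)]mulrC divfK // addrC mulr_natl.
by rewrite sinD2pi cosD2pi sinN cosN ac as_ ltr0_norm // opprK.
Qed.

Definition turn (z : circle R) : R :=
  projT1 (cid2 (turn_point_surj z)).

Lemma turn_itv z : 0 <= turn z < 1.
Proof. by rewrite /turn; case: cid2. Qed.

Lemma turnK : cancel turn turn_point.
Proof. by move=> z; rewrite /turn; case: cid2. Qed.

Lemma turn_pointK t : 0 <= t < 1 -> turn (turn_point t) = t.
Proof. by move=> t01; apply: turn_point_inj => //; rewrite ?turn_itv ?turnK. Qed.

Lemma compact_circle : compact [set: circle R].
Proof.
have -> : [set: circle R] = turn_point @` `[0, 1].
  apply/seteqP; split => // z _; exists (turn z); last exact: turnK.
  by rewrite /= in_itv /=; have := turn_itv z; lra.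
apply: continuous_compact; last exact: segment_compact.
exact/continuous_subspaceT/continuous_turn_point.
Qed.

Lemma hausdorff_set_type (T : topologicalType) (A : set T) :
  hausdorff_space T -> hausdorff_space A.
Proof.
move=> hT x y cl; apply: val_inj; apply: hT => B C Bx Cy.
have nB : nbhs x ((@set_val _ A) @^-1` B).
  by have := @initial_continuous A T set_val x B; apply.
have nC : nbhs y ((@set_val _ A) @^-1` C).
  by have := @initial_continuous A T set_val y C; apply.
have [z [Bz Cz]] := cl _ _ nB nC.
by exists (set_val z).
Qed.

Lemma hausdorff_circle : hausdorff_space (circle R).
Proof. exact/hausdorff_set_type/norm_hausdorff. Qed.

(** The circle carries the quotient topology of the line. *)
Lemma continuous_from_circle (T : topologicalType) (f : circle R -> T) :
  continuous (f \o turn_point) -> continuous f.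
Proof.
move=> cf; apply/continuous_closedP => C clC.
have -> : f @^-1` C = turn_point @` ((f \o turn_point) @^-1` C `&` `[0, 1]).
  apply/seteqP; split => z /=.
    move=> Cfz; exists (turn z); last exact: turnK.
    by rewrite turnK; split => //=; rewrite in_itv /=; have := turn_itv z; lra.
  by move=> [t [Ct _] <-].
apply: compact_closed; first exact: hausdorff_circle.
apply: continuous_compact; first exact/continuous_subspaceT/continuous_turn_point.
apply: (subclosed_compact _ (@segment_compact R 0 1)); last by move=> t [].
  apply: closedI; last exact: interval_closed.
  by move/continuous_closedP : cf; apply.
Qed.

End Circle.

(** * Knots as periodic curves *)

Section Curves.
Context {R : realType}.
Implicit Types (g : R -> space3 R) (H K : R -> R).

Definition periodic1 (T : Type) (g : R -> T) := forall t, g (t + 1) = g t.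

Definition simple_curve g :=
  [/\ continuous g, periodic1 g &
      forall s t, 0 <= s < 1 -> 0 <= t < 1 -> g s = g t -> s = t].

(** Lifts of the orientation preserving homeomorphisms of the circle, with angles
    counted in turns. *)
Definition circle_lift H :=
  [/\ continuous H, {homo H : s t / s < t} & forall t, H (t + 1) = H t + 1].

(** The induction runs in both directions; stepping backwards cancels [f]. *)
Lemma shift_int (T : Type) (g : R -> T) (f : T -> T) :
  (forall t, g (t + 1) = f (g t)) -> injective f ->
  forall (h : int -> T -> T), (forall n x, h (n + 1) x = f (h n x)) ->
  (forall x, h 0 x = x) -> forall (n : int) t, g (t + n%:~R) = h n (g t).
Proof.
move=> gf fi h hS h0 n t.
have P (m : nat) : g (t + m%:~R) = h m%:Z (g t).
  elim: m => [|m IH]; first by rewrite addr0 h0.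
  have -> : t + m.+1%:~R = t + m%:~R + 1 :> R by rewrite intS rmorphD /=; ring.
  by rewrite gf IH intS [1 + _]addrC hS.
have N (m : nat) : g (t - m%:~R) = h (- m%:Z) (g t).
  elim: m => [|m IH]; first by rewrite subr0 oppr0 h0.
  apply: fi; rewrite -gf -hS -addrA.
  have -> : - (m.+1)%:~R + 1 = - m%:~R :> R by rewrite intS rmorphD /=; ring.
  by rewrite IH; congr (h _ _); rewrite intS; ring.
case: n => m; first exact: P.
by rewrite NegzE rmorphN /= N.
Qed.

Lemma periodic1_int (T : Type) (g : R -> T) : periodic1 g ->
  forall (n : int) t, g (t + n%:~R) = g t.
Proof.
by move=> gp n t; rewrite (@shift_int _ g id gp _ (fun _ x => x)).
Qed.

Lemma circle_lift_int H : circle_lift H ->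
  forall (n : int) t, H (t + n%:~R) = H t + n%:~R.
Proof.
move=> [_ _ H1] n t.
rewrite (@shift_int _ H (fun x => x + 1) H1 _ (fun n x => x + n%:~R)) //.
- exact: addIr.
- by move=> m x; rewrite rmorphD /= addrA.
- by move=> x; rewrite addr0.
Qed.

Lemma frac_itv (t : R) : 0 <= t - (Num.floor t)%:~R < 1.
Proof.
have := floor_itv t; rewrite rmorphD /= => h; lra.
Qed.

Lemma turn_point_int (n : int) (t : R) : turn_point (t + n%:~R) = turn_point t.
Proof. exact/periodic1_int/turn_point_add1. Qed.

Lemma simple_curve_eq g s t : simple_curve g -> g s = g t ->
  exists n : int, s = t + n%:~R.
Proof.
move=> [_ gp gi] gst; exists (Num.floor s - Num.floor t).
have : s - (Num.floor s)%:~R = t - (Num.floor t)%:~R.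
  apply: gi; rewrite ?frac_itv // -!rmorphN /= !periodic1_int //.
rewrite rmorphB /=; lra.
Qed.

Definition on_circle (T : Type) (g : R -> T) (z : circle R) : T := g (turn z).

Lemma turn_point_turn (t : R) : exists n : int, turn (turn_point t) = t + n%:~R.
Proof.
exists (- Num.floor t).
have -> : turn_point t = turn_point (t + (- Num.floor t)%:~R).
  by rewrite turn_point_int.
by rewrite turn_pointK // rmorphN /=; exact: frac_itv.
Qed.

Lemma on_circleE (T : Type) (g : R -> T) t : periodic1 g ->
  on_circle g (turn_point t) = g t.
Proof.
move=> gp; rewrite /on_circle; have [n ->] := turn_point_turn t.
exact: periodic1_int.
Qed.

(** The orientation is the direction of increasing parameters. *)
Definition knot_of g : oriented_set R :=
  OrientedSet (range g) [set on_circle g \o h | h in @orientation_preserving R].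

Lemma circle_lift_comp H K :
  circle_lift H -> circle_lift K -> circle_lift (H \o K).
Proof.
move=> [cH hH H1] [cK hK K1]; split.
- exact: continuous_comp_fun.
- by move=> s t st; apply/hH/hK.
- by move=> t /=; rewrite K1 H1.
Qed.

Lemma circle_lift_addr (c : R) : circle_lift (fun t => t + c).
Proof.
split; last by move=> t; rewrite addrAC.
  by move=> t; apply: cvgD; [exact: cvg_id|exact: cvg_cst].
by move=> s t st; rewrite ltrD2r.
Qed.

(** A jump of an increasing function would leave a gap in its range. *)
Lemma increasing_surj_continuous (K : R -> R) :
  {homo K : s t / s < t} -> (forall t, exists y, K y = t) -> continuous K.
Proof.
move=> hK sK y; apply/continuous_at_dist => e e0.
have leK := ltW_homo hK.
have [a aE] := sK (K y - e / 2); have [b bE] := sK (K y + e / 2).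
have ay : a < y by rewrite ltNge; apply/negP => /leK; lra.
have yb : y < b by rewrite ltNge; apply/negP => /leK; lra.
exists (Num.min (y - a) (b - y)); first by rewrite lt_min; apply/andP; split; lra.
move=> x; rewrite lt_min !ltr_norml => /andP[/andP[_ xa] /andP[xb _]].
have /leK h1 : a <= x by lra.
have /leK h2 : x <= b by lra.
lra.
Qed.

Lemma circle_lift_inverse H : circle_lift H ->
  exists2 K, circle_lift K & cancel H K /\ cancel K H.
Proof.
move=> LH; have [cH hH H1] := LH.
have leH := ltW_homo hH.
have ex y : exists t, H t = y.
  pose n := Num.floor (y - H 0).
  have := floor_itv (y - H 0); rewrite -/n rmorphD /= => nI.
  have Hn (m : int) : H m%:~R = H 0 + m%:~R by rewrite -(circle_lift_int LH) add0r.
  have [|||t _ <-] := @IVT R H n%:~R (n + 1)%:~R y; last by exists t.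
  - by rewrite ler_int lerDl.
  - exact: continuous_subspaceT.
  - rewrite !Hn rmorphD /= minElt maxElt !ltrD2l ltrDl ltr01 /=; lra.
pose K y := projT1 (cid (ex y)).
have KK : cancel K H by move=> y; rewrite /K; case: cid.
have Hinj : injective H.
  move=> s t st; case: (ltgtP s t) => // /hH; by rewrite st ltxx.
have HK : cancel H K by move=> t; apply: Hinj; rewrite KK.
have hK : {homo K : s t / s < t}.
  move=> s t st; rewrite ltNge; apply/negP => /leH.
  by rewrite !KK leNgt st.
exists K; split => //.
  by apply: increasing_surj_continuous => // t; exists (H t).
by move=> t; apply: Hinj; rewrite H1 !KK.
Qed.

Definition circle_map H (z : circle R) := turn_point (H (turn z)).

Lemma circle_mapE H (t : R) : circle_lift H ->
  circle_map H (turn_point t) = turn_point (H t).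
Proof.
move=> LH; rewrite /circle_map; have [n ->] := turn_point_turn t.
by rewrite (circle_lift_int LH) turn_point_int.
Qed.

Lemma circle_map_cancel H K : circle_lift H -> circle_lift K ->
  cancel H K -> cancel (circle_map H) (circle_map K).
Proof.
by move=> LH LK HK z; rewrite -[z]turnK !circle_mapE // HK.
Qed.

Lemma continuous_circle_map H : circle_lift H -> continuous (circle_map H).
Proof.
move=> LH; apply: continuous_from_circle.
rewrite (_ : _ \o _ = turn_point \o H).
  apply: continuous_comp_fun; last exact: continuous_turn_point.
  by case: LH.
by apply/funext => t /=; rewrite circle_mapE.
Qed.

Lemma orientation_preserving_circle_map H :
  circle_lift H -> orientation_preserving (circle_map H).
Proof.
move=> LH; have [K LK [HK KH]] := circle_lift_inverse LH.
have p0 := @pi_gt0 R; have pn0 : 2 * pi != 0 :> R by lra.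
split.
  split; first exact: continuous_circle_map.
  exists (circle_map K); split; first exact: continuous_circle_map.
    exact: circle_map_cancel.
  exact: circle_map_cancel.
have [cH hH H1] := LH.
exists (fun t => 2 * pi * H (t / (2 * pi))); split.
- have c1 : continuous (fun t : R => t / (2 * pi)).
    by move=> t; apply: cvgM; [exact: cvg_id|exact: cvg_cst].
  have c3 : continuous (fun t : R => H (t / (2 * pi))).
    exact: continuous_comp_fun c1 cH.
  move=> t; apply: cvgM; first exact: cvg_cst.
  exact: c3.
- move=> s t st; rewrite ltr_pM2l; last by lra.
  by apply: hH; rewrite ltr_pM2r // invr_gt0; lra.
- move=> t; have := circle_mapE (t / (2 * pi)) LH.
  by rewrite /turn_point mulrC divfK.
Qed.

Lemma homeomorphism_comp (X Y Z : topologicalType) (f : X -> Y) (h : Y -> Z) :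
  homeomorphism f -> homeomorphism h -> homeomorphism (h \o f).
Proof.
move=> [cf [f' [cf' fK f'K]]] [ch [h' [ch' hK h'K]]]; split.
  exact: continuous_comp_fun.
exists (f' \o h'); split.
- exact: continuous_comp_fun.
- exact: can_comp.
- exact: can_comp.
Qed.

Lemma orientation_preserving_comp (h k : circle R -> circle R) :
  orientation_preserving h -> orientation_preserving k ->
  orientation_preserving (h \o k).
Proof.
move=> [hh [H [cH hH HE]]] [kk [K [cK hK KE]]]; split.
  exact: homeomorphism_comp.
exists (H \o K); split; first exact: continuous_comp_fun.
  by move=> s t st; apply/hH/hK.
by move=> t /=; rewrite KE HE.
Qed.

Lemma int_small (n : int) : -1 < (n%:~R : R) < 1 -> n = 0.
Proof.
move=> /andP[h1 h2]; have : (-1 < n)%R by rewrite -(@ltr_int R) rmorphN /=.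
have : (n < 1)%R by rewrite -(@ltr_int R).
lia.
Qed.

Lemma simple_curve_lt1 g s t : simple_curve g -> g s = g t -> `|s - t| < 1 -> s = t.
Proof.
move=> Sg /(simple_curve_eq Sg)[k kE]; rewrite ltr_norml => h.
have k0 : k = 0 by apply: int_small; lra.
by rewrite kE k0 addr0.
Qed.

Lemma simple_curve_lift g H :
  simple_curve g -> circle_lift H -> simple_curve (g \o H).
Proof.
move=> Sg LH; have [cg gp gi] := Sg; have [cH hH H1] := LH; split.
- exact: continuous_comp_fun.
- by move=> t /=; rewrite H1 gp.
- move=> s t s01 t01 /= /(simple_curve_eq Sg) [n].
  have [K LK [HK _]] := circle_lift_inverse LH.
  move=> /(congr1 K); rewrite -(circle_lift_int LH) !HK => st.
  suff n0 : n = 0 by rewrite st n0 addr0.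
  by apply: int_small; lra.
Qed.

(** Precomposing with a lift only changes the representative of the class of
    parametrizations. *)
Lemma knot_of_lift g H :
  periodic1 g -> circle_lift H -> knot_of (g \o H) = knot_of g.
Proof.
move=> gp LH; have [K LK [HK KH]] := circle_lift_inverse LH.
have E : on_circle (g \o H) = on_circle g \o circle_map H.
  by apply/funext => z /=; rewrite /circle_map on_circleE.
rewrite /knot_of; congr OrientedSet.
  apply/seteqP; split => x /=; first by move=> [t _ <-]; exists (H t).
  by move=> [t _ <-]; exists (K t) => //=; rewrite KH.
apply/seteqP; split => x /= [h oh <-].
  exists (circle_map H \o h); last by rewrite E.
  by apply: orientation_preserving_comp => //; exact: orientation_preserving_circle_map.
exists (circle_map K \o h).
  by apply: orientation_preserving_comp => //; exact: orientation_preserving_circle_map.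
by rewrite E; apply/funext => z /=; rewrite circle_map_cancel.
Qed.

Lemma oriented_image_knot_of (F : space3 R -> space3 R) g :
  oriented_image F (knot_of g) = knot_of (F \o g).
Proof.
rewrite /knot_of /oriented_image /=; congr OrientedSet.
  by apply/seteqP; split => x /=; [move=> [_ [t _ <-] <-]; exists t|
    move=> [t _ <-]; exists (g t) => //; exists t].
apply/seteqP; split => x /=.
  by move=> [_ [h oh <-] <-]; exists h.
by move=> [h oh <-]; exists (on_circle g \o h) => //; exists h.
Qed.

(** A continuous bijection from a compact space onto a Hausdorff space is a
    homeomorphism. *)
Lemma parametrizes_on_circle g : simple_curve g ->
  parametrizes (on_circle g) (range g).
Proof.
move=> Sg; have [cg gp gi] := Sg.
have inr z : on_circle g z \in range g by apply/mem_set; exists (turn z).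
pose h z : range g := exist _ (on_circle g z) (inr z).
have ex (x : range g) : exists z, on_circle g z = set_val x.
  case: x => x xr; have [t _ tx] := set_mem xr.
  by exists (turn_point t); rewrite on_circleE.
pose k x := projT1 (cid (ex x)).
have hinj : injective h.
  move=> z w [] zw; rewrite -[z]turnK -[w]turnK; congr turn_point.
  by apply: gi => //; exact: turn_itv.
have kK : cancel k h.
  by move=> x; apply: val_inj; rewrite /k; case: cid.
have hK : cancel h k by move=> z; apply: hinj; rewrite kK.
have ch : continuous h.
  have := @continuous_comp_initial (range g) (circle R) (space3 R)
    (@set_val _ (range g)) h; apply.
  apply: continuous_from_circle; rewrite (_ : _ \o _ = g) //.
  by apply/funext => t /=; rewrite -[RHS](on_circleE _ gp).
exists h; split => //; split => //; exists k; split => //.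
apply: (compact_bijection_inverse (@compact_circle R) _ ch hK kK).
exact/hausdorff_set_type/norm_hausdorff.
Qed.

Lemma is_oriented_knot_of g : simple_curve g -> is_oriented_knot (knot_of g).
Proof. by move=> Sg; exists (on_circle g); split => //; exact: parametrizes_on_circle. Qed.

Lemma parametrizes_curve (p : circle R -> space3 R) (C : set (space3 R)) :
  parametrizes p C ->
  simple_curve (p \o turn_point) /\ range (p \o turn_point) = C.
Proof.
move=> [h [[ch [k [ck hk kh]]] ph]].
split; first split.
- apply: continuous_comp_fun; first exact: continuous_turn_point.
  rewrite (_ : p = @set_val _ C \o h); last exact/funext.
  by apply: continuous_comp_fun; [exact: ch|exact: initial_continuous].
- by move=> t /=; rewrite turn_point_add1.
- move=> s t s01 t01 /=; rewrite !ph => /val_inj /(congr1 k).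
  by rewrite !hk => /turn_point_inj; apply.
apply/seteqP; split => x /=.
  by move=> [t _ <-]; rewrite ph; exact/set_mem/valP.
move=> Cx; exists (turn (k (exist _ x (mem_set Cx)))) => //.
by rewrite turnK ph kh.
Qed.

Lemma oriented_knot_curve (k : oriented_set R) : is_oriented_knot k ->
  exists2 g, simple_curve g & k = knot_of g.
Proof.
case: k => C O [p [/= pC ->]]; have [Sg rg] := parametrizes_curve pC.
exists (p \o turn_point) => //; rewrite /knot_of rg; congr OrientedSet.
congr (image _ _); apply/funext => h; apply/funext => z /=.
by rewrite /on_circle /= turnK.
Qed.

End Curves.

(** * Ends of ambient isotopies *)

Section Isotopies.
Context {R : realType}.
Notation V := (space3 R).
Implicit Types (Phi : V -> V) (g : R -> V).

(** Joint continuity of the inverses makes these maps a group. Times outside the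
    unit interval are allowed in order to have plain continuity on a product. *)
Definition isotopy_end Phi := exists F G : R -> V -> V,
  [/\ continuous (fun z : R * V => F z.1 z.2) /\
      continuous (fun z : R * V => G z.1 z.2),
      forall t, cancel (F t) (G t), forall t, cancel (G t) (F t),
      F 0 =1 id & F 1 =1 Phi].

Definition isotopic_curves g g' := exists2 Phi, isotopy_end Phi & g' = Phi \o g.

Lemma continuous_pair_comp (T U W X : topologicalType) (F : U * W -> X)
    (a : T -> U) (b : T -> W) :
  continuous F -> continuous a -> continuous b ->
  continuous (fun t => F (a t, b t)).
Proof.
move=> cF ca cb t; apply: (continuous_comp (f := fun t => (a t, b t)) (g := F)).
  by apply: (@cvg_pair _ _ _ _ (nbhs (a t)) (nbhs (b t))); [exact: ca|exact: cb].
exact: cF.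
Qed.

Lemma continuous_slice (F : R -> V -> V) t :
  continuous (fun z : R * V => F z.1 z.2) -> continuous (F t).
Proof.
move=> cF; apply: (@continuous_pair_comp _ _ _ _ (fun z : R * V => F z.1 z.2) (cst t) id) => //.
  exact: cst_continuous.
by move=> p; exact: cvg_id.
Qed.

Lemma isotopy_end_comp Phi Psi :
  isotopy_end Phi -> isotopy_end Psi -> isotopy_end (Psi \o Phi).
Proof.
move=> [F [F' [[cF cF'] FK F'K F0 F1]]] [G [G' [[cG cG'] GK G'K G0 G1]]].
have cfst : continuous (fun z : R * V => z.1) by move=> z; exact: cvg_fst.
exists (fun t => G t \o F t), (fun t => F' t \o G' t); split.
- split.
    exact: (@continuous_pair_comp _ _ _ _ (fun z : R * V => G z.1 z.2) fst
      (fun z : R * V => F z.1 z.2)).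
  exact: (@continuous_pair_comp _ _ _ _ (fun z : R * V => F' z.1 z.2) fst
      (fun z : R * V => G' z.1 z.2)).
- by move=> t; exact: can_comp.
- by move=> t; exact: can_comp.
- by move=> p /=; rewrite F0 G0.
- by move=> p /=; rewrite F1 G1.
Qed.

Lemma isotopy_end_inverse Phi : isotopy_end Phi ->
  exists2 Psi, isotopy_end Psi & cancel Phi Psi /\ cancel Psi Phi.
Proof.
move=> [F [F' [[cF cF'] FK F'K F0 F1]]]; exists (F' 1).
  exists F', F; split => // p; by rewrite -[LHS]F0 F'K.
by split=> p; rewrite -F1 ?FK ?F'K.
Qed.

Lemma isotopy_end_inj Phi : isotopy_end Phi -> injective Phi.
Proof. by move=> /isotopy_end_inverse[Psi _ [/can_inj]]. Qed.

Lemma isotopy_end_continuous Phi : isotopy_end Phi -> continuous Phi.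
Proof.
move=> [F [_ [[cF _] _ _ _ F1]]].
rewrite (_ : Phi = F 1); last by apply/funext => p; rewrite F1.
exact: continuous_slice.
Qed.

Lemma isotopy_end_ambient Phi : isotopy_end Phi ->
  exists F, ambient_isotopy F /\ F 1 = Phi.
Proof.
move=> [F [F' [[cF cF'] FK F'K F0 F1]]]; exists F; split; last exact/funext.
split => //; first exact: continuous_subspaceT.
move=> t _; split; last exists (F' t); last split => //.
  exact: continuous_slice.
exact: continuous_slice.
Qed.

Lemma isotopy_end_id : isotopy_end id.
Proof.
exists (fun=> id), (fun=> id); split => //.
by split => z; exact: cvg_snd.
Qed.

Lemma isotopic_curves_simple g g' :
  isotopic_curves g g' -> simple_curve g -> simple_curve g'.
Proof.
move=> [F eF ->] [cg gp gi]; split.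
- by apply: continuous_comp_fun => //; exact: isotopy_end_continuous.
- by move=> t /=; rewrite gp.
- by move=> s t s01 t01 /= /(isotopy_end_inj eF) /gi; apply.
Qed.

(** * Elementary isotopies *)

(** Freezes an isotopy outside the unit interval, where its formula may fail to be
    invertible. *)
Definition clamp01 (t : R) := Num.max 0 (Num.min 1 t).

Lemma clamp01_itv t : 0 <= clamp01 t <= 1.
Proof. by rewrite /clamp01 le_max lexx /= ge_max ler01 /= ge_min lexx. Qed.

Lemma clamp01_0 : clamp01 0 = 0.
Proof. by rewrite /clamp01 minEle maxEle ler10 lexx. Qed.

Lemma clamp01_1 : clamp01 1 = 1.
Proof. by rewrite /clamp01 minEle maxEle lexx ler01. Qed.

Lemma continuous_clamp01 : continuous clamp01.
Proof.
apply: continuous_real_max; first exact: cst_continuous.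
by apply: continuous_real_min => t; [exact: cst_continuous|exact: cvg_id].
Qed.

Lemma continuous_clamp_time : continuous (fun z : R * V => clamp01 z.1).
Proof.
apply: continuous_comp_fun; last exact: continuous_clamp01.
by move=> z; exact: cvg_fst.
Qed.

Lemma continuous_space : continuous (fun z : R * V => z.2).
Proof. by move=> z; exact: cvg_snd. Qed.

Lemma isotopy_end_translation (v : V) : isotopy_end (fun p => p + v).
Proof.
have ct : continuous (fun z : R * V => z.1 *: v).
  by move=> z; apply: cvgZ; [exact: cvg_fst|exact: cvg_cst].
exists (fun t p => p + t *: v), (fun t p => p - t *: v); split.
- split=> z; first by apply: cvgD; [exact: cvg_snd|exact: ct].
  by apply: cvgB; [exact: cvg_snd|exact: ct].
- by move=> t p; rewrite addrK.
- by move=> t p; rewrite subrK.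
- by move=> p; rewrite scale0r addr0.
- by move=> p; rewrite scale1r.
Qed.

Definition linform (a b c : R) (p : V) := a * xco p + b * yco p + c * zco p.

Lemma linform_addZ a b c p k v :
  linform a b c (p + k *: v) = linform a b c p + k * linform a b c v.
Proof. rewrite /linform !coE; ring. Qed.

Lemma continuous_linform a b c : continuous (linform a b c).
Proof.
have cm k (f : V -> R) : continuous f -> continuous (fun p => k * f p).
  by move=> cf; apply: continuous_real_mul => //; exact: cst_continuous.
apply: continuous_real_add; first apply: continuous_real_add.
- exact: (cm _ _ continuous_xco).
- exact: (cm _ _ continuous_yco).
- exact: (cm _ _ continuous_zco).
Qed.

(** The form is constant along [v], so the shear by [- v] is the inverse. *)
Lemma isotopy_end_shear a b c (v : V) : linform a b c v = 0 ->
  isotopy_end (fun p => p + linform a b c p *: v).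
Proof.
move=> lv.
have ct : continuous (fun z : R * V => (z.1 * linform a b c z.2) *: v).
  move=> z; apply: cvgZ; last exact: cvg_cst.
  apply: cvgM; first exact: cvg_fst.
  by apply: (continuous_comp_fun continuous_space); exact: continuous_linform.
exists (fun t p => p + (t * linform a b c p) *: v),
  (fun t p => p - (t * linform a b c p) *: v); split.
- split=> z; first by apply: cvgD; [exact: cvg_snd|exact: ct].
  by apply: cvgB; [exact: cvg_snd|exact: ct].
- by move=> t p; rewrite linform_addZ lv mulr0 addr0 addrK.
- by move=> t p; rewrite -scaleNr linform_addZ lv mulr0 addr0 scaleNr subrK.
- by move=> p; rewrite mul0r scale0r addr0.
- by move=> p; rewrite mul1r.
Qed.

Lemma isotopy_end_homothety (k : R) : 0 < k -> isotopy_end (fun p => k *: p).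
Proof.
move=> k0; pose r (t : R) := 1 + clamp01 t * (k - 1).
have r0 t : 0 < r t by have := clamp01_itv t; rewrite /r; nra.
have cr : continuous (fun z : R * V => r z.1).
  move=> z; apply: cvgD; first exact: cvg_cst.
  by apply: cvgM; [exact: continuous_clamp_time|exact: cvg_cst].
exists (fun t p => r t *: p), (fun t p => (r t)^-1 *: p); split.
- split=> z; apply: cvgZ; try exact: cvg_snd; first exact: cr.
  by apply: cvgV; [rewrite gt_eqF|exact: cr].
- by move=> t p; rewrite scalerA mulVf ?scale1r // gt_eqF.
- by move=> t p; rewrite scalerA divff ?scale1r // gt_eqF.
- by move=> p; rewrite /r clamp01_0 mul0r addr0 scale1r.
- by move=> p; rewrite /r clamp01_1 mul1r addrC subrK.
Qed.

(** Each horizontal plane is scaled about the vertical axis by its own factor,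
    which gives a knot a prescribed profile. *)
Lemma isotopy_end_widen (w : R -> R) : (forall z, 0 < w z) -> continuous w ->
  isotopy_end (fun p => vec3 (w (zco p) * xco p) (w (zco p) * yco p) (zco p)).
Proof.
move=> w0 cw; pose r (t z : R) := 1 + clamp01 t * (w z - 1).
have r0 t z : 0 < r t z.
  by have := clamp01_itv t; have := w0 z; rewrite /r; nra.
have cx := continuous_comp_fun continuous_space (@continuous_xco R).
have cy := continuous_comp_fun continuous_space (@continuous_yco R).
have cz := continuous_comp_fun continuous_space (@continuous_zco R).
have cr : continuous (fun z : R * V => r z.1 (zco z.2)).
  move=> z; apply: cvgD; first exact: cvg_cst.
  apply: cvgM; first exact: continuous_clamp_time.
  apply: cvgB; last exact: cvg_cst.
  by apply: (continuous_comp_fun cz); exact: cw.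
have cri : continuous (fun z : R * V => (r z.1 (zco z.2))^-1).
  by move=> z; apply: cvgV; [rewrite gt_eqF|exact: cr].
exists (fun t p => vec3 (r t (zco p) * xco p) (r t (zco p) * yco p) (zco p)),
  (fun t p => vec3 ((r t (zco p))^-1 * xco p) ((r t (zco p))^-1 * yco p) (zco p)).
split.
- split; (apply: continuous_vec3 => //; apply: continuous_real_mul => //).
- by move=> t p; apply: vec3P; rewrite !coE // mulKf // gt_eqF.
- by move=> t p; apply: vec3P; rewrite !coE // mulVKf // gt_eqF.
- by move=> p; apply: vec3P; rewrite !coE // /r clamp01_0; ring.
- by move=> p; apply: vec3P; rewrite !coE // /r clamp01_1; ring.
Qed.

(** Lengthens the slab of thickness [h] below the plane [z = 0] by the factor [k]
    and only translates what hangs below it. *)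
Definition stretch (k h z : R) := Num.max (k * z) (z - (k - 1) * h).

Lemma stretchK k h : 1 <= k -> cancel (stretch k h)
  (fun y => Num.min (y / k) (y + (k - 1) * h)).
Proof.
move=> k1 z; rewrite /stretch.
have k0 : 0 < k by lra.
have kn0 : k != 0 by rewrite gt_eqF.
have [zh|zh] := leP (z - (k - 1) * h) (k * z).
  have -> : k * z / k = z by field.
  rewrite minEle; case: leP => //.
  by move=> zh'; exfalso; nra.
have -> : z - (k - 1) * h + (k - 1) * h = z by ring.
rewrite minEle ler_pdivrMr //; case: leP => // zh'; nra.
Qed.

Lemma stretchVK k h : 1 <= k ->
  cancel (fun y => Num.min (y / k) (y + (k - 1) * h)) (stretch k h).
Proof.
move=> k1 y; rewrite /stretch.
have k0 : 0 < k by lra.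
have kn0 : k != 0 by rewrite gt_eqF.
rewrite [Num.min _ _]minEle ler_pdivrMr //; case: leP => yh.
  have -> : k * (y / k) = y by field.
  rewrite maxEle; case: leP => // yh'.
  have : y * k <= (y / k - (k - 1) * h) * k by rewrite ler_pM2r.
  rewrite mulrBl divfK // => yk.
  by apply: (mulIf kn0); rewrite mulrBl divfK //; nra.
by rewrite maxEle; case: leP => // yh'; nra.
Qed.

Lemma isotopy_end_stretch (k h : R) : 1 <= k ->
  isotopy_end (fun p => vec3 (xco p) (yco p) (stretch k h (zco p))).
Proof.
move=> k1; pose r (t : R) := 1 + clamp01 t * (k - 1).
have r1 t : 1 <= r t by have := clamp01_itv t; rewrite /r; nra.
have cx := continuous_comp_fun continuous_space (@continuous_xco R).
have cy := continuous_comp_fun continuous_space (@continuous_yco R).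
have cz := continuous_comp_fun continuous_space (@continuous_zco R).
have cr : continuous (fun z : R * V => r z.1).
  move=> z; apply: cvgD; first exact: cvg_cst.
  by apply: cvgM; [exact: continuous_clamp_time|exact: cvg_cst].
have crh : continuous (fun z : R * V => (r z.1 - 1) * h).
  by move=> z; apply: cvgM; [apply: cvgB; [exact: cr|exact: cvg_cst]|exact: cvg_cst].
have cri : continuous (fun z : R * V => (r z.1)^-1).
  by move=> z; apply: cvgV; [rewrite gt_eqF // (lt_le_trans _ (r1 _))|exact: cr].
exists (fun t p => vec3 (xco p) (yco p) (stretch (r t) h (zco p))),
  (fun t p => vec3 (xco p) (yco p)
     (Num.min (zco p / r t) (zco p + (r t - 1) * h))).
split.
- split; apply: continuous_vec3 => //.
    apply: continuous_real_max; first exact: continuous_real_mul.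
    exact: continuous_real_sub.
  apply: continuous_real_min; first exact: continuous_real_mul.
  exact: continuous_real_add.
- by move=> t p; apply: vec3P; rewrite !coE // stretchK.
- by move=> t p; apply: vec3P; rewrite !coE // stretchVK.
- move=> p; apply: vec3P; rewrite !coE // /r clamp01_0 mul0r addr0 /stretch.
  by rewrite subrr mul0r subr0 mul1r maxxx.
- by move=> p; apply: vec3P; rewrite !coE // /r clamp01_1 mul1r addrC subrK.
Qed.

End Isotopies.

(** * Lipschitz perturbations of a curve *)

(** Joins completeness to the norm, as the contraction principle requires. *)
HB.instance Definition _ (R : realType) := Complete.on 'rV[R]_3.

Section LipschitzPerturbation.
Context {R : realType}.
Notation V := (space3 R).

Definition lip (X Y : normedModType R) (L : R) (f : X -> Y) :=
  forall x y, `|f x - f y| <= L * `|x - y|.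

Lemma lip_continuous (X Y : normedModType R) L (f : X -> Y) :
  lip L f -> continuous f.
Proof.
move=> fL x; apply/continuous_at_dist => e e0.
exists (e / (`|L| + 1)); first by rewrite divr_gt0 // ltr_wpDl.
move=> y; rewrite ltr_pdivlMr ?ltr_wpDl // => h; apply: le_lt_trans h.
apply: (le_trans (fL x y)); rewrite mulrC ler_wpM2l //.
by rewrite (le_trans (ler_norm _)) // lerDl.
Qed.

Lemma contraction_has_fixpoint (X : completeNormedModType R) (f : X -> X) (q : R) :
  0 <= q < 1 -> lip q f -> exists p, p = f p.
Proof.
move=> /andP[q0 q1] fq.
have fT : set_fun [set: X] [set: X] f by [].
pose ff := mkfun_fun fT.
have [|||p _ fp] := @banach_fixed_point R X setT ff.
- exists (NngNum q0); split => //= -[x y] _ /=; exact: fq.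
- exact: closedT.
- by exists 0.
- by exists p.
Qed.

(** Each [id + t D] is bijective by the contraction principle. Its inverse is
    Lipschitz in the point and, at each point, in the time, hence jointly
    continuous. *)
Lemma isotopy_end_lip (D : V -> V) (L : R) : 0 <= L < 1 -> lip L D ->
  isotopy_end (fun p => p + D p).
Proof.
move=> /andP[L0 L1] DL.
have cD := lip_continuous DL.
have lipc t q : lip L (fun p => q - clamp01 t *: D p).
  move=> x y; have /andP[c0 c1] := clamp01_itv t.
  have -> : q - clamp01 t *: D x - (q - clamp01 t *: D y) = clamp01 t *: (D y - D x).
    by apply/rowP => j; rewrite !mxE; ring.
  rewrite normrZ ger0_norm // distrC -[leRHS]mul1r; exact: ler_pM.
have ex t q : exists p, p + clamp01 t *: D p = q.
  have L01 : 0 <= L < 1 by rewrite L0.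
  have [p pE] := @contraction_has_fixpoint (space3 R) _ L L01 (lipc t q).
  by exists p; rewrite {1}pE subrK.
pose G t q := projT1 (cid (ex t q)).
have GE t q : G t q + clamp01 t *: D (G t q) = q by rewrite /G; case: cid.
have Glip t q t' q' : (1 - L) * `|G t' q' - G t q| <=
    `|q' - q| + `|clamp01 t' - clamp01 t| * `|D (G t q)|.
  set x := G t q; set x' := G t' q'.
  have /andP[c0 c1] := clamp01_itv t'.
  have E : x' - x = (q' - q) + (clamp01 t - clamp01 t') *: D x
      + clamp01 t' *: (D x - D x').
    rewrite -[in RHS](GE t q) -[in RHS](GE t' q') -/x -/x'.
    by apply/rowP => j; rewrite !mxE; ring.
  have h1 : `|clamp01 t' *: (D x - D x')| <= L * `|x' - x|.
    rewrite normrZ ger0_norm // -[leRHS]mul1r; apply: ler_pM => //.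
    by rewrite distrC; exact: DL.
  have h2 := ler_normD (q' - q + (clamp01 t - clamp01 t') *: D x)
    (clamp01 t' *: (D x - D x')).
  have h3 := ler_normD (q' - q) ((clamp01 t - clamp01 t') *: D x).
  rewrite -E in h2; rewrite normrZ [`|clamp01 t - _|]distrC in h3.
  by rewrite mulrBl mul1r; lra.
have cc := @continuous_clamp_time R.
have cs := @continuous_space R.
exists (fun t p => p + clamp01 t *: D p), G; split.
- split.
    move=> z; apply: cvgD; first exact: cs.
    apply: cvgZ; first exact: cc.
    exact: (continuous_comp_fun cs cD).
  move=> z; apply/cvgrPdist_lt => e e0.
  have c1 : continuous (fun w : R * V => `|w.2 - z.2| + `|clamp01 w.1 - clamp01 z.1|
      * `|D (G z.1 z.2)|).
    move=> w; apply: cvgD.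
      by apply: cvg_norm; apply: cvgB; [exact: cs|exact: cvg_cst].
    apply: cvgM; last exact: cvg_cst.
    by apply: cvg_norm; apply: cvgB; [exact: cc|exact: cvg_cst].
  have e1 : 0 < (1 - L) * e by rewrite mulr_gt0 // subr_gt0.
  have /cvgrPdist_lt /(_ _ e1) := c1 z.
  rewrite !subrr !normr0 mul0r addr0; apply: filterS => w /=.
  rewrite sub0r normrN ger0_norm ?addr_ge0 ?mulr_ge0 //.
  move=> h; rewrite distrC -(@ltr_pM2l _ (1 - L)) ?subr_gt0 //.
  exact: le_lt_trans (Glip _ _ _ _) h.
- move=> t p; set q := p + _; have E := GE t q.
  have /andP[c0 c1] := clamp01_itv t.
  have h : G t q - p = clamp01 t *: (D p - D (G t q)).
    rewrite scalerBr -[in LHS](addrK (clamp01 t *: D (G t q)) (G t q)) E /q.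
    by rewrite addrAC [p + _]addrC addrK.
  apply/eqP; rewrite -subr_eq0 -normr_le0.
  have h1 : `|G t q - p| <= L * `|G t q - p|.
    rewrite {1}h normrZ ger0_norm // -[leRHS]mul1r; apply: ler_pM => //.
    by rewrite distrC; exact: DL.
  have := normr_ge0 (G t q - p); nra.
- by move=> t q; exact: GE.
- by move=> p; rewrite clamp01_0 scale0r addr0.
- by move=> p; rewrite clamp01_1 scale1r.
Qed.

(** McShane: the infimum of the cones [d s + k * `|x - c s|] extends the
    function [c s |-> d s] with the same constant. *)
Lemma mcshane (X : normedModType R) (S : Type) (s0 : S) (c : S -> X) (d : S -> R)
    (k : R) : 0 <= k -> (forall s t, `|d s - d t| <= k * `|c s - c t|) ->
  exists2 F : X -> R, (forall s, F (c s) = d s) & lip k F.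
Proof.
move=> k0 H; pose A x := [set d s + k * `|x - c s| | s in [set: S]].
have A0 x : A x !=set0 by exists (d s0 + k * `|x - c s0|), s0.
have lbA x : has_lbound (A x).
  exists (d s0 - k * `|x - c s0|) => _ [s _ <-].
  have h1 := ler_normB (x - c s0) (x - c s).
  have := H s0 s; have := ler_norm (d s0 - d s).
  have -> : c s0 - c s = (x - c s) - (x - c s0) by rewrite opprB [RHS]addrC addrA subrK.
  have := ler_normB (x - c s) (x - c s0); nra.
exists (fun x => inf (A x)).
  move=> s; apply/eqP; rewrite eq_le; apply/andP; split.
    apply: ge_inf; first exact: lbA.
    by exists s => //; rewrite subrr normr0 mulr0 addr0.
  apply: lb_le_inf; first exact: A0.
  by move=> _ [t _ <-]; have := H s t; have := ler_norm (d s - d t); lra.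
have P x y : inf (A x) - inf (A y) <= k * `|x - y|.
  rewrite lerBlDl -lerBlDr; apply: lb_le_inf; first exact: A0.
  move=> _ [s _ <-]; rewrite lerBlDr.
  apply: (@le_trans _ _ (d s + k * `|x - c s|)).
    by apply: ge_inf; [exact: lbA|exists s].
  have := ler_normD (x - y) (y - c s); rewrite addrA subrK; nra.
move=> x y; rewrite ler_norml P andbT lerNl opprB distrC; exact: P.
Qed.

(** The norm is the largest coordinate, so extending each coordinate separately
    keeps the constant. *)
Lemma lip_extension_space (S : Type) (s0 : S) (c d : S -> V) (k : R) :
  0 <= k -> (forall s t, `|d s - d t| <= k * `|c s - c t|) ->
  exists2 F : V -> V, (forall s, F (c s) = d s) & lip k F.
Proof.
move=> k0 H.
have Hj j : exists2 F : V -> R, (forall s, F (c s) = d s 0 j) & lip k F.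
  apply: mcshane => // s t; apply: le_trans (H s t).
  by apply: le_trans (coord_norm_le _ j); rewrite !mxE.
pose Fj j := projT1 (cid2 (Hj j)).
have FjE j s : Fj j (c s) = d s 0 j by rewrite /Fj; case: cid2.
have FjL j : lip k (Fj j) by rewrite /Fj; case: cid2.
exists (fun x => \row_j Fj j x).
  by move=> s; apply/rowP => j; rewrite mxE FjE.
move=> x y; apply: row_norm_le; first by rewrite mulr_ge0.
by move=> j; rewrite !mxE; exact: FjL.
Qed.

(** On a closed curve the parameters of two points can be chosen at most half a
    turn apart. *)
Definition bilip_curve (c : R) (g : R -> V) :=
  forall s t, `|s - t| <= 2^-1 -> c * `|s - t| <= `|g s - g t|.

Lemma periodic_shift_close (s t : R) :
  exists n : int, `|s - (t + n%:~R)| <= 2^-1.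
Proof.
exists (Num.floor (s - t + 2^-1)).
have := floor_itv (s - t + 2^-1); rewrite rmorphD /= ler_norml => h.
by apply/andP; split; lra.
Qed.

(** As a function of the point of the curve the displacement is Lipschitz with the
    constant [L / c < 1], so it extends to a contraction of the whole space. *)
Lemma bilip_curve_stable (g g' : R -> V) (c L : R) :
  0 <= L < c -> periodic1 g -> periodic1 g' -> bilip_curve c g ->
  lip L (fun t => g' t - g t) -> isotopic_curves g g'.
Proof.
move=> /andP[L0 Lc] gp gp' gc dL.
have c0 : 0 < c by lra.
have [//||D DE DL] := @lip_extension_space R 0 g (fun t => g' t - g t) (L / c).
- by rewrite divr_ge0 // ltW.
- move=> s t; have [n nE] := periodic_shift_close s t.
  have -> : g' t - g t = g' (t + n%:~R) - g (t + n%:~R) by rewrite !periodic1_int.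
  have -> : g t = g (t + n%:~R) by rewrite periodic1_int.
  apply: (le_trans (dL _ _)); rewrite -mulrA ler_wpM2l // ler_pdivlMl //.
  exact: gc.
exists (fun p => p + D p); last first.
  by apply/funext => t /=; rewrite DE addrC subrK.
apply: (@isotopy_end_lip _ (L / c)) => //.
by rewrite divr_ge0 ?ltr_pdivrMr //; lra.
Qed.

End LipschitzPerturbation.

(** * Piecewise linear curves *)

Section PiecewiseLinear.
Context {R : realType}.
Notation V := (space3 R).
Implicit Types (g h : R -> V) (n : nat) (j : int).

(** The bounds on the cells [[j / n, (j + 1) / n]] add up along the subdivision. *)
Lemma lip_cells (X : normedModType R) (f : R -> X) (L : R) n : (0 < n)%N ->
  (forall (j : int) (a b : R), 0 <= a <= 1 -> 0 <= b <= 1 ->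
     `|f ((j%:~R + a) / n%:R) - f ((j%:~R + b) / n%:R)|
       <= L * (`|a - b| / n%:R)) -> lip L f.
Proof.
move=> n0 fc; have nR : 0 < n%:R :> R by rewrite ltr0n.
have nn : n%:R != 0 :> R by rewrite gt_eqF.
pose fl (s : R) := Num.floor (n%:R * s).
have flP (s : R) : (fl s)%:~R <= n%:R * s < (fl s)%:~R + 1.
  by have := floor_itv (n%:R * s); rewrite rmorphD.
have cell (s t : R) (j : int) : j%:~R <= n%:R * s <= j%:~R + 1 ->
    j%:~R <= n%:R * t <= j%:~R + 1 -> `|f s - f t| <= L * `|s - t|.
  move=> sj tj.
  have := fc j (n%:R * s - j%:~R) (n%:R * t - j%:~R).
  have E (x : R) : (j%:~R + (n%:R * x - j%:~R)) / n%:R = x by field.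
  rewrite !E.
  have -> : n%:R * s - j%:~R - (n%:R * t - j%:~R) = n%:R * (s - t) by ring.
  have -> : `|n%:R * (s - t)| / n%:R = `|s - t|.
    by rewrite normrM (gtr0_norm nR) mulrAC divff // mul1r.
  apply; lra.
have P (k : nat) (s t : R) : s <= t -> (fl t <= fl s + k%:Z)%R -> `|f s - f t| <= L * `|s - t|.
  elim: k s t => [|k IH] s t st tk.
    have := flP s; have := flP t => ft fs; apply: (@cell s t (fl s)); first by lra.
    have : (fl t)%:~R <= (fl s)%:~R :> R by rewrite ler_int; move: tk; rewrite addr0.
    have : n%:R * s <= n%:R * t by rewrite ler_pM2l.
    lra.
  have fs := flP s; have ft := flP t.
  have [ts|ts] := leP (n%:R * t) ((fl s)%:~R + 1).
    apply: (@cell s t (fl s)); first by lra.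
    have : n%:R * s <= n%:R * t by rewrite ler_pM2l.
    lra.
  pose m : R := ((fl s)%:~R + 1) / n%:R.
  have nm : n%:R * m = (fl s)%:~R + 1 by rewrite /m mulrC divfK.
  have sm : s <= m by rewrite -(ler_pM2l nR) nm; lra.
  have mt : m <= t by rewrite -(ler_pM2l nR) nm; lra.
  have h1 : `|f s - f m| <= L * `|s - m| by apply: (@cell s m (fl s)); lra.
  have fm : fl m = fl s + 1.
    by rewrite /fl nm -[1]/(1%:~R) -rmorphD /= intrKfloor.
  have h2 : `|f m - f t| <= L * `|m - t|.
    by apply: IH => //; rewrite fm; move: tk; rewrite intS addrA.
  have -> : f s - f t = (f s - f m) + (f m - f t) by rewrite addrA subrK.
  apply: (le_trans (ler_normD _ _)); apply: (le_trans (lerD h1 h2)).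
  rewrite -mulrDr; have -> // : `|s - m| + `|m - t| = `|s - t|.
  by rewrite !ler0_norm; move: sm mt st; clear; lra.
move=> s t; wlog st : s t / s <= t.
  move=> W; have [st|/ltW ts] := leP s t; first exact: W.
  by rewrite distrC [`|s - t|]distrC; exact: W.
apply: (P `|fl t - fl s|%N) => //.
have := lez_abs (fl t - fl s); lia.
Qed.

Definition is_pl n g := forall j (th : R), 0 <= th <= 1 ->
  g ((j%:~R + th) / n%:R) =
    (1 - th) *: g (j%:~R / n%:R) + th *: g ((j + 1)%:~R / n%:R).

Lemma is_pl_diff n g j (a b : R) : is_pl n g -> 0 <= a <= 1 -> 0 <= b <= 1 ->
  g ((j%:~R + a) / n%:R) - g ((j%:~R + b) / n%:R) =
    (a - b) *: (g ((j + 1)%:~R / n%:R) - g (j%:~R / n%:R)).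
Proof.
by move=> gn a1 b1; rewrite !gn //; apply/rowP => i; rewrite !mxE; ring.
Qed.

Lemma is_pl_lip n g (M : R) : (0 < n)%N -> is_pl n g ->
  (forall j, `|g (j%:~R / n%:R)| <= M) -> lip (2 * M * n%:R) g.
Proof.
move=> n0 gn gM; apply: (lip_cells n0) => j a b a1 b1.
rewrite (is_pl_diff _ gn) // normrZ.
have nn : n%:R != 0 :> R by rewrite pnatr_eq0 -lt0n.
have -> : 2 * M * n%:R * (`|a - b| / n%:R) = `|a - b| * (2 * M) by field.
rewrite ler_wpM2l //; have := ler_normB (g ((j + 1)%:~R / n%:R)) (g (j%:~R / n%:R)).
by have := gM j; have := gM (j + 1); lra.
Qed.

Lemma is_plB n g h : is_pl n g -> is_pl n h -> is_pl n (fun t => g t - h t).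
Proof.
by move=> gn hn j th t1; rewrite gn // hn //; apply/rowP => i; rewrite !mxE; ring.
Qed.

Definition pl_curve n (v : int -> V) (t : R) : V :=
  let j := Num.floor (n%:R * t) in let th := n%:R * t - j%:~R in
  (1 - th) *: v j + th *: v (j + 1).

Lemma pl_curve_vertex n v j : (0 < n)%N -> pl_curve n v (j%:~R / n%:R) = v j.
Proof.
move=> n0; have nn : n%:R != 0 :> R by rewrite pnatr_eq0 -lt0n.
rewrite /pl_curve [n%:R * _]mulrC divfK // intrKfloor subrr subr0.
by rewrite scale1r scale0r addr0.
Qed.

Lemma is_pl_pl_curve n v : (0 < n)%N -> is_pl n (pl_curve n v).
Proof.
move=> n0 j th /andP[th0 th1].
have nn : n%:R != 0 :> R by rewrite pnatr_eq0 -lt0n.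
rewrite !pl_curve_vertex //.
have [th1'|th1'] := ltP th 1; last first.
  have -> : th = 1 by lra.
  rewrite -[j%:~R + 1](rmorphD _ j 1) pl_curve_vertex //.
  by rewrite subrr scale0r scale1r add0r.
rewrite /pl_curve [n%:R * _]mulrC divfK //.
have -> : Num.floor (j%:~R + th) = j.
  by apply/floor_def; rewrite rmorphD /=; apply/andP; split; lra.
by have -> : j%:~R + th - j%:~R = th by ring.
Qed.

Lemma pl_curve_periodic n v : (0 < n)%N -> (forall j, v (j + n%:Z) = v j) ->
  periodic1 (pl_curve n v).
Proof.
move=> n0 vp t; rewrite /pl_curve mulrDr mulr1.
have -> : Num.floor (n%:R * t + n%:R) = Num.floor (n%:R * t) + n%:Z.
  apply/floor_def; have := floor_itv (n%:R * t).
  rewrite !rmorphD /= -!pmulrn => h; apply/andP; split; lra.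
have -> : n%:R * t + n%:R - (Num.floor (n%:R * t) + n%:Z)%:~R
   = n%:R * t - (Num.floor (n%:R * t))%:~R by rewrite rmorphD /= -!pmulrn; ring.
by rewrite addrAC !vp.
Qed.

(** Measuring the distance by the Lipschitz constant of the difference forces the
    directions of the edges to approximate those of the curve. *)
Definition pl_approximable g := forall e, 0 < e ->
  exists n h, [/\ (0 < n)%N, is_pl n h, periodic1 h & lip e (fun t => h t - g t)].

Definition rat_point (q : rat * rat * rat) : V :=
  vec3 (ratr q.1.1) (ratr q.1.2) (ratr q.2).

Definition rat_curve (s : seq (rat * rat * rat)) : R -> V :=
  pl_curve (size s) (fun j => rat_point (nth (0, 0, 0) s `|(j %% (size s)%:Z)%Z|)).

Lemma rat_curve_periodic s : (0 < size s)%N -> periodic1 (rat_curve s).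
Proof. by move=> s0; apply: pl_curve_periodic => // j; rewrite modzDr. Qed.

Lemma rat_approx (x e : R) : 0 < e -> exists q : rat, `|ratr q - x| <= e.
Proof.
move=> e0; have [|q] := @rat_in_itvoo R (x - e) (x + e); first by lra.
by rewrite in_itv /= => qx; exists q; rewrite ler_norml; lra.
Qed.

Lemma rat_point_approx (v : V) (e : R) : 0 < e -> exists q, `|rat_point q - v| <= e.
Proof.
move=> e0; have [a aE] := rat_approx (xco v) e0.
have [b bE] := rat_approx (yco v) e0; have [c cE] := rat_approx (zco v) e0.
by exists (a, b, c); apply: vec3_norm_le; rewrite ?coE //; exact: ltW.
Qed.

(** Moving finitely many vertices to nearby rational points is also a Lipschitz
    small change. *)
Lemma isotopic_rat_curve g (c : R) : 0 < c -> periodic1 g -> bilip_curve c g ->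
  pl_approximable g -> exists s, (0 < size s)%N /\ isotopic_curves g (rat_curve s).
Proof.
move=> c0 gp gc gapp.
have [|n [h [n0 hn hp hg]]] := gapp (c / 4); first by lra.
have nR : 0 < n%:R :> R by rewrite ltr0n.
(* moving the vertices by [e] costs the Lipschitz constant [2 * e * n = c / 4] *)
pose e := c / 8 / n%:R; have e0 : 0 < e by rewrite !divr_gt0.
pose q (j : nat) := projT1 (cid (rat_point_approx (h (j%:R / n%:R)) e0)).
have qE (i : nat) : `|rat_point (q i) - h (i%:R / n%:R)| <= e by rewrite /q; case: cid.
pose s := mkseq q n; have sn : size s = n by rewrite size_mkseq.
exists s; split; first by rewrite sn.
have vE (j : int) : `|rat_curve s (j%:~R / n%:R) - h (j%:~R / n%:R)| <= e.
  rewrite /rat_curve sn pl_curve_vertex //.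
  have jn : (`|(j %% n%:Z)%Z| < n)%N.
    have := ltz_pmod j (d := n%:Z); have := modz_ge0 j (d := n%:Z); lia.
  rewrite nth_mkseq //; apply: le_trans (qE _).
  have : j%:~R / n%:R = `|(j %% n%:Z)%Z|%:R / n%:R + ((j %/ n%:Z)%Z)%:~R :> R.
    have {1}-> : j = (`|(j %% n%:Z)%Z|%:Z + (j %/ n%:Z)%Z * n%:Z)%R.
      have := divz_eq j n%:Z; have := modz_ge0 j (d := n%:Z); lia.
    rewrite rmorphD rmorphM /= -!pmulrn; field; exact: lt0r_neq0.
  by move=> ->; rewrite periodic1_int.
apply: (@bilip_curve_stable _ _ _ c (c / 2)) => //.
- by apply/andP; split; lra.
- by apply: rat_curve_periodic; rewrite sn.
have h1 : lip (2 * e * n%:R) (fun t => rat_curve s t - h t).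
  apply: is_pl_lip => //; apply: is_plB => //.
  by rewrite /rat_curve sn; exact: is_pl_pl_curve.
move=> x y; have := h1 x y; have := hg x y.
have -> : 2 * e * n%:R = c / 4.
  by rewrite /e; field; exact: lt0r_neq0.
have -> : rat_curve s x - g x - (rat_curve s y - g y) =
   (rat_curve s x - h x - (rat_curve s y - h y)) + (h x - g x - (h y - g y)).
  by apply/rowP => i; rewrite !mxE; ring.
have := ler_normD (rat_curve s x - h x - (rat_curve s y - h y)) (h x - g x - (h y - g y)).
lra.
Qed.

End PiecewiseLinear.

(** * Smooth and piecewise linear curves are bi-Lipschitz *)

Section Bilip.
Context {R : realType}.
Notation V := (space3 R).
Implicit Types (g h : R -> V) (n : nat) (j : int).

Definition locally_bilip g := forall t0, exists2 d, 0 < d & exists2 c, 0 < c &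
  forall s t, `|s - t0| < d -> `|t - t0| < d -> c * `|s - t| <= `|g s - g t|.

Lemma near_prod_dist (s0 t0 d : R) : 0 < d ->
  \forall z \near (s0, t0), `|z.1 - s0| < d /\ `|z.2 - t0| < d.
Proof.
move=> d0; exists (ball s0 d, ball t0 d); first by split; exact: nbhsx_ballx.
by move=> -[a b] /=; rewrite -!ball_normE /= /ball_ /= ![`|s0 - _|]distrC ![`|t0 - _|]distrC => -[].
Qed.

Lemma near_pos_le (c0 : R) : 0 < c0 -> \forall c \near 0^'+, 0 < c <= c0.
Proof.
move=> c00; near=> c; apply/andP; split; first by near: c; exact: nbhs_right_gt.
by near: c; exact: nbhs_right_le.
Unshelve. all: end_near. Qed.

(** Compactness of pairs of parameters: off the diagonal the distance is
    bounded below by injectivity, near it by the local estimate. *)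
Lemma bilip_curve_of_local g : simple_curve g -> locally_bilip g ->
  exists2 c, 0 < c & bilip_curve c g.
Proof.
move=> Sg lg; have [cg gp gi] := Sg.
pose P (c : R) (z : R * R) := `|z.1 - z.2| <= 2^-1 ->
  c * `|z.1 - z.2| <= `|g z.1 - g z.2|.
(* a common integer shift brings [s] into [[0, 1]], and then [t] into [[-1, 2]] *)
have cpt : compact (`[0, 1] `*` `[-1, 2] : set (R * R)).
  by apply: compact_setX; exact: segment_compact.
have /compact_near_coveringP cov := cpt.
have : \forall c \near 0^'+, (`[0, 1] `*` `[-1, 2] : set (R * R)) `<=` P c.
  apply: cov => -[s t] _; have [gst|gst] := eqVneq (g s) (g t).
    have [k sk] := simple_curve_eq Sg gst.
    have [k0|k0] := eqVneq k 0.
      have st : s = t by rewrite sk k0 addr0.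
      rewrite -st; have [d d0 [c0 c00 Hc]] := lg s.
      near=> z c; have : 0 < c <= c0 by near: c; exact: near_pos_le.
      move=> /andP[cp cc0] _; have : `|z.1 - s| < d /\ `|z.2 - s| < d.
        by near: z; exact: near_prod_dist.
      by move=> [h1 h2]; apply: le_trans (Hc _ _ h1 h2); rewrite ler_wpM2r.
    (* parameters a full turn or more apart violate the bound by half a turn *)
    have far : 1 <= `|s - t|.
      rewrite sk addrAC subrr add0r -intr_norm -[1]/(1%:~R) ler_int.
      by rewrite -normr_gt0 in k0; lia.
    near=> z c; rewrite /P /= => zz.
    have : `|z.1 - s| < 4^-1 /\ `|z.2 - t| < 4^-1.
      by near: z; apply: near_prod_dist; lra.
    move=> [h1 h2]; exfalso.
    have := ler_normD (s - z.1) (z.1 - z.2); have := ler_normD (s - z.1 + (z.1 - z.2)) (z.2 - t).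
    have -> : s - z.1 + (z.1 - z.2) + (z.2 - t) = s - t by ring.
    rewrite [`|s - z.1|]distrC; lra.
  pose r := `|g s - g t|; have r0 : 0 < r by rewrite normr_gt0 subr_eq0.
  have [d1 d10 H1] := (continuous_at_dist g s).1 (cg s) (r / 4) ltac:(lra).
  have [d2 d20 H2] := (continuous_at_dist g t).1 (cg t) (r / 4) ltac:(lra).
  near=> z c; rewrite /P /= => zz.
  have [h1 _] : `|z.1 - s| < d1 /\ `|z.2 - t| < d1.
    by near: z; apply: near_prod_dist; lra.
  have [_ h2] : `|z.1 - s| < d2 /\ `|z.2 - t| < d2.
    by near: z; apply: near_prod_dist; lra.
  have /andP[c0 cr] : 0 < c <= r by near: c; exact: near_pos_le.
  rewrite distrC in h1; rewrite distrC in h2.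
  have {}h1 := H1 _ h1; have {}h2 := H2 _ h2.
  have h3 := ler_normD (g s - g z.1) (g z.1 - g z.2).
  have h4 := ler_normD (g s - g z.1 + (g z.1 - g z.2)) (g z.2 - g t).
  have E : g s - g z.1 + (g z.1 - g z.2) + (g z.2 - g t) = g s - g t.
    by apply/rowP => i; rewrite !mxE; ring.
  rewrite E -/r [`|g z.2 - _|]distrC in h4.
  have : c * `|z.1 - z.2| <= r * 2^-1 by apply: ler_pM => //; exact: ltW.
  move: h1 h2 h3 h4; clear; lra.
move=> Pn; have : \forall c \near (0 : R)^'+, 0 < c /\
    (`[0, 1] `*` `[-1, 2] : set (R * R)) `<=` P c.
  near=> c; split; first by near: c; exact: nbhs_right_gt.
  by near: c.
move=> /filter_ex[c [c0 Pc]]; exists c => // s t st.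
have sm := frac_itv s; set m := Num.floor s in sm.
rewrite -(periodic1_int gp (- m) s) -(periodic1_int gp (- m) t).
have E : s - t = (s + (- m)%:~R) - (t + (- m)%:~R) by ring.
rewrite E; apply: (Pc (s + (- m)%:~R, t + (- m)%:~R)) => /=; last by rewrite -E.
rewrite rmorphN /= in E *; split => /=; rewrite in_itv /=; first by lra.
by move: st; rewrite ler_norml; lra.
Unshelve. all: end_near. Qed.

(** Strict differentiability: the two points of the difference quotient move
    independently. *)
Definition strong_derivative g t0 w := forall e, 0 < e -> exists2 d, 0 < d &
  forall s t, `|s - t0| < d -> `|t - t0| < d ->
    `|g s - g t - (s - t) *: w| <= e * `|s - t|.

Definition immersed g := forall t0, exists2 w, w != 0 & strong_derivative g t0 w.

Lemma immersed_locally_bilip g : immersed g -> locally_bilip g.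
Proof.
move=> ig t0; have [w w0 gw] := ig t0.
have wn : 0 < `|w| by rewrite normr_gt0.
have [|d d0 H] := gw (`|w| / 2); first by rewrite divr_gt0.
exists d => //; exists (`|w| / 2); first by rewrite divr_gt0.
move=> s t hs ht; have := H s t hs ht.
have := ler_normB (g s - g t) (g s - g t - (s - t) *: w).
by rewrite opprB addrC subrK normrZ; lra.
Qed.

(** On the cells of a fine enough subdivision the curve is within a small
    Lipschitz distance of an affine map, hence of its chord. *)
Lemma immersed_pl_approximable g : simple_curve g -> immersed g ->
  pl_approximable g.
Proof.
move=> [cg gp gi] ig e e0.
pose P n (t0 : R) := exists w : V, forall s t, `|s - t0| <= n.+1%:R^-1 ->
  `|t - t0| <= n.+1%:R^-1 -> `|g s - g t - (s - t) *: w| <= e / 2 * `|s - t|.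
have /compact_near_coveringP cov := @segment_compact R 0 1.
have : \forall n \near \oo, `[0, 1]%classic `<=` P n.
  apply: cov => t0 _; have [w _ gw] := ig t0.
  have [|d d0 H] := gw (e / 2); first by rewrite divr_gt0.
  have d20 : 0 < d / 2 by rewrite divr_gt0.
  near=> t1 n; exists w => s t hs ht.
  have t1d : `|t1 - t0| < d / 2.
    near: t1; apply/nbhs_ballP; exists (d / 2) => //.
    by move=> x; rewrite -ball_normE /= /ball_ /= distrC.
  have nd : n.+1%:R^-1 < d / 2 by near: n; exact: (near_infty_natSinv_lt (PosNum d20)).
  move: hs ht nd; move: (n.+1%:R^-1) => iv hs ht nd.
  apply: H.
    have := ler_normD (s - t1) (t1 - t0); rewrite addrA subrK; move: hs t1d nd; clear; lra.
  have := ler_normD (t - t1) (t1 - t0); rewrite addrA subrK; move: ht t1d nd; clear; lra.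
move=> [n _ /(_ n (leqnn n)) Pn].
have nR : 0 < n.+1%:R :> R by rewrite ltr0n.
have nn : n.+1%:R != 0 :> R by rewrite gt_eqF.
exists n.+1, (pl_curve n.+1 (fun j => g (j%:~R / n.+1%:R))); split => //.
- exact: is_pl_pl_curve.
- apply: pl_curve_periodic => // j; rewrite rmorphD /= mulrDl -pmulrn divff //.
apply: (lip_cells (n := n.+1)) => // j a b a01 b01.
set h := pl_curve _ _; have hn : is_pl n.+1 h by exact: is_pl_pl_curve.
have -> : h ((j%:~R + a) / n.+1%:R) - g ((j%:~R + a) / n.+1%:R) -
   (h ((j%:~R + b) / n.+1%:R) - g ((j%:~R + b) / n.+1%:R)) =
   (h ((j%:~R + a) / n.+1%:R) - h ((j%:~R + b) / n.+1%:R)) -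
   (g ((j%:~R + a) / n.+1%:R) - g ((j%:~R + b) / n.+1%:R)).
  by apply/rowP => i; rewrite !mxE; ring.
rewrite (is_pl_diff _ hn) // /h !pl_curve_vertex //.
pose m := Num.floor (j%:~R / n.+1%:R : R).
pose t1 : R := j%:~R / n.+1%:R - m%:~R.
have t101 : 0 <= t1 < 1 by exact: frac_itv.
have [|w Pw] := Pn t1; first by rewrite /= in_itv /=; lra.
have gE x : g ((j%:~R + x) / n.+1%:R) = g (t1 + x / n.+1%:R).
  rewrite -[RHS](periodic1_int gp m); congr g; rewrite /t1 mulrDl; ring.
have Pj x y : 0 <= x <= 1 -> 0 <= y <= 1 ->
    `|g ((j%:~R + x) / n.+1%:R) - g ((j%:~R + y) / n.+1%:R)
      - ((x - y) / n.+1%:R) *: w| <= e / 2 * (`|x - y| / n.+1%:R).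
  move=> x01 y01; rewrite !gE.
  have E : t1 + x / n.+1%:R - (t1 + y / n.+1%:R) = (x - y) / n.+1%:R by rewrite mulrBl; ring.
  have := Pw (t1 + x / n.+1%:R) (t1 + y / n.+1%:R).
  have nvn : `|n.+1%:R^-1| = n.+1%:R^-1 :> R by rewrite ger0_norm // invr_ge0 ltW.
  have near_t1 z : 0 <= z <= 1 -> `|t1 + z / n.+1%:R - t1| <= n.+1%:R^-1.
    move=> z01; rewrite addrAC subrr add0r normrM nvn -[leRHS]mul1r.
    by rewrite ler_pM2r ?invr_gt0 // ler_norml; move: z01; clear; lra.
  by rewrite E normrM nvn; apply; exact: near_t1.
have h1 := Pj a b a01 b01.
have h2 := Pj 1 0 ltac:(clear; lra) ltac:(clear; lra).
rewrite subr0 normr1 addr0 mul1r in h2.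
rewrite [(j + 1)%:~R]rmorphD /=.
set G1 := g ((j%:~R + 1) / _) in h2 *; set G0 := g (j%:~R / _) in h2 *.
have -> : (a - b) *: (G1 - G0) - (g ((j%:~R + a) / n.+1%:R) - g ((j%:~R + b) / n.+1%:R))
  = (a - b) *: (G1 - G0 - n.+1%:R^-1 *: w) -
    (g ((j%:~R + a) / n.+1%:R) - g ((j%:~R + b) / n.+1%:R) - ((a - b) / n.+1%:R) *: w).
  by apply/rowP => i; rewrite !mxE; ring.
apply: (le_trans (ler_normB _ _)); rewrite normrZ.
have h3 : `|a - b| * `|G1 - G0 - n.+1%:R^-1 *: w| <= `|a - b| * (e / 2 / n.+1%:R).
  by rewrite ler_wpM2l.
apply: le_trans (lerD h3 h1) _; rewrite le_eqVlt; apply/orP; left; apply/eqP.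
by move: (n.+1%:R^-1 : R) => iv; field.
Unshelve. all: end_near. Qed.

(** At a vertex [a] belongs to the outgoing edge; reversing the curve gives the
    incoming one. *)
Lemma is_pl_right n g t0 : (0 < n)%N -> is_pl n g ->
  exists2 d, 0 < d & exists a, forall u, 0 <= u <= d -> g (t0 + u) = g t0 + u *: a.
Proof.
move=> n0 gn; have nR : 0 < n%:R :> R by rewrite ltr0n.
have nn : n%:R != 0 :> R by rewrite gt_eqF.
pose j := Num.floor (n%:R * t0); pose th := n%:R * t0 - j%:~R.
have th01 : 0 <= th < 1 by exact: frac_itv.
exists ((1 - th) / n%:R); first by rewrite divr_gt0 //; lra.
exists (n%:R *: (g ((j + 1)%:~R / n%:R) - g (j%:~R / n%:R))) => u.
rewrite ler_pdivlMr // => u01.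
have E : t0 = (j%:~R + th) / n%:R by rewrite /th; field.
have Eu : t0 + u = (j%:~R + (th + n%:R * u)) / n%:R by rewrite /th; field.
have gu : g (t0 + u) - g t0 =
    g ((j%:~R + (th + n%:R * u)) / n%:R) - g ((j%:~R + th) / n%:R).
  by rewrite -Eu -E.
have nu : 0 <= n%:R * u by rewrite mulr_ge0 //; lra.
rewrite -[LHS](subrK (g t0)) addrC gu (is_pl_diff _ gn); [|lra|lra].
by rewrite scalerA; congr (_ + _ *: _); ring.
Qed.

Lemma is_pl_opp n g : is_pl n g -> is_pl n (g \o -%R).
Proof.
move=> gn j th th01 /=.
have -> : - ((j%:~R + th) / n%:R) = ((- (j + 1))%:~R + (1 - th)) / n%:R :> R.
  by rewrite rmorphN rmorphD /=; ring.
rewrite gn; last by lra.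
have -> : (- (j + 1) + 1)%R = - j by ring.
rewrite !rmorphN /= !mulNr addrC; congr (_ *: _ + _ *: _); ring.
Qed.

(** Two different edges leave a vertex in different directions, since the curve
    is injective. *)
Lemma is_pl_locally_bilip n g : (0 < n)%N -> simple_curve g -> is_pl n g ->
  locally_bilip g.
Proof.
move=> n0 Sg gn t0; have [cg gp gi] := Sg.
have [d1 d10 [a ga]] := is_pl_right t0 n0 gn.
have [d2 d20 [b gb']] := is_pl_right (- t0) n0 (is_pl_opp gn).
have gb u : 0 <= u <= d2 -> g (t0 - u) = g t0 + u *: b.
  by move=> /gb' /=; rewrite opprD !opprK.
pose d := Num.min (Num.min d1 d2) (2^-1).
have d0 : 0 < d by rewrite !lt_min d10 d20 /=; lra.
have [dd1 dd2 dh] : [/\ d <= d1, d <= d2 & d <= 2^-1].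
  by rewrite /d; split; rewrite !ge_min lexx ?orbT.
(* [f] has no zero: at a zero, the two edges would meet away from [t0] *)
pose f (l : R) := `|l *: a - (1 - l) *: b|.
have f0 l : 0 <= l <= 1 -> 0 < f l.
  move=> l01; rewrite normr_gt0; apply/eqP => lab.
  have e1 := ga (l * d) ltac:(apply/andP; split; nra).
  have e2 := gb ((1 - l) * d) ltac:(apply/andP; split; nra).
  have : g (t0 + l * d) = g (t0 - (1 - l) * d).
    rewrite e1 e2; congr (_ + _); apply/eqP; rewrite -subr_eq0; apply/eqP.
    have -> : (l * d) *: a - ((1 - l) * d) *: b = d *: (l *: a - (1 - l) *: b).
      by apply/rowP => i; rewrite !mxE; ring.
    by rewrite lab scaler0.
  by move=> /(simple_curve_lt1 Sg); rewrite ltr_norml; lra.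
have cf : {within `[0, 1], continuous f}.
  apply: continuous_subspaceT => l; apply: cvg_norm; apply: cvgB.
    by apply: cvgZ; [exact: cvg_id|exact: cvg_cst].
  apply: cvgZ; last exact: cvg_cst.
  by apply: cvgB; [exact: cvg_cst|exact: cvg_id].
have [l l01 lmin] := EVT_min (@ler01 R) cf.
have fl0 : 0 < f l by apply: f0; move: l01; rewrite in_itv.
have fle (u v : R) : 0 <= u -> 0 <= v -> f l * (u + v) <= `|u *: a - v *: b|.
  move=> u0 v0; have [uv|uv] := eqVneq (u + v) 0.
    by rewrite uv mulr0.
  have uvp : 0 < u + v by rewrite lt_neqAle eq_sym uv addr_ge0.
  have uv01 : 0 <= u / (u + v) <= 1.
    rewrite divr_ge0 ?(ltW uvp) //=.
    by rewrite ler_pdivrMr // mul1r lerDl.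
  have := lmin (u / (u + v)); rewrite in_itv /= uv01 => /(_ isT).
  rewrite -(ler_pM2r uvp) => h; apply: le_trans h _.
  rewrite /f -[X in _ * X](gtr0_norm uvp) mulrC -normrZ le_eqVlt; apply/orP; left.
  apply/eqP; congr (`|_|); rewrite scalerBr !scalerA mulrBr mulr1.
  have -> : (u + v) * (u / (u + v)) = u by field.
  by congr (_ - _ *: _); ring.
exists d => //; exists (f l) => // s t.
wlog st : s t / t <= s.
  move=> W hs ht; have [ts|/ltW st] := leP t s; first exact: W.
  by rewrite distrC [`|g s - _|]distrC; exact: W.
rewrite !ltr_norml => hs ht; rewrite (ger0_norm (_ : 0 <= s - t)); last by move: st; clear; lra.
have [s0|s0] := leP t0 s.
  have gs : g s = g t0 + (s - t0) *: a.
    by rewrite -ga; [congr g; ring|move: s0 hs dd1; clear; lra].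
  have [t00|t00] := leP t0 t.
    have gt : g t = g t0 + (t - t0) *: a.
      by rewrite -ga; [congr g; ring|move: t00 ht dd1; clear; lra].
    have := fle (s - t) 0 ltac:(move: st; clear; lra) ltac:(clear; lra).
    rewrite addr0 scale0r subr0 => h; apply: (le_trans h).
    rewrite le_eqVlt; apply/orP; left; apply/eqP; congr (`|_|).
    by rewrite gs gt; apply/rowP => i; rewrite !mxE; ring.
  have gt : g t = g t0 + (t0 - t) *: b.
    by rewrite -gb; [congr g; ring|move: t00 ht dd2; clear; lra].
  have := fle (s - t0) (t0 - t) ltac:(move: s0; clear; lra)
    ltac:(move: t00; clear; lra).
  have -> : s - t0 + (t0 - t) = s - t by ring.
  move=> h; apply: (le_trans h).
  rewrite le_eqVlt; apply/orP; left; apply/eqP; congr (`|_|).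
  by rewrite gs gt; apply/rowP => i; rewrite !mxE; ring.
have gs : g s = g t0 + (t0 - s) *: b.
  by rewrite -gb; [congr g; ring|move: s0 hs dd2; clear; lra].
have gt : g t = g t0 + (t0 - t) *: b.
  by rewrite -gb; [congr g; ring|move: st s0 ht dd2; clear; lra].
have := fle 0 (s - t) ltac:(clear; lra) ltac:(move: st; clear; lra).
rewrite add0r scale0r sub0r => h; apply: (le_trans h).
rewrite le_eqVlt; apply/orP; left; apply/eqP; congr (`|_|).
by rewrite gs gt; apply/rowP => i; rewrite !mxE; ring.
Qed.

Lemma is_pl_approximable n g : (0 < n)%N -> is_pl n g -> periodic1 g ->
  pl_approximable g.
Proof.
move=> n0 gn gp e e0; exists n, g; split => // x y.
by rewrite !subrr normr0 mulr_ge0 // ltW.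
Qed.

Lemma simple_curve_opp g : simple_curve g -> simple_curve (g \o -%R).
Proof.
move=> Sg; have [cg gp gi] := Sg; split.
- apply: continuous_comp_fun => // t; apply: cvgN; exact: cvg_id.
- by move=> t /=; rewrite -[LHS]gp; congr g; ring.
- move=> s t s01 t01 /= /(simple_curve_lt1 Sg); rewrite ltr_norml; lra.
Qed.

Lemma immersed_opp g : immersed g -> immersed (g \o -%R).
Proof.
move=> ig t0; have [w w0 gw] := ig (- t0); exists (- w); first by rewrite oppr_eq0.
move=> e e0; have [d d0 H] := gw e e0; exists d => // s t hs ht /=.
have := H (- s) (- t); rewrite -!opprD !normrN => /(_ hs ht).
by rewrite scaleNr scalerN.
Qed.

(** The mean value theorem, coordinate by coordinate. *)
Lemma strong_derivative_C1 (F : R -> V) :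
  (forall t, derivable F t 1) -> continuous (derive1 F) ->
  forall t0, strong_derivative F t0 (derive1 F t0).
Proof.
move=> dF cF' t0 e e0.
have [d d0 H] := (continuous_at_dist (derive1 F) t0).1 (cF' t0) e e0.
exists d => // s t.
have dFi (i : 'I_3) (x : R) : is_derive x 1 (fun t : R => F t 0 i) (derive1 F x 0 i).
  have dFx := dF x; have /derivable_mxP := dFx => /(_ 0 i) dfi.
  by apply: DeriveDef => //; rewrite derive1E derive_mx // mxE.
wlog st : s t / t < s.
  move=> W hs ht; have [->|/eqP nst] := eqVneq s t.
    by rewrite !subrr scale0r subr0 !normr0 mulr0.
  have [ts|ts|//] := ltgtP s t; last exact: W.
  have := W t s ts ht hs; rewrite [`|t - s|]distrC.
  rewrite -normrN !opprB; congr (`|_| <= _).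
  by apply/rowP => i; rewrite !mxE; ring.
move=> hs ht; rewrite (gtr0_norm (_ : 0 < s - t)); last by lra.
apply: row_norm_le; first by rewrite mulr_ge0 ?subr_ge0; lra.
move=> i; rewrite !mxE.
have cfi : {within `[t, s], continuous (fun t : R => F t 0 i)}.
  apply: derivable_within_continuous => x _.
  exact: (@ex_derive _ _ _ _ _ _ _ (dFi i x)).
have [x xI E] := @MVT R (fun t : R => F t 0 i) (fun x => derive1 F x 0 i) t s st
  (fun x _ => dFi i x) cfi.
rewrite E; move: xI; rewrite in_itv /= => xI.
have -> : derive1 F x 0 i * (s - t) - (s - t) * derive1 F t0 0 i
   = (s - t) * (derive1 F x - derive1 F t0) 0 i.
  by rewrite [_ * (s - t)]mulrC -mulrBr !mxE.
rewrite normrM gtr0_norm; last by lra.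
rewrite mulrC ler_wpM2r //; first by lra.
apply: le_trans (coord_norm_le _ _) _; rewrite distrC; apply/ltW/H.
by move: hs ht; rewrite !ltr_norml; lra.
Qed.

Lemma smooth_knot_curve (C : set V) : smooth_knot C ->
  exists g, [/\ simple_curve g, range g = C & immersed g].
Proof.
move=> [p [pC dp p0]]; have [Sg rg] := parametrizes_curve pC.
exists (p \o turn_point); split => // t0.
pose F s := p (circle_angle s).
have cF' : continuous (derive1 F).
  move=> t; apply: differentiable_continuous; apply/derivable1_diffP.
  exact: (dp 1%N t).
have pi0 : 0 < 2 * pi :> R by have := @pi_gt0 R; lra.
have sF := strong_derivative_C1 (dp 0%N) cF'.
exists ((2 * pi) *: derive1 F (2 * pi * t0)).
  by rewrite scaler_eq0 negb_or gt_eqF //=; exact: p0.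
move=> e e0; have [|d d0 H] := sF (2 * pi * t0) (e / (2 * pi)).
  by rewrite divr_gt0.
exists (d / (2 * pi)); first by rewrite divr_gt0.
move=> s t; rewrite !ltr_pdivlMr // => hs ht.
have nrm (x y : R) : `|2 * pi * x - 2 * pi * y| = 2 * pi * `|x - y|.
  by rewrite -mulrBr (normrM (2 * pi) (x - y)) (gtr0_norm pi0).
have := H (2 * pi * s) (2 * pi * t); rewrite !nrm.
move=> /(_ ltac:(by rewrite mulrC) ltac:(by rewrite mulrC)).
by rewrite mulrA divfK ?gt_eqF // -mulrBr scalerA [(s - t) * _]mulrC.
Qed.

End Bilip.

(** * Curves with the same range *)

Section Reparametrization.
Context {R : realType}.
Notation V := (space3 R).
Implicit Types (g h : R -> V).

(** No continuity is asked for: an increasing bijection of the unit interval is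
    continuous. *)
Lemma circle_lift_of_bijection (M : R -> R) :
  (forall s t, 0 <= s -> s < t -> t <= 1 -> M s < M t) -> M 0 = 0 -> M 1 = 1 ->
  (forall y, 0 <= y <= 1 -> exists2 t, 0 <= t <= 1 & M t = y) ->
  exists2 H, circle_lift H & forall t, 0 <= t <= 1 -> H t = M t.
Proof.
move=> Mi M0 M1 Ms.
have Mle s t : 0 <= s -> s <= t -> t <= 1 -> M s <= M t.
  by move=> s0; rewrite le_eqVlt => /orP[/eqP-> //|st t1]; exact/ltW/Mi.
have M01 t : 0 <= t < 1 -> 0 <= M t < 1.
  move=> /andP[t0 t1]; apply/andP; split; first by rewrite -M0; apply: Mle => //; lra.
  by rewrite -M1; apply: Mi.
pose H (t : R) := M (t - (Num.floor t)%:~R) + (Num.floor t)%:~R.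
have H1 t : H (t + 1) = H t + 1.
  rewrite /H; have -> : Num.floor (t + 1) = Num.floor t + 1.
    by apply/floor_def; have := floor_itv t; rewrite !rmorphD /=; lra.
  by rewrite rmorphD /= opprD addrACA subrr addr0 addrA.
have flE (k : int) (t : R) : 0 <= t < 1 -> Num.floor (t + k%:~R) = k.
  by move=> t01; apply/floor_def; rewrite rmorphD /=; lra.
have HE (k : int) (t : R) : 0 <= t < 1 -> H (t + k%:~R) = M t + k%:~R.
  by move=> t01; rewrite /H flE // addrK.
have hH : {homo H : s t / s < t}.
  move=> s t st; have fs := frac_itv s; have ft := frac_itv t.
  rewrite /H; set k := Num.floor s in fs *; set m := Num.floor t in ft *.
  have [km|km|km] := ltgtP k m.
  - have : k%:~R + 1 <= m%:~R :> R by rewrite -[1]/(1%:~R) -rmorphD /= ler_int; lia.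
    by have := M01 _ fs; have := M01 _ ft; lra.
  - have : m%:~R + 1 <= k%:~R :> R by rewrite -[1]/(1%:~R) -rmorphD /= ler_int; lia.
    lra.
  - rewrite -km in ft *; rewrite ltrD2r; apply: Mi; lra.
exists H; last first.
  move=> t /andP[t0]; rewrite le_eqVlt => /orP[/eqP->|t1].
    by rewrite -[X in H X]add0r -[1]/(1%:~R) HE ?M0 ?M1 ?add0r //; lra.
  by rewrite -[in LHS](addr0 t) (HE 0) ?addr0 //; lra.
split => //; apply: increasing_surj_continuous => // y.
have fy := frac_itv y; have [|t t01 tE] := Ms (y - (Num.floor y)%:~R); first by lra.
exists (t + (Num.floor y)%:~R).
rewrite HE ?tE ?subrK //; case/andP: t01 => -> /=; rewrite le_eqVlt => /orP[/eqP t1|//].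
by rewrite t1 M1 in tE; lra.
Qed.

Lemma near_dist (s d : R) : 0 < d -> \forall x \near s, `|x - s| < d.
Proof.
move=> d0; apply/nbhs_ballP; exists d => //.
by move=> x; rewrite -ball_normE /= /ball_ /= distrC.
Qed.

(** The parameter depends continuously on the point, away from the base point: by
    compactness, points with far parameters stay away. *)
Lemma simple_curve_inverse_dist g s0 e : simple_curve g -> 0 < s0 < 1 -> 0 < e ->
  exists2 d, 0 < d & forall s, 0 <= s < 1 -> `|g s - g s0| < d -> `|s - s0| < e.
Proof.
move=> Sg s01 e0; have [cg gp gi] := Sg.
have /compact_near_coveringP cov := @segment_compact R 0 1.
pose P (d : R) (s : R) := `|s - s0| < e \/ d <= `|g s - g s0|.
have : \forall d \near 0^'+, `[0, 1]%classic `<=` P d.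
  apply: cov => s; rewrite /= in_itv /= => s1.
  have [->|ss0] := eqVneq s s0.
    near=> s' d; rewrite /P /=; left.
    by near: s'; exact: near_dist.
  have r0 : 0 < `|g s - g s0|.
    rewrite normr_gt0 subr_eq0; apply: contra_neq ss0 => /(simple_curve_lt1 Sg).
    by apply; rewrite ltr_norml; lra.
  have [d1 d10 H] := (continuous_at_dist g s).1 (cg s) (`|g s - g s0| / 2) ltac:(lra).
  near=> s' d; rewrite /P /=; right.
  have h1 : `|g s - g s'| < `|g s - g s0| / 2.
    apply: H; rewrite distrC.
    by near: s'; exact: near_dist.
  have /andP[_ h2] : 0 < d <= `|g s - g s0| / 2 by near: d; apply: near_pos_le; lra.
  have := ler_normD (g s - g s') (g s' - g s0); rewrite addrA subrK; lra.
move=> Pn; have : \forall d \near (0 : R)^'+, 0 < d /\ `[0, 1]%classic `<=` P d.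
  near=> c; split; first by near: c; exact: nbhs_right_gt.
  by near: c.
move=> /filter_ex[d [d0 Pd]]; exists d => // s s1 gs.
have [|//|] := Pd s; first by rewrite /= in_itv /=; lra.
by rewrite leNgt gs.
Unshelve. all: end_near. Qed.

Lemma simple_curve_param g x : simple_curve g -> range g x ->
  exists2 t, 0 <= t < 1 & g t = x.
Proof.
move=> [_ gp _] [t _ <-]; exists (t - (Num.floor t)%:~R); first exact: frac_itv.
by rewrite -rmorphN /= periodic1_int.
Qed.

Lemma periodic1_eq (T : Type) (f f' : R -> T) : periodic1 f -> periodic1 f' ->
  (forall t, 0 <= t < 1 -> f t = f' t) -> f = f'.
Proof.
move=> fp fp' E; apply/funext => t.
rewrite -(periodic1_int fp (- Num.floor t)) -(periodic1_int fp' (- Num.floor t)).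
by apply: E; rewrite rmorphN /= frac_itv.
Qed.

(** The base points correspond, so it suffices to match the remaining open arcs
    monotonically. *)
Lemma reparametrization_of_open g g' (m : R -> R) :
  periodic1 g -> periodic1 g' -> g 0 = g' 0 ->
  (forall t, 0 < t < 1 -> 0 < m t < 1) ->
  (forall s t, 0 < s -> s < t -> t < 1 -> m s < m t) ->
  (forall y, 0 < y < 1 -> exists2 t, 0 < t < 1 & m t = y) ->
  (forall t, 0 < t < 1 -> g (m t) = g' t) ->
  exists2 H, circle_lift H & g' = g \o H.
Proof.
move=> gp gp' g0 m01 mi ms gm.
pose M t := if t <= 0 then 0 else if 1 <= t then 1 else m t.
have M0 : M 0 = 0 by rewrite /M lexx.
have M1 : M 1 = 1 by rewrite /M lexx ler10.
have Mm t : 0 < t < 1 -> M t = m t.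
  by move=> /andP[t0 t1]; rewrite /M !leNgt t0 t1.
have [|//|//||H LH HM] := @circle_lift_of_bijection M.
- move=> s t s0 st t1; move: s0 t1.
  rewrite [0 <= s]le_eqVlt [t <= 1]le_eqVlt => /orP[/eqP s0|s0] /orP[/eqP t1|t1].
  + by rewrite -s0 t1 M0 M1.
  + have t01 : 0 < t < 1 by lra.
    by rewrite -s0 M0 Mm //; have := m01 _ t01; lra.
  + have s01 : 0 < s < 1 by lra.
    by rewrite t1 M1 Mm //; have := m01 _ s01; lra.
  + by rewrite !Mm; [exact: mi|lra|lra].
- move=> y /andP[]; rewrite le_eqVlt => /orP[/eqP <-|y0].
    by move=> _; exists 0 => //; lra.
  rewrite le_eqVlt => /orP[/eqP ->|y1]; first by exists 1 => //; lra.
  have [|t t01 tE] := ms y; first by rewrite y0.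
  by exists t; [lra|rewrite Mm].
exists H => //; have [_ _ H1] := LH.
apply: periodic1_eq => //.
  by move=> t /=; rewrite H1 gp.
move=> t /andP[]; rewrite le_eqVlt => /orP[/eqP <-|t0] t1 /=.
  by rewrite HM ?M0 //; lra.
by rewrite HM ?Mm ?gm //; lra.
Qed.

(** Removing the base point leaves two open arcs, and a continuous bijection
    between intervals is monotone. *)
Lemma simple_curve_same_range g g' :
  simple_curve g -> simple_curve g' -> range g = range g' ->
  exists2 H, circle_lift H & g' = g \o H \/ g' = (g \o -%R) \o H.
Proof.
move=> Sg0 Sg' rg.
have [c _ gc] : exists2 c, 0 <= c < 1 & g c = g' 0.
  by apply: simple_curve_param => //; rewrite rg; exists 0.
pose g1 := g \o (fun t => t + c).
have Sg : simple_curve g1 by apply: simple_curve_lift => //; exact: circle_lift_addr.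
have g10 : g1 0 = g' 0 by rewrite /g1 /= add0r.
have rg1 : range g1 = range g'.
  rewrite -rg; apply/seteqP; split => x /= [t _ <-]; first by exists (t + c).
  by exists (t - c) => //; rewrite /g1 /= subrK.
have [cg gp gi] := Sg; have [cg' gp' gi'] := Sg'.
have ex t : exists2 s, 0 <= s < 1 & g1 s = g' t.
  by apply: simple_curve_param => //; rewrite rg1; exists t.
pose m t := projT1 (cid2 (ex t)).
have mI t : 0 <= m t < 1 by rewrite /m; case: cid2.
have mE t : g1 (m t) = g' t by rewrite /m; case: cid2.
have m01 t : 0 < t < 1 -> 0 < m t < 1.
  move=> t01; have := mI t; rewrite le_eqVlt => /andP[/orP[/eqP m0|->]-> //].
  have := mE t; rewrite -m0 g10 => /gi' => /(_ _ _); lra.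
have msur y : 0 < y < 1 -> exists2 t, 0 < t < 1 & m t = y.
  move=> y01; have [t t01 tE] : exists2 t, 0 <= t < 1 & g' t = g1 y.
    by apply: simple_curve_param => //; rewrite -rg1; exists y.
  have my : m t = y by apply: gi; rewrite ?mE //; lra.
  exists t => //; have : t != 0; last by rewrite neq_lt; lra.
  apply/eqP => t0; move: tE; rewrite t0 -g10 => /gi; lra.
have cm : {within `]0, 1[, continuous m}.
  rewrite continuous_open_subspace; last exact: interval_open.
  move=> t; rewrite inE /= in_itv /= => t01.
  apply/continuous_at_dist => e e0.
  have [d d0 H] := simple_curve_inverse_dist Sg (m01 _ t01) e0.
  have [d1 d10 H1] := (continuous_at_dist g' t).1 (cg' t) d d0.
  exists d1 => // s ts; rewrite distrC; apply: H; first exact: mI.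
  by rewrite !mE distrC; exact: H1.
have im : {in `]0, 1[ &, injective m}.
  move=> s t; rewrite !in_itv /= => s01 t01 st.
  by apply: gi'; rewrite -?mE ?st //; lra.
have [mi|md] := itv_continuous_inj_mono cm im.
  have [||H LH HE] := @reparametrization_of_open g1 g' m gp gp' g10 m01 _ msur.
  - by move=> s t s0 st t1; apply: mi => //; rewrite in_itv /=; lra.
  - by move=> t _; exact: mE.
  exists ((fun t => t + c) \o H); last by left.
  by apply: circle_lift_comp => //; exact: circle_lift_addr.
have [gpo g1o] : periodic1 (g1 \o -%R) /\ (g1 \o -%R) 0 = g' 0.
  by have [_ gpo _] := simple_curve_opp Sg; split => //=; rewrite oppr0.
have [||||H LH HE] := @reparametrization_of_open (g1 \o -%R) g' (fun t => 1 - m t) gpo gp' g1o.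
- by move=> t /m01; lra.
- move=> s t s0 st t1; rewrite ltrD2l ltrN2.
  by apply: md => //; rewrite in_itv /=; lra.
- move=> y y01; have [|t t01 tE] := msur (1 - y); first by lra.
  by exists t => //; rewrite tE; ring.
- by move=> t _ /=; rewrite opprB -mE -[LHS]gp; congr g1; ring.
exists ((fun t => t + - c) \o H).
  by apply: circle_lift_comp => //; exact: circle_lift_addr.
right; rewrite HE; apply/funext => t /=; congr g; ring.
Qed.

End Reparametrization.

(** * Polygonal knots as piecewise linear curves *)

Section Polygons.
Context {R : realType}.
Notation V := (space3 R).
Implicit Types (g h : R -> V) (a b p : V).

Definition seg a b (l : R) : V := (1 - l) *: a + l *: b.

Lemma segE a b l : seg a b l = a + l *: (b - a).
Proof. by apply/rowP => i; rewrite !mxE; ring. Qed.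

Lemma seg_left a b l m : seg a (seg a b l) m = seg a b (m * l).
Proof. by apply/rowP => i; rewrite !mxE; ring. Qed.

Lemma seg_right a b l m : seg (seg a b l) b m = seg a b (l + m * (1 - l)).
Proof. by apply/rowP => i; rewrite !mxE; ring. Qed.

Definition on_seg a b x := exists2 l, 0 <= l <= 1 & seg a b l = x.

Lemma on_seg_split a b l x : 0 < l < 1 ->
  on_seg a b x <-> on_seg a (seg a b l) x \/ on_seg (seg a b l) b x.
Proof.
move=> l01; have ln : l != 0 by lra.
have ln1 : 1 - l != 0 by lra.
split=> [[m m01 <-]|].
  have [ml|lm] := leP m l.
    left; exists (m / l); first by rewrite divr_ge0 ?ler_pdivrMr //=; lra.
    by rewrite seg_left divfK.
  right; exists ((m - l) / (1 - l)).
    by rewrite divr_ge0 ?ler_pdivrMr //=; lra.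
  by rewrite seg_right divfK //; congr seg; ring.
case=> [[m m01 <-]|[m m01 <-]].
  by exists (m * l); [apply/andP; split; nra|rewrite seg_left].
by exists (l + m * (1 - l)); [apply/andP; split; nra|rewrite seg_right].
Qed.

Definition on_segs (s : seq (V * V)) x := exists2 ab, ab \in s & on_seg ab.1 ab.2 x.

Lemma on_segs_cons ab s x :
  on_segs (ab :: s) x <-> on_seg ab.1 ab.2 x \/ on_segs s x.
Proof.
split=> [[cd]|[abx|[cd cds cdx]]].
- by rewrite inE => /orP[/eqP ->|cds] cdx; [left|right; exists cd].
- by exists ab => //; rewrite mem_head.
- by exists cd => //; rewrite inE cds orbT.
Qed.

(** Cutting at [p] makes [p] an end point of every segment through it, except for
    segments of length zero. *)
Lemma segs_split_at p (s : seq (V * V)) : exists s',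
  (forall x, on_segs s x <-> on_segs s' x) /\
  forall ab, ab \in s' -> forall l, 0 < l < 1 -> seg ab.1 ab.2 l = p -> ab.1 = ab.2.
Proof.
elim: s => [|[a b] s [s' [ss' s'p]]]; first by exists [::].
have [[l [l01 lp]]|np] := pselect (exists l, 0 < l < 1 /\ seg a b l = p); last first.
  exists ((a, b) :: s'); split=> [x|].
    by rewrite !on_segs_cons ss'.
  move=> cd; rewrite inE => /orP[/eqP ->|]; last exact: s'p.
  by move=> l l01 lp; exfalso; apply: np; exists l.
exists ((a, p) :: (p, b) :: s'); split=> [x|].
  by rewrite !on_segs_cons /= ss' (on_seg_split _ _ _ l01) lp; tauto.
move=> cd; rewrite !inE => /or3P[/eqP ->|/eqP ->|]; last exact: s'p.
  move=> m m01 /=; rewrite segE => /eqP; rewrite -subr_eq0.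
  have -> : a + m *: (p - a) - p = (m - 1) *: (p - a).
    by apply/rowP => i; rewrite !mxE; ring.
  rewrite scaler_eq0 !subr_eq0 => /orP[/eqP m1|/eqP ->//].
  by exfalso; lra.
move=> m m01 /=; rewrite segE => /eqP; rewrite -subr_eq0.
rewrite addrAC subrr add0r scaler_eq0 !subr_eq0 => /orP[/eqP m1|/eqP ->//].
by exfalso; lra.
Qed.

Lemma continuous_seg a b : continuous (seg a b).
Proof.
move=> l; apply: cvgD.
  by apply: cvgZ; [apply: cvgB; [exact: cvg_cst|exact: cvg_id]|exact: cvg_cst].
by apply: cvgZ; [exact: cvg_id|exact: cvg_cst].
Qed.

Lemma closed_on_seg a b : closed (on_seg a b).
Proof.
have -> : on_seg a b = seg a b @` `[0, 1].
  apply/seteqP; split => x [l]; first by move=> l01 <-; exists l => //=; rewrite in_itv.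
  by rewrite /= in_itv /= => l01 <-; exists l.
apply: compact_closed; first exact: norm_hausdorff.
apply: continuous_compact; last exact: segment_compact.
exact/continuous_subspaceT/continuous_seg.
Qed.

(** The part of the segment between the two points avoids the base point, so
    that its parameters vary continuously and take all intermediate values. *)
Lemma segment_times_convex g a b t1 t t2 : simple_curve g ->
  (forall l, 0 <= l <= 1 -> range g (seg a b l)) ->
  (forall l, 0 < l < 1 -> seg a b l = g 0 -> a = b) ->
  0 < t1 -> t1 < t -> t < t2 -> t2 < 1 ->
  on_seg a b (g t1) -> on_seg a b (g t2) -> on_seg a b (g t).
Proof.
move=> Sg inr nb t10 t1t tt2 t21 [l1 l101 e1] [l2 l201 e2].
have [cg gp gi] := Sg.
have t12 : g t1 <> g t2 by move=> /gi; lra.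
have ab : a != b.
  apply/eqP => ab; apply: t12; rewrite -e1 -e2 ab.
  by rewrite !segE subrr !scaler0.
pose lo := Num.min l1 l2; pose hi := Num.max l1 l2.
have lohi : lo <= hi by rewrite /lo /hi ge_min !le_max lexx.
have I01 l : lo <= l <= hi -> 0 <= l <= 1.
  by rewrite /lo /hi ge_min le_max => /andP[/orP[h|h] /orP[h'|h']]; move: l101 l201 h h'; clear; lra.
have nb' l : lo <= l <= hi -> seg a b l <> g 0.
  move=> Il lb.
  have [l0|l0] := eqVneq l l1; first by move: lb; rewrite l0 e1 => /gi; lra.
  have [l0'|l0'] := eqVneq l l2; first by move: lb; rewrite l0' e2 => /gi; lra.
  move/eqP: ab; apply; apply: (nb l) => //; move: Il l0 l0'.
  rewrite /lo /hi ge_min le_max !neq_lt.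
  by move=> /andP[/orP[h|h] /orP[h'|h']] /orP[i|i] /orP[i'|i'];
    move: l101 l201 h h' i i'; clear; lra.
pose cl l := Num.max lo (Num.min hi l).
have clI l : lo <= cl l <= hi by rewrite /cl le_max lexx /= ge_max lohi ge_min lexx.
have clE l : lo <= l <= hi -> cl l = l.
  by move=> /andP[h1 h2]; rewrite /cl (min_idPr h2) (max_idPr h1).
have ccl : continuous cl.
  apply: continuous_real_max; first exact: cst_continuous.
  by apply: continuous_real_min => l; [exact: cst_continuous|exact: cvg_id].
have ex l : exists2 t, 0 <= t < 1 & g t = seg a b (cl l).
  by apply: simple_curve_param => //; apply: inr; apply: I01.
pose th l := projT1 (cid2 (ex l)).
have thI l : 0 <= th l < 1 by rewrite /th; case: cid2.
have thE l : g (th l) = seg a b (cl l) by rewrite /th; case: cid2.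
have th0 l : 0 < th l < 1.
  have := thI l; rewrite le_eqVlt => /andP[/orP[/eqP t0|->]-> //].
  by have := nb' _ (clI l); rewrite -thE -t0.
have csc : continuous (seg a b \o cl).
  by apply: continuous_comp_fun => //; exact: continuous_seg.
have cth : continuous th.
  move=> l; apply/continuous_at_dist => e e0.
  have [d d0 H] := simple_curve_inverse_dist Sg (th0 l) e0.
  have [d1 d10 H1] := (continuous_at_dist (seg a b \o cl) l).1 (csc l) d d0.
  exists d1 => // l' ll'; rewrite distrC; apply: H; first exact: thI.
  by rewrite !thE distrC; exact: H1.
have I1 : lo <= l1 <= hi by rewrite /lo /hi ge_min le_max lexx.
have I2 : lo <= l2 <= hi by rewrite /lo /hi ge_min le_max lexx !orbT.
have th1 : th l1 = t1 by apply: gi => //; rewrite ?thE ?clE ?e1 //; lra.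
have th2 : th l2 = t2 by apply: gi => //; rewrite ?thE ?clE ?e2 //; lra.
have [||l] := @IVT R th lo hi t lohi.
- exact: continuous_subspaceT.
- rewrite /lo /hi minElt maxElt.
  case: (ltP l1 l2) => _; rewrite th1 th2 ge_min le_max.
    by apply/andP; split; apply/orP; [left|right]; exact: ltW.
  by apply/andP; split; apply/orP; [right|left]; exact: ltW.
rewrite in_itv /= => lI lt; exists l; first exact: I01.
by rewrite -lt thE clE.
Qed.

(** The curve runs once along a straight segment, at a speed given by [r]. *)
Definition edge g (x y : R) := x < y /\ exists r : R -> R,
  [/\ r x = 0, r y = 1, forall s t, x <= s -> s < t -> t <= y -> r s < r t,
      forall c, 0 <= c <= 1 -> exists2 t, x <= t <= y & r t = c &
      forall t, x <= t <= y -> g t = seg (g x) (g y) (r t)].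

Lemma edge_of_segment g a b x y : simple_curve g -> x < y -> y < x + 1 ->
  (forall t, x <= t <= y -> on_seg a b (g t)) -> edge g x y.
Proof.
move=> Sg xy yx1 gab; have [cg gp gi] := Sg.
have inj s t : x <= s <= y -> x <= t <= y -> g s = g t -> s = t.
  by move=> sI tI /(simple_curve_lt1 Sg); apply; rewrite ltr_norml; lra.
have [i abi] : exists i, a 0 i != b 0 i.
  apply: contrapT => nab; have ab : a = b.
    by apply/rowP => i; apply: contrapT => /eqP ni; apply: nab; exists i.
  have [|l1 _ e1] := gab x; first by lra.
  have [|l2 _ e2] := gab y; first by lra.
  suff : x = y by lra.
  by apply: inj; rewrite -?e1 -?e2 ?ab ?segE ?subrr ?scaler0 //; lra.
pose la t := (g t 0 i - a 0 i) / (b 0 i - a 0 i).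
have bai : b 0 i - a 0 i != 0 by rewrite subr_eq0 eq_sym.
have laE t : x <= t <= y -> g t = seg a b (la t).
  move=> /gab[l _ lE]; rewrite -[LHS]lE; congr seg; rewrite /la -lE segE !mxE.
  by rewrite addrAC subrr add0r mulfK.
have cla : continuous la.
  move=> t; apply: cvgM; last exact: cvg_cst.
  apply: cvgB; last exact: cvg_cst.
  exact: (continuous_comp_fun cg (@coord_continuous R 1 3 0 i)).
have D0 : la y - la x != 0.
  rewrite subr_eq0; apply/eqP => D0; suff : x = y by lra.
  by apply: inj; rewrite ?laE ?D0 //; lra.
pose r t := (la t - la x) / (la y - la x).
have rx : r x = 0 by rewrite /r subrr mul0r.
have ry : r y = 1 by rewrite /r divff.
have cr : continuous r.
  move=> t; apply: cvgM; last exact: cvg_cst.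
  by apply: cvgB; [exact: cla|exact: cvg_cst].
have rmono : {in `[x, y] &, {mono r : s t / s <= t}}.
  apply: segment_continuous_inj_le; first by rewrite rx ry.
    exact: continuous_subspaceT.
  move=> s t; rewrite !in_itv /= => sI tI /(congr1 (fun u => u * (la y - la x))).
  rewrite /r !divfK // => /addIr st; apply: inj => //; rewrite !laE // st //.
split => //; exists r; split => //.
- move=> s t xs st ty; rewrite ltNge rmono ?in_itv /= -?ltNge //; lra.
- move=> c c01; have [||t] := @IVT R r x y c (ltW xy).
  + exact: continuous_subspaceT.
  + by rewrite rx ry minElt maxElt ltr01.
  by rewrite in_itv /= => tI tc; exists t.
- move=> t tI; rewrite (laE t) // (laE x) ?(laE y) //; [|lra|lra].
  rewrite !segE; apply/rowP => k; rewrite !mxE /r; field; exact: D0.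
Qed.

Fixpoint edge_path g x (l : seq R) :=
  if l is y :: l' then edge g x y /\ edge_path g y l' else True.

Lemma edge_path_le g x l : edge_path g x l -> x <= last x l.
Proof.
elim: l x => [|y l IH] x //= [[xy _] /IH]; exact/le_trans/ltW.
Qed.

(** A clock that makes the curve run along the k-th segment between the times k
    and k + 1. *)
Lemma edge_path_clock g x l : edge_path g x l -> exists M : R -> R,
  [/\ M x = 0, M (last x l) = (size l)%:R,
      forall s t, x <= s -> s < t -> t <= last x l -> M s < M t,
      forall c, 0 <= c <= (size l)%:R -> exists2 t, x <= t <= last x l & M t = c &
      (0 < size l)%N -> forall t, x <= t <= last x l -> exists k th,
        [/\ (k < size l)%N, 0 <= th <= 1, M t = k%:R + th &
            g t = seg (g (nth 0 (x :: l) k)) (g (nth 0 (x :: l) k.+1)) th]].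
Proof.
elim: l x => [|y l IH] x.
  move=> _; exists (fun t => t - x); split => //=.
  - by rewrite subrr.
  - by rewrite subrr.
  - by move=> s t _ st _; rewrite ltrD2r.
  - by move=> c c0; exists x; [lra|rewrite subrr; lra].
move=> /= [[xy [r [rx ry ri rs rE]]] gl].
have [M [My Ml Mi Ms ME]] := IH y gl; have yl := edge_path_le gl.
exists (fun t => if t <= y then r t else 1 + M t); split.
- by rewrite (ltW xy).
- have [ly|_] := leP (last y l) y; last by rewrite Ml -natr1 addrC.
  have lyE : last y l = y by apply/eqP; rewrite eq_le ly.
  by rewrite lyE ry -natr1 -Ml lyE My add0r.
- move=> s t xs st tl; have [ty|yt] := leP t y.
    by rewrite (ltW (lt_le_trans st ty)); apply: ri.
  have M0 : 0 < M t by rewrite -My; apply: Mi.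
  have [sy|ys] := leP s y; last by rewrite ltrD2l; apply: Mi => //; exact: ltW.
  suff : r s <= 1 by lra.
  move: sy; rewrite le_eqVlt => /orP[/eqP ->|sy]; first by rewrite ry.
  by rewrite -ry; apply/ltW/ri.
- move=> c c01; have [c1|c1] := leP c 1.
    have [|t t01 tE] := rs c; first by lra.
    exists t; first by have := yl; lra.
    by have [_|yt] := leP t y; [|lra].
  have [|t t01 tE] := Ms (c - 1); first by rewrite -natr1 in c01; lra.
  exists t; first by lra.
  have [ty|yt] := leP t y; last by rewrite tE; ring.
  have ty' : t = y by apply/eqP; rewrite eq_le ty; lra.
  by rewrite ty' My in tE; lra.
- move=> _ t tI; have [ty|yt] := leP t y.
    exists 0%N, (r t); split => //=; last 2 first.
    + by rewrite add0r.
    + by apply: rE; lra.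
    have rle s s' : x <= s -> s <= s' -> s' <= y -> r s <= r s'.
      by rewrite [s <= _]le_eqVlt => xs /orP[/eqP->//|ss] sy; apply/ltW/ri.
    by rewrite -rx -[X in _ && (_ <= X)]ry !rle //; lra.
  have l0 : (0 < size l)%N.
    by case: l tI {gl IH Ml Mi Ms ME yl} => //= tI; lra.
  have [|k [th [kl th01 Mt gt]]] := ME l0 t; first by lra.
  exists k.+1, th; split => //.
  by rewrite Mt -natr1; ring.
Qed.

Lemma edge_path_of_adjacent g x (l : seq R) : path <%R x l ->
  (forall y z, y \in x :: l -> z \in x :: l -> y < z ->
     (forall w, w \in x :: l -> ~~ (y < w < z)) -> edge g y z) -> edge_path g x l.
Proof.
elim: l x => [|y l IH] x //= /andP[xy yl] H; split.
  apply: H => //; rewrite ?inE ?eqxx ?orbT // => w.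
  rewrite !inE => /or3P[/eqP ->|/eqP ->|wl]; rewrite ?ltxx ?andbF //.
  have /allP /(_ _ wl) yw := order_path_min lt_trans yl.
  by apply/negP => /andP[_]; rewrite ltNge ltW.
apply: IH => // a b al bl ab H'; apply: H => //.
- by rewrite inE al orbT.
- by rewrite inE bl orbT.
move=> w; rewrite inE => /orP[/eqP ->|]; last exact: H'.
apply/negP => /andP[ax _].
have /allP xl : all (> x) (y :: l).
  by apply: (order_path_min lt_trans); rewrite /= xy.
by have := xl _ al; rewrite ltNge ltW.
Qed.

Lemma path_lt_last (x : R) l w : path <%R x l -> w \in x :: l -> w <= last x l.
Proof.
elim: l x w => [|y l IH] x w /=; first by rewrite inE => _ /eqP ->.
move=> /andP[xy yl]; rewrite inE => /orP[/eqP ->|/(IH _ _ yl) //].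
by apply: le_trans (ltW xy) _; apply: IH => //; rewrite mem_head.
Qed.

Lemma closed_between (C : set R) y z : closed C -> y < z ->
  (forall t, y < t < z -> C t) -> forall t, y <= t <= z -> C t.
Proof.
move=> cC yz H t tI; apply: contrapT => nC.
have oC : open (~` C) by exact: closed_openC.
have /nbhs_ballP[d /= d0 dC] : nbhs t (~` C) by exact: open_nbhs_nbhs.
pose e := Num.min d (z - y) / 4.
have e0 : 0 < e by rewrite divr_gt0 // lt_min d0 subr_gt0.
have [ed ez] : 4 * e <= d /\ 4 * e <= z - y.
  have -> : 4 * e = Num.min d (z - y) by rewrite /e mulrC divfK.
  by split; rewrite ge_min lexx ?orbT.
have inC s : `|t - s| < d -> y < s < z -> False.
  by move=> ts sI; apply: (dC s); [rewrite -ball_normE|exact: H].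
have [ty|ty] := leP (t - y) (2 * e).
  by apply: (inC (t + e)); [rewrite ltr_norml|]; lra.
by apply: (inC (t - e)); [rewrite ltr_norml|]; lra.
Qed.

(** The parameters of each segment form an interval, so that the end points of
    these finitely many intervals cut the unit interval into edges. *)
Lemma polygonal_curve_edges g (s : seq (V * V)) : simple_curve g ->
  (forall x, range g x <-> on_segs s x) ->
  exists l, [/\ edge_path g 0 l, (0 < size l)%N & last 0 l = 1].
Proof.
move=> Sg rg; have [cg gp gi] := Sg.
have [s' [ss' nb]] := segs_split_at (g 0) s.
pose T (ab : V * V) := [set t : R | 0 < t < 1 /\ on_seg ab.1 ab.2 (g t)].
(* the midpoint keeps every edge shorter than a full turn *)
pose X : seq R := [:: 0; 2^-1; 1] ++ [seq inf (T ab) | ab <- s'] ++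
  [seq sup (T ab) | ab <- s'].
pose X1 : seq R := [seq x <- X | 0 <= x <= 1].
pose xs : seq R := sort <=%R (undup X1).
have xsE w : (w \in xs) = (0 <= w <= 1) && (w \in X).
  by rewrite mem_sort mem_undup mem_filter.
have xs_sorted : sorted <%R xs.
  by rewrite lt_sorted_uniq_le sort_uniq undup_uniq sort_le_sorted.
have in0 : 0 \in xs by rewrite xsE !inE eqxx lexx ler01.
have in1 : 1 \in xs by rewrite xsE !inE eqxx lexx ler01 !orbT.
have inh : 2^-1 \in xs.
  by rewrite xsE !inE eqxx !orbT andbT; apply/andP; split; lra.
have xs01 w : w \in xs -> 0 <= w <= 1 by rewrite xsE => /andP[].
have edge_xs y z : y \in xs -> z \in xs -> y < z ->
    (forall w, w \in xs -> ~~ (y < w < z)) -> edge g y z.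
  move=> yxs zxs yz nw; have y01 := xs01 _ yxs; have z01 := xs01 _ zxs.
  have yz1 : z < y + 1.
    by have /negP := nw _ inh; rewrite ltNge => nh; apply/negP => h; apply: nh; lra.
  pose m := (y + z) / 2; have mI : y < m < z by rewrite /m; lra.
  have [ab abs abm] : on_segs s' (g m) by rewrite -ss' -rg; exists m.
  have Tm : T ab m by split => //; lra.
  have T01 t : T ab t -> 0 < t < 1 by case.
  have lbT : lbound (T ab) 0 by move=> t /T01; lra.
  have ubT : ubound (T ab) 1 by move=> t /T01; lra.
  have infm : inf (T ab) <= m by apply: ge_inf => //; exists 0.
  have supm : m <= sup (T ab) by apply: ub_le_sup => //; exists 1.
  have inf0 : 0 <= inf (T ab) by apply: lb_le_inf => //; exists m.
  have sup1 : sup (T ab) <= 1 by apply: ge_sup => //; exists m.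
  have infy : inf (T ab) <= y.
    have : inf (T ab) \in xs.
      rewrite xsE inf0 mem_cat mem_cat (map_f (fun ab => inf (T ab)) abs).
      by rewrite /= orbT andbT; move: infm mI z01; clear; lra.
    by move=> /nw; rewrite negb_and -!leNgt => /orP[//|]; move: infm mI; clear; lra.
  have supz : z <= sup (T ab).
    have : sup (T ab) \in xs.
      rewrite xsE sup1 mem_cat mem_cat (map_f (fun ab => sup (T ab)) abs).
      by rewrite !orbT !andbT; move: supm mI y01; clear; lra.
    by move=> /nw; rewrite negb_and -!leNgt => /orP[|//]; move: supm mI; clear; lra.
  apply: (@edge_of_segment _ ab.1 ab.2) => //.
  apply: (@closed_between (g @^-1` on_seg ab.1 ab.2)) => //.
    by move/continuous_closedP : cg; apply; exact: closed_on_seg.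
  move=> t tI /=.
  have [t1 [t101 t1s] t1t] : exists2 t1, T ab t1 & t1 < t.
    apply: contrapT => nt; have : t <= inf (T ab); last by move: infy tI; clear; lra.
    apply: lb_le_inf; first by exists m.
    by move=> u Tu; rewrite leNgt; apply/negP => ut; apply: nt; exists u.
  have [t2 [t201 t2s] tt2] : exists2 t2, T ab t2 & t < t2.
    apply: contrapT => nt; have : sup (T ab) <= t; last by move: supz tI; clear; lra.
    apply: ge_sup; first by exists m.
    by move=> u Tu; rewrite leNgt; apply/negP => ut; apply: nt; exists u.
  apply: (segment_times_convex Sg _ _ _ t1t tt2) => //;
    [| |by case/andP: t101|by case/andP: t201].
  - by move=> l l01; rewrite rg ss'; exists ab => //; exists l.
  - by move=> l; exact: nb.
move: xs_sorted in0 in1 xs01 edge_xs; case: xs {xsE inh} => [//|x l] /= xl in0 in1 xs01 gx.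
have x0 : x = 0.
  apply/eqP; rewrite eq_le; apply/andP; split; last by have := xs01 x (mem_head _ _); lra.
  move: in0; rewrite inE => /orP[/eqP ->//|/(allP (order_path_min lt_trans xl))].
  exact: ltW.
have l1 : last x l = 1.
  apply/eqP; rewrite eq_le (path_lt_last xl in1) andbT.
  by have := xs01 _ (mem_last x l); lra.
exists l; rewrite -x0; split => //; first exact: edge_path_of_adjacent.
by case: l l1 {xl in0 in1 xs01 gx} => //= x1; move: (@ltr01 R); rewrite -x1 x0 ltxx.
Qed.

Lemma polygonal_curve_pl g (s : seq (V * V)) : simple_curve g ->
  (forall x, range g x <-> on_segs s x) ->
  exists n h H, [/\ (0 < n)%N, is_pl n h, simple_curve h, circle_lift H & g = h \o H].
Proof.
move=> Sg rg; have [cg gp gi] := Sg.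
have [l [gl l0 l1]] := polygonal_curve_edges Sg rg.
have [M [M0 Ml Mi Ms ME]] := edge_path_clock gl; rewrite l1 in Ml Mi Ms ME.
pose n := size l; have nR : 0 < n%:R :> R by rewrite ltr0n.
have nn : n%:R != 0 :> R by rewrite gt_eqF.
pose v (k : nat) := g (nth 0 (0 :: l) k).
pose h := pl_curve n (fun j => v `|(j %% n%:Z)%Z|%N).
have hn : is_pl n h by exact: is_pl_pl_curve.
have hp : periodic1 h by apply: pl_curve_periodic => // j; rewrite modzDr.
have hv (k : nat) : (k <= n)%N -> h (k%:R / n%:R) = v k.
  move=> kn; have := @pl_curve_vertex R n (fun j => v `|(j %% n%:Z)%Z|%N) k%:Z l0.
  rewrite -pmulrn /h => ->; move: kn; rewrite leq_eqVlt => /orP[/eqP ->|kn].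
    have -> : v n = g 1 by rewrite /v /n -(last_nth 0 0 l) l1.
    by rewrite modzz /v /= -[in LHS](gp 0) add0r.
  by rewrite modz_small.
have [||||H LH HM] := @circle_lift_of_bijection R (fun t => M t / n%:R).
- by move=> a b a0 ab b1; rewrite ltr_pM2r ?invr_gt0 //; exact: Mi.
- by rewrite M0 mul0r.
- by rewrite Ml divff.
- move=> y y01; have [|t t01 tE] := Ms (y * n%:R).
    by apply/andP; split; [rewrite mulr_ge0 //; lra|rewrite ler_piMl //; lra].
  by exists t => //; rewrite tE mulfK.
have gE : g = h \o H.
  have [_ _ H1] := LH; apply: periodic1_eq => //; first by move=> t /=; rewrite H1 hp.
  move=> t t01; rewrite /= HM; last by lra.
  have [|k [th [kl th01 -> ->]]] := ME l0 t; first by lra.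
  have := hn k%:Z th th01.
  have -> : (k%:Z + 1)%:~R = k.+1%:R :> R by rewrite rmorphD /= -pmulrn natr1.
  by rewrite -pmulrn !hv // ltnW.
have [K LK [HK KH]] := circle_lift_inverse LH.
exists n, h, H; split => //.
have -> : h = g \o K by rewrite gE; apply/funext => t /=; rewrite KH.
exact: simple_curve_lift.
Qed.

End Polygons.

(** * Rational polygons and their highest point *)

Section TameTypes.
Context {R : realType}.
Notation V := (space3 R).
Implicit Types (g h : R -> V).

Lemma isotopic_rat_curve_of_local g : simple_curve g -> locally_bilip g ->
  pl_approximable g ->
  exists s, [/\ (0 < size s)%N, simple_curve (rat_curve s : R -> V) &
    isotopic_curves g (rat_curve s)].
Proof.
move=> Sg lg ag; have [c c0 gc] := bilip_curve_of_local Sg lg.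
have [_ gp _] := Sg; have [s [s0 gs]] := isotopic_rat_curve c0 gp gc ag.
by exists s; split => //; exact: isotopic_curves_simple gs Sg.
Qed.

(** Smooth and polygonal knots have bi-Lipschitz parametrizations that polygons
    approximate. The given orientation selects such a parametrization or its
    reverse. *)
Lemma tame_rat_curve (k : oriented_set R) : is_oriented_knot k ->
  smooth_knot (carrier k) \/ polygonal_knot (carrier k) ->
  exists s, [/\ (0 < size s)%N, simple_curve (rat_curve s : R -> V) &
    exists2 Phi, isotopy_end Phi & oriented_image Phi k = knot_of (rat_curve s)].
Proof.
move=> /oriented_knot_curve[g Sg ->] /= tame.
suff [g' Eg [Sg' [lg ag]]] : exists2 g', knot_of g = knot_of g' & 
    simple_curve g' /\ locally_bilip g' /\ pl_approximable g'.
  have [s [s0 Ss [Phi ePhi E]]] := isotopic_rat_curve_of_local Sg' lg ag.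
  exists s; split => //; exists Phi => //.
  by rewrite Eg oriented_image_knot_of E.
case: tame => [/smooth_knot_curve[h [Sh rh ih]]|[_ [s gs]]].
  have [H LH HE] := simple_curve_same_range Sh Sg rh.
  suff [g' [Sg' ig' E]] : exists g', [/\ simple_curve g', immersed g' & g = g' \o H].
    exists g'; first by rewrite E knot_of_lift //; case: Sg'.
    split => //; split; first exact: immersed_locally_bilip.
    exact: immersed_pl_approximable.
  case: HE => ->; first by exists h.
  by exists (h \o -%R); split => //; [exact: simple_curve_opp|exact: immersed_opp].
have rg x : range g x <-> on_segs s x.
  rewrite gs; split=> [[ab abs [t t01 tx]]|[ab abs [t t01 tx]]].
    by exists ab => //; exists t => //; move: t01; rewrite /= in_itv.
  by exists ab => //; exists t => //; rewrite /= in_itv.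
have [n [h [H [n0 hn Sh LH E]]]] := polygonal_curve_pl Sg rg.
exists h; first by rewrite E knot_of_lift //; case: Sh.
split => //; split; first exact: is_pl_locally_bilip hn.
by have [_ hp _] := Sh; exact: is_pl_approximable hn hp.
Qed.

(** Ambient isotopy up to orientation preserving reparametrization. *)
Definition deforms g g' := exists Phi H,
  [/\ isotopy_end Phi, circle_lift H & g' = Phi \o g \o H].

Lemma deforms_trans g1 g2 g3 : deforms g1 g2 -> deforms g2 g3 -> deforms g1 g3.
Proof.
move=> [F [H [eF LH ->]]] [F' [H' [eF' LH' ->]]]; exists (F' \o F), (H \o H').
split => //; first exact: isotopy_end_comp.
exact: circle_lift_comp.
Qed.

Lemma deforms_end g Phi : isotopy_end Phi -> deforms g (Phi \o g).
Proof.
move=> eP; exists Phi, (fun t => t + 0); split => //.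
  exact: circle_lift_addr.
by apply/funext => t /=; rewrite addr0.
Qed.

Lemma deforms_lift g H : circle_lift H -> deforms g (g \o H).
Proof.
by move=> LH; exists id, H; split => //; exact: isotopy_end_id.
Qed.

Lemma deforms_simple g g' : deforms g g' -> simple_curve g -> simple_curve g'.
Proof.
move=> [F [H [eF LH ->]]] Sg; apply: simple_curve_lift => //.
by apply: (@isotopic_curves_simple _ g) => //; exists F.
Qed.

Lemma is_pl_shift n g i : (0 < n)%N -> is_pl n g ->
  is_pl n (g \o (fun t => t + i%:R / n%:R)).
Proof.
move=> n0 gn j th th01 /=.
have E x : x / n%:R + i%:R / n%:R = (x + i%:R) / n%:R :> R by rewrite mulrDl.
rewrite !E; have -> : j%:~R + th + i%:R = (j + i%:Z)%:~R + th :> R.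
  by rewrite rmorphD /= -pmulrn; ring.
rewrite gn // !rmorphD /= -!pmulrn.
by congr (_ *: _ + _ *: g (_ / _)); ring.
Qed.

Definition affine_map (F : V -> V) := forall (p q : V) (l : R),
  F ((1 - l) *: p + l *: q) = (1 - l) *: F p + l *: F q.

Lemma is_pl_affine n g F : affine_map F -> is_pl n g -> is_pl n (F \o g).
Proof. by move=> aF gn j th th01 /=; rewrite gn // aF. Qed.

Lemma affine_shear a b c (v : V) : affine_map (fun p => p + linform a b c p *: v).
Proof.
move=> p q l; rewrite /linform !coE.
by apply/rowP => i; rewrite !mxE; ring.
Qed.

Lemma affine_translation (v : V) : affine_map (fun p => p + v).
Proof. by move=> p q l; apply/rowP => i; rewrite !mxE; ring. Qed.

Lemma is_pl_simple_gt1 n g : (0 < n)%N -> is_pl n g -> simple_curve g -> (1 < n)%N.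
Proof.
case: n => [//|[|//]] _ gn [_ gp gi].
have e := gn 0 (2^-1) ltac:(lra).
have g1 : g ((0 + 1)%:~R / 1%:R) = g 0 by rewrite divr1 -[RHS]gp !add0r.
have g0 : g (0%:~R / 1%:R) = g 0 by rewrite divr1.
rewrite g1 g0 -scalerDl subrK scale1r divr1 add0r in e.
have := gi 2^-1 0 _ _ e; lra.
Qed.

(** A vertex that is farthest from a given point is the only one at which the
    linear form in its direction is maximal. If that point lies far below the
    knot, a shear turns this form into the height. *)
Lemma deforms_top n g : (0 < n)%N -> is_pl n g -> simple_curve g ->
  exists g', [/\ deforms g g', is_pl n g', simple_curve g', g' 0 = 0 &
    forall t, 0 < t < 1 -> zco (g' t) < 0].
Proof.
move=> n0 gn Sg; have n1 := is_pl_simple_gt1 n0 gn Sg.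
have nR : 0 < n%:R :> R by rewrite ltr0n.
have nn : n%:R != 0 :> R by rewrite gt_eqF.
pose v (j : nat) := g (j%:R / n%:R).
(* the vertex [v i] is farthest from the point [(0, 0, - L)] *)
pose L : R := 1 + \sum_(j < n.+1) `|v j|.
have vL (j : nat) : (j <= n)%N -> `|v j| < L.
  move=> jn; rewrite /L (bigD1 (Ordinal (jn : (j < n.+1)%N))) //= addrCA ltrDl.
  by rewrite ltr_wpDr ?sumr_ge0.
pose Q (p : V) := xco p ^+ 2 + yco p ^+ 2 + (zco p + L) ^+ 2.
have [i _ Qi] := arg_maxP (i0 := ord0 : 'I_n.+1) (fun j => Q (v j)) (isT : xpredT _).
have ni : (i <= n)%N := ltn_ord i.
pose g1 := g \o (fun t => t + i%:R / n%:R).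
have dg1 : deforms g g1 by apply: deforms_lift; exact: circle_lift_addr.
have g1n : is_pl n g1 by exact: is_pl_shift.
have Sg1 := deforms_simple dg1 Sg.
have [cg gp gi] := Sg.
pose P := g1 0; have PE : P = v i by rewrite /P /g1 /= add0r.
have QP (j : int) : Q (g1 (j%:~R / n%:R)) <= Q P.
  have jE : (j + i%:Z)%:~R / n%:R = `|((j + i%:Z) %% n%:Z)%Z|%N%:R / n%:R
      + (((j + i%:Z) %/ n%:Z)%Z)%:~R :> R.
    have {1}-> : j + i%:Z = (`|((j + i%:Z) %% n%:Z)%Z|%N%:Z + ((j + i%:Z) %/ n%:Z)%Z * n%:Z)%R.
      have := divz_eq (j + i%:Z) n%:Z; have := modz_ge0 (j + i%:Z) (d := n%:Z); lia.
    rewrite rmorphD rmorphM /= -!pmulrn; field; exact: lt0r_neq0.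
  rewrite PE /g1 /= -mulrDl.
  have -> : j%:~R + i%:R = (j + i%:Z)%:~R :> R by rewrite rmorphD /= -pmulrn.
  rewrite jE (periodic1_int gp); have jn : (`|((j + i%:Z) %% n%:Z)%Z| < n.+1)%N.
    have := ltz_pmod (j + i%:Z) (d := n%:Z); have := modz_ge0 (j + i%:Z) (d := n%:Z); lia.
  exact: (Qi (Ordinal jn)).
have c0 : 0 < zco P + L.
  have := vL i ni; rewrite -PE => h; have := zco_norm P; rewrite ler_norml; lra.
(* up to a factor, [F1] turns the linear form in the direction of the farthest
   vertex into the height; [F2] moves this vertex to the origin *)
pose F1 := fun p : V => p + linform (xco P / (zco P + L)) (yco P / (zco P + L)) 0 p *: vec3 0 0 1.
have eF1 : isotopy_end F1.
  by apply: isotopy_end_shear; rewrite /linform !coE; ring.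
pose F2 := fun p : V => p + (- F1 P).
have eF2 : isotopy_end F2 by exact: isotopy_end_translation.
pose g3 := F2 \o (F1 \o g1).
have dg3 : deforms g g3.
  apply: deforms_trans dg1 _; apply: deforms_trans; last exact: deforms_end eF2.
  exact: deforms_end.
have g3n : is_pl n g3.
  apply: is_pl_affine; first exact: affine_translation.
  by apply: is_pl_affine => //; exact: affine_shear.
have Sg3 := deforms_simple dg3 Sg.
have g30 : g3 0 = 0 by rewrite /g3 /= /F2 subrr.
exists g3; split => // t t01.
have zg3 s : zco (g3 s) * (zco P + L) =
    - ((xco P) * (xco P - xco (g1 s)) + (yco P) * (yco P - yco (g1 s)) +
       (zco P + L) * (zco P - zco (g1 s))).
  rewrite /g3 /F2 /F1 /= /linform !coE; field; exact: lt0r_neq0.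
have zneg (j : int) : g1 (j%:~R / n%:R) <> P -> zco (g3 (j%:~R / n%:R)) < 0.
  move=> jP; rewrite -(pmulr_llt0 _ c0) zg3; set p := g1 _ in jP *.
  have := QP j; rewrite /Q -/p => Qp.
  have : 0 < (xco P - xco p) ^+ 2 + (yco P - yco p) ^+ 2 + (zco P - zco p) ^+ 2.
    rewrite lt_neqAle !addr_ge0 ?sqr_ge0 // andbT eq_sym; apply/eqP => e.
    have h1 := sqr_ge0 (xco P - xco p); have h2 := sqr_ge0 (yco P - yco p).
    have h3 := sqr_ge0 (zco P - zco p).
    apply: jP; apply: vec3P; apply/eqP; rewrite eq_sym -subr_eq0 -sqrf_eq0; apply/eqP; move: h1 h2 h3 e; clear; lra.
  nra.
have vlt (j : int) : (0 < j < n%:Z)%R -> zco (g3 (j%:~R / n%:R)) < 0.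
  move=> /andP[j0 jn]; apply: zneg; rewrite /P => /(simple_curve_lt1 Sg1) h.
  have : 0 < j%:~R / n%:R :> R by rewrite divr_gt0 // ltr0z.
  have j1 : j%:~R / n%:R < 1 :> R by rewrite ltr_pdivrMr // mul1r pmulrn ltr_int.
  move=> j0'; have := h ltac:(rewrite ltr_norml; lra); lra.
pose j := Num.floor (n%:R * t); pose th := n%:R * t - j%:~R.
have th01 : 0 <= th < 1 by exact: frac_itv.
have tE : t = (j%:~R + th) / n%:R by rewrite /th; field.
have nt0 : 0 < n%:R * t < n%:R.
  by apply/andP; split; nra.
have jn : (j < n%:Z)%R.
  by rewrite -(@ltr_int R) -pmulrn; rewrite /th in th01; lra.
have j0 : (0 <= j)%R.
  have : 0 < (j + 1)%:~R :> R by rewrite rmorphD /=; rewrite /th in th01; lra.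
  by rewrite ltr0z; clear; lia.
have zle (k : int) : (0 <= k <= n%:Z)%R -> zco (g3 (k%:~R / n%:R)) <= 0.
  move=> k01; have [k0|k0] := eqVneq k 0; first by rewrite k0 mul0r g30 zco0.
  have [kn|kn] := eqVneq k n%:Z.
    have [_ g3p _] := Sg3.
    by rewrite kn -pmulrn divff // -[g3 1]g3p -[1 + 1]/(1 + 1) g3p -[X in g3 X]add0r g3p g30 zco0.
  by apply/ltW/vlt; move: k01 k0 kn; clear; lia.
rewrite tE g3n; last by move: th01; clear; lra.
rewrite zcoD !zcoZ; have [jz|jz] := eqVneq j 0.
  have z1 : zco (g3 ((j + 1)%:~R / n%:R)) < 0 by apply: vlt; rewrite jz; move: n1; clear; lia.
  have th0 : 0 < th by move: nt0; rewrite /th jz subr0; lra.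
  have z0 : zco (g3 (j%:~R / n%:R)) = 0 by rewrite jz mul0r g30 zco0.
  rewrite z0 mulr0 add0r; nra.
have z1 : zco (g3 (j%:~R / n%:R)) < 0 by apply: vlt; move: jz j0 jn; clear; lia.
have z2 := zle (j + 1) ltac:(move: j0 jn; clear; lia).
nra.
Qed.

End TameTypes.

(** * Straightening the highest corner *)

Section Corner.
Context {R : realType}.
Notation V := (space3 R).
Implicit Types (g h : R -> V).

Definition planar (a b c d : R) (p : V) : V :=
  vec3 (a * xco p + b * yco p) (c * xco p + d * yco p) (zco p).

Lemma isotopy_end_planar_comp a b c d a' b' c' d' :
  isotopy_end (planar a b c d) -> isotopy_end (planar a' b' c' d') ->
  isotopy_end (planar (a' * a + b' * c) (a' * b + b' * d)
    (c' * a + d' * c) (c' * b + d' * d)).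
Proof.
move=> e e'; have := isotopy_end_comp e e'; congr isotopy_end.
by apply/funext => p; apply: vec3P; rewrite /= /planar !coE //; ring.
Qed.

Lemma isotopy_end_planar_shearx a : isotopy_end (planar 1 a 0 1).
Proof.
have : @linform R 0 a 0 (vec3 1 0 0) = 0 by rewrite /linform !coE; ring.
move=> /isotopy_end_shear; congr isotopy_end; apply/funext => p.
by apply: vec3P; rewrite /planar /linform !coE; ring.
Qed.

Lemma isotopy_end_planar_sheary a : isotopy_end (planar 1 0 a 1).
Proof.
have : @linform R a 0 0 (vec3 0 1 0) = 0 by rewrite /linform !coE; ring.
move=> /isotopy_end_shear; congr isotopy_end; apply/funext => p.
by apply: vec3P; rewrite /planar /linform !coE; ring.
Qed.

(** Shears of the plane are transitive on nonzero vectors. *)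
Lemma planar_to_x (u1 u2 : R) : (u1 != 0) || (u2 != 0) -> exists a b c d,
  [/\ isotopy_end (planar a b c d), a * u1 + b * u2 = 1 & c * u1 + d * u2 = 0].
Proof.
have H u v : v != 0 -> exists a b c d,
    [/\ isotopy_end (planar a b c d), a * u + b * v = 1 & c * u + d * v = 0].
  move=> v0.
  have := isotopy_end_planar_comp (isotopy_end_planar_shearx ((1 - u) / v))
    (isotopy_end_planar_sheary (- v)).
  set a := (_ + _); set b := (X in planar _ X); set c := (X in planar _ _ X).
  set d := (X in planar _ _ _ X) => e; exists a, b, c, d; split => //.
    by rewrite /a /b; field.
  by rewrite /c /d; field.
have [v0|v0] := eqVneq u2 0; last by move=> _; exact: H.
rewrite v0 => /orP[u0|//].
have [a [b [c [d [e h1 h2]]]]] := H u1 u1 u0.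
have := isotopy_end_planar_comp (isotopy_end_planar_sheary 1) e.
set a' := (_ + _); set b' := (X in planar _ X); set c' := (X in planar _ _ X).
set d' := (X in planar _ _ _ X) => e'; exists a', b', c', d'; split => //.
  by rewrite -[RHS]h1 /a' /b'; ring.
by rewrite -[RHS]h2 /c' /d'; ring.
Qed.

(** Shears bring the two edges at the top vertex into the directions
    [(-1, 0, -1)] and [(1, 0, -1)]. *)
Lemma deforms_corner n g : (0 < n)%N -> is_pl n g -> simple_curve g ->
  exists g' al be, [/\ deforms g g', 0 < al /\ 0 < be,
    forall u, 0 <= u <= 1 -> g' (u / n%:R) = (u * al) *: vec3 (-1) 0 (-1),
    forall u, 0 <= u <= 1 -> g' (- (u / n%:R)) = (u * be) *: vec3 1 0 (-1) &
    forall t, 0 < t < 1 -> zco (g' t) < 0].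
Proof.
move=> n0 gn Sg; have n1 := is_pl_simple_gt1 n0 gn Sg.
have [g1 [dg1 g1n Sg1 g10 g1z]] := deforms_top n0 gn Sg.
have nR : 0 < n%:R :> R by rewrite ltr0n.
have nn : n%:R != 0 :> R by rewrite gt_eqF.
have n1R : 1 < n%:R :> R by rewrite ltr1n.
have [_ gp _] := Sg1.
pose A0 := g1 (n%:R^-1); pose B0 := g1 (- n%:R^-1).
have gA u : 0 <= u <= 1 -> g1 (u / n%:R) = u *: A0.
  move=> u01; have := g1n 0 u u01.
  by rewrite !add0r mul0r g10 scaler0 add0r mul1r.
have gB u : 0 <= u <= 1 -> g1 (- (u / n%:R)) = u *: B0.
  move=> u01; have := g1n (-1) (1 - u) ltac:(lra).
  rewrite addNr mul0r g10 scaler0 addr0 mulN1r /B0.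
  have -> : 1 - (1 - u) = u :> R by ring.
  by move=> <-; congr g1; ring.
pose al := - zco A0; pose be := - zco B0.
have iv0 : 0 < (n%:R^-1 : R) < 1 by rewrite invr_gt0 nR invf_lt1.
have al0 : 0 < al by rewrite oppr_gt0; exact: g1z.
have be0 : 0 < be.
  by rewrite oppr_gt0 /B0 -gp; apply: g1z; lra.
pose A := al^-1 *: A0; pose B := be^-1 *: B0.
have A0E : A0 = al *: A by rewrite scalerA divff ?scale1r // gt_eqF.
have B0E : B0 = be *: B by rewrite scalerA divff ?scale1r // gt_eqF.
have zA : zco A = -1 by rewrite zcoZ -[zco A0]opprK -/al mulrN mulVf // gt_eqF.
have zB : zco B = -1 by rewrite zcoZ -[zco B0]opprK -/be mulrN mulVf // gt_eqF.
move: A B A0E B0E zA zB => A B A0E B0E zA zB.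
(* otherwise the two edges would overlap near the corner *)
have AB : A <> B.
  move=> AB; pose s := Num.min al be / 4.
  have [s0 sa sb] : [/\ 0 < s, s <= al / 4 & s <= be / 4].
    by rewrite /s; split; rewrite ?divr_gt0 ?lt_min ?al0 ?be0 // ler_pM2r ?invr_gt0 // ge_min lexx ?orbT.
  have ua : 0 < s / al <= 4^-1 by rewrite divr_gt0 //= ler_pdivrMr //; lra.
  have ub : 0 < s / be <= 4^-1 by rewrite divr_gt0 //= ler_pdivrMr //; move: sb; clear; lra.
  have := gA (s / al) ltac:(move: ua; clear; lra);
    have := gB (s / be) ltac:(move: ub; clear; lra).
  rewrite A0E B0E !scalerA !divfK ?gt_eqF // AB => <- /(simple_curve_lt1 Sg1).
  have ta : 0 < s / al / n%:R <= 4^-1.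
    rewrite divr_gt0 //=; last by case/andP: ua.
    rewrite ler_pdivrMr //; nra.
  have tb : 0 < s / be / n%:R <= 4^-1.
    rewrite divr_gt0 //=; last by case/andP: ub.
    rewrite ler_pdivrMr //; nra.
  by move: ta tb; clear; move=> ta tb /(_ ltac:(rewrite ltr_norml; lra)); lra.
(* [F1] turns the median [C] of the two edges into the vertical direction; a
   planar map then turns half their difference into the first unit vector *)
pose C := 2^-1 *: (A + B).
pose F1 := fun p : V => p + linform 0 0 1 p *: vec3 (xco C) (yco C) 0.
have eF1 : isotopy_end F1.
  by apply: isotopy_end_shear; rewrite /linform !coE; ring.
pose u1 := (xco B - xco A) / 2; pose u2 := (yco B - yco A) / 2.
have u0 : (u1 != 0) || (u2 != 0).
  rewrite -negb_and; apply/negP => /andP[/eqP h1 /eqP h2]; apply: AB.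
  apply: vec3P; rewrite ?zA ?zB //; first by rewrite /u1 in h1; lra.
  by rewrite /u2 in h2; lra.
have [a [b [c [d [eF2 m1 m2]]]]] := planar_to_x u0.
pose F := planar a b c d \o F1.
have eF : isotopy_end F by exact: isotopy_end_comp.
have FE p : F p = vec3 (a * (xco p + zco p * xco C) + b * (yco p + zco p * yco C))
    (c * (xco p + zco p * xco C) + d * (yco p + zco p * yco C)) (zco p).
  by apply: vec3P; rewrite /F /= /planar /F1 /linform !coE; ring.
have FA s : F (s *: A) = s *: vec3 (-1) 0 (-1).
  rewrite FE; apply: vec3P; rewrite !coE zA.
  - transitivity (s * - (a * u1 + b * u2)); last by rewrite m1; ring.
    by rewrite /C /u1 /u2 ?coE; field.
  - transitivity (s * - (c * u1 + d * u2)); last by rewrite m2; ring.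
    by rewrite /C /u1 /u2 ?coE; field.
  - by [].
have FB s : F (s *: B) = s *: vec3 1 0 (-1).
  rewrite FE; apply: vec3P; rewrite !coE zB.
  - transitivity (s * (a * u1 + b * u2)); last by rewrite m1; ring.
    by rewrite /C /u1 /u2 ?coE; field.
  - transitivity (s * (c * u1 + d * u2)); last by rewrite m2; ring.
    by rewrite /C /u1 /u2 ?coE; field.
  - by [].
exists (F \o g1), al, be; split => //.
- by apply: deforms_trans dg1 _; exact: deforms_end.
- by move=> u u01; rewrite /= gA // A0E scalerA FA.
- by move=> u u01; rewrite /= gB // B0E scalerA FB.
- by move=> t /g1z; rewrite /= FE coE.
Qed.

(** The knot hangs from a tent: above the height [- de] there are only two
    straight edges. *)
Definition tent_curve g (de t1 t2 : R) := [/\ [/\ 0 < de, 0 < t1, t1 < t2 & t2 < 1],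
  forall t, 0 <= t <= t1 -> g t = (de * t / t1) *: vec3 (-1) 0 (-1),
  forall t, t2 <= t <= 1 -> g t = (de * (1 - t) / (1 - t2)) *: vec3 1 0 (-1) &
  forall t, t1 <= t <= t2 -> zco (g t) <= - de].

(** The part of the knot away from the corner is compact, so it stays below the
    corner by a positive height, at which the tent is cut off. *)
Lemma deforms_tent n g : (0 < n)%N -> is_pl n g -> simple_curve g ->
  exists g' de t1 t2, deforms g g' /\ tent_curve g' de t1 t2.
Proof.
move=> n0 gn Sg; have n1 := is_pl_simple_gt1 n0 gn Sg.
have [g' [al [be [dg [al0 be0] gA gB gz]]]] := deforms_corner n0 gn Sg.
have Sg' := deforms_simple dg Sg; have [cg gp _] := Sg'.
have nR : 0 < n%:R :> R by rewrite ltr0n.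
have nn : n%:R != 0 :> R by rewrite gt_eqF.
have n1R : 1 < n%:R :> R by rewrite ltr1n.
pose i : R := (2 * n%:R)^-1.
have i0 : 0 < i < 2^-1.
  by rewrite invr_gt0 mulr_gt0 //= ltf_pV2 ?posrE ?mulr_gt0 //; lra.
have cz : {within `[i, 1 - i], continuous (fun t => - zco (g' t))}.
  apply: continuous_subspaceT; apply: continuous_real_opp.
  exact: (continuous_comp_fun cg continuous_zco).
have [|t0 t0I tmin] := @EVT_min R _ i (1 - i) _ cz; first by lra.
have d0 : 0 < - zco (g' t0).
  by rewrite oppr_gt0; apply: gz; move: t0I; rewrite in_itv /=; lra.
pose de := Num.min (- zco (g' t0)) (Num.min (al / 4) (be / 4)).
have [de0 dz da db] : [/\ 0 < de, de <= - zco (g' t0), de <= al / 4 & de <= be / 4].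
  rewrite /de; split; rewrite ?lt_min ?d0 ?divr_gt0 //= !ge_min lexx ?orbT //.
pose t1 := de / al / n%:R; pose t2 := 1 - de / be / n%:R.
have ua : 0 < de / al <= 4^-1 by rewrite divr_gt0 //= ler_pdivrMr //; move: da; clear; lra.
have ub : 0 < de / be <= 4^-1 by rewrite divr_gt0 //= ler_pdivrMr //; move: db; clear; lra.
have iE : i = 2^-1 / n%:R by rewrite /i invfM.
have ti1 : 0 < t1 < i.
  rewrite iE /t1 ltr_pM2r ?invr_gt0 // divr_gt0 //=; last by case/andP: ua.
  by move: ua; clear; lra.
have ti2 : 1 - i < t2 < 1.
  rewrite /t2; have : 0 < de / be / n%:R < i; last by clear; lra.
  rewrite iE ltr_pM2r ?invr_gt0 // divr_gt0 //=; last by case/andP: ub.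
  by move: ub; clear; lra.
exists g', de, t1, t2; split => //; split.
- by move: de0 ti1 ti2 i0; clear; split; lra.
- move=> t t01; have -> : g' t = g' (n%:R * t / n%:R) by congr g'; field.
  rewrite gA; first by congr (_ *: _); rewrite /t1; field; rewrite nn !gt_eqF.
  have : n%:R * t <= n%:R * t1 by rewrite ler_pM2l //; case/andP: t01.
  have -> : n%:R * t1 = de / al by rewrite /t1; field; rewrite nn gt_eqF.
  have : 0 <= n%:R * t by rewrite mulr_ge0 ?ler0n //; case/andP: t01.
  move: ua; clear; lra.
- move=> t t01; have -> : g' t = g' (- (n%:R * (1 - t) / n%:R)).
    by rewrite -[RHS]gp; congr g'; field.
  rewrite gB.
    congr (_ *: _); rewrite /t2; have -> : 1 - (1 - de / be / n%:R) = de / be / n%:R by ring.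
    by field; rewrite nn !gt_eqF.
  have : n%:R * (1 - t) <= n%:R * (1 - t2) by rewrite ler_pM2l //; move: t01; clear; lra.
  have -> : n%:R * (1 - t2) = de / be by rewrite /t2; field; rewrite nn gt_eqF.
  have : 0 <= n%:R * (1 - t) by rewrite mulr_ge0 ?ler0n //; move: t01; clear; lra.
  move: ub; clear; lra.
move=> t tI; have [ti|it] := leP t i.
  have -> : g' t = g' (n%:R * t / n%:R) by congr g'; field.
  have nt2 : n%:R * t <= n%:R * i by rewrite ler_pM2l.
  have e2 : n%:R * i = 2^-1 by rewrite iE; field.
  have nt1 : n%:R * t1 <= n%:R * t by rewrite ler_pM2l //; case/andP: tI.
  have e1 : n%:R * t1 = de / al by rewrite /t1; field; rewrite nn gt_eqF.
  rewrite gA; last by move: nt2 e2 nt1 e1 ua; clear; lra.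
  rewrite !coE mulrN1 lerN2 -ler_pdivrMr //; move: nt1 e1; clear; lra.
have [ti|it'] := leP t (1 - i).
  by have := tmin t; rewrite in_itv /= ti (ltW it) => /(_ isT); move: dz; clear; lra.
have -> : g' t = g' (- (n%:R * (1 - t) / n%:R)).
  by rewrite -[RHS]gp; congr g'; field.
have nt2 : n%:R * (1 - t) <= n%:R * i by rewrite ler_pM2l //; move: it'; clear; lra.
have e2 : n%:R * i = 2^-1 by rewrite iE; field.
have nt1 : n%:R * (1 - t2) <= n%:R * (1 - t).
  by rewrite ler_pM2l //; move: tI; clear; lra.
have e1 : n%:R * (1 - t2) = de / be by rewrite /t2; field; rewrite nn gt_eqF.
rewrite gB; last by move: nt2 e2 nt1 e1 ub; clear; lra.
rewrite !coE mulrN1 lerN2 -ler_pdivrMr //; move: nt1 e1; clear; lra.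
Qed.

End Corner.

(** * Hanging curves *)

Section Hanging.
Context {R : realType}.
Notation V := (space3 R).
Implicit Types (g h : R -> V).

(** A third of a turn is spent on each of the left edge, the knotted part and the
    right edge. The knotted part lies below the base of the triangle, in a sector
    whose bounds differ by the factor 2: the sectors for [d] and [d / 2] are
    disjoint. By the last clause it tends to the base as [d] tends to 0. *)
Definition hanging (d : R) (k : R -> V) := [/\
  forall t, 0 <= t <= 3^-1 -> k t = vec3 (- t) 0 (- t),
  forall t, 2 / 3 <= t <= 1 -> k t = vec3 (1 - t) 0 (t - 1),
  forall t, 3^-1 < t < 2 / 3 -> `|xco (k t)| < 3^-1 /\
    3 / 4 * d * (1 - 3 * `|xco (k t)|) < - 3^-1 - zco (k t)
      < 3 / 2 * d * (1 - 3 * `|xco (k t)|) &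
  forall t, 3^-1 <= t <= 2 / 3 -> `|k t - vec3 (2 * t - 1) 0 (- 3^-1)| <= 2 * d].

(** A homothety shrinks the knot and its tent, a stretch lengthens the edges of the
    tent down to depth [c] and translates the knot, and a widening bends the
    edges: they run apart down to the base of the triangle, at depth 1/3, and
    back towards each other below it. At depth [c] the widening is trivial, so
    that the knot remains small. *)
Lemma squeeze_map (R0 de d : R) : 0 <= R0 -> 0 < de -> 0 < d <= 1 ->
  exists eta c F, [/\ 0 < eta <= d / 20, c = 3^-1 + d * (1 - 3 * eta), isotopy_end F,
    forall sg u, 0 <= u <= c -> F ((de * (u / c)) *: vec3 sg 0 (-1)) =
      vec3 (sg * (if u <= 3^-1 then u else (1 - (u - 3^-1) / d) / 3)) 0 (- u) &
    forall p, `|p| <= R0 -> zco p <= - de ->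
      [/\ `|xco (F p)| <= d / 20, `|yco (F p)| <= d / 20 &
        d * (1 - 3 * eta) <= - 3^-1 - zco (F p) <= d * (1 - 3 * eta) + d / 20]].
Proof.
move=> R00 de0 /andP[d0 d1].
have dn : d != 0 by rewrite gt_eqF.
(* the scale [ep] brings the radius [R0] of the knot below [d / 20] and the height
   [de] of the tent to [eta] *)
pose S := R0 + de + 1; have S0 : 0 < S by rewrite /S; lra.
pose ep := d / (20 * S); have ep0 : 0 < ep by rewrite divr_gt0 // mulr_gt0.
have epS : ep * S = d / 20 by rewrite /ep; field; exact: lt0r_neq0.
have epR : ep * R0 <= d / 20.
  by rewrite -epS ler_pM2l // /S; lra.
have [eta etaE] : exists eta, eta = ep * de by exists (ep * de).
have eta0 : 0 < eta by rewrite etaE mulr_gt0.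
have etad : eta <= d / 20.
  by rewrite etaE -epS ler_pM2l // /S; lra.
clear epS; clearbody ep; clear S0; clear S.
have etan : eta != 0 by rewrite gt_eqF.
have [dd ddE] : exists dd, dd = d * (1 - 3 * eta) by exists (d * (1 - 3 * eta)).
have dd0 : 0 < dd by rewrite ddE mulr_gt0 //; lra.
have dd1 : dd < d by rewrite ddE -[ltRHS]mulr1 ltr_pM2l //; lra.
have [c cE] : exists c, c = 3^-1 + dd by exists (3^-1 + dd).
have c0 : 0 < c by lra.
have [k kE] : exists k, k * eta = c by exists (c / eta); rewrite divfK.
have k1 : 1 <= k by rewrite -(ler_pM2r eta0) kE; lra.
have k0 : 0 < k by lra.
have kn : k != 0 by rewrite gt_eqF.
have cn : c != 0 by rewrite gt_eqF.
pose s (z : R) := Num.max 0 (Num.min dd (- z - 3^-1)).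
have s01 z : 0 <= s z <= dd.
  by rewrite /s le_max lexx /= ge_max ge_min lexx /= andbT ltW.
have cs : continuous s.
  apply: continuous_real_max; first exact: cst_continuous.
  apply: continuous_real_min; first exact: cst_continuous.
  apply: continuous_real_sub; last exact: cst_continuous.
  by apply: continuous_real_opp => z; exact: cvg_id.
(* the widening compensates the stretch above the base, where [s = 0], and is
   trivial at the bottom, where [s = dd] *)
pose w z := k * (1 - s z / d) / (1 + 3 * s z).
have s3 z : 0 < 1 + 3 * s z by have /andP[h _] := s01 z; rewrite ltr_wpDr // mulr_ge0.
have w0 z : 0 < w z.
  rewrite /w divr_gt0 // mulr_gt0 // subr_gt0 ltr_pdivrMr // mul1r.
  by have /andP[_ h] := s01 z; exact: le_lt_trans h dd1.
have cw : continuous w.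
  apply: continuous_real_mul; last first.
    apply: continuous_real_inv; first by move=> z; rewrite gt_eqF.
    apply: continuous_real_add; first exact: cst_continuous.
    by apply: continuous_real_mul => //; exact: cst_continuous.
  apply: continuous_real_mul; first exact: cst_continuous.
  apply: continuous_real_sub; first exact: cst_continuous.
  by apply: continuous_real_mul => //; exact: cst_continuous.
pose F (p : V) := let z := stretch k eta (ep * zco p) in
  vec3 (w z * (ep * xco p)) (w z * (ep * yco p)) z.
have eF : isotopy_end F.
  have := isotopy_end_comp (isotopy_end_comp (isotopy_end_homothety ep0)
    (isotopy_end_stretch eta k1)) (isotopy_end_widen w0 cw).
  by congr isotopy_end; apply/funext => p; apply: vec3P; rewrite /F /= !coE.
exists eta, c, F; split => //; [by apply/andP|by rewrite cE ddE| |].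
- move=> sg u /andP[u0 uc].
  have st : stretch k eta (- (u / k)) = - u.
    rewrite /stretch; have -> : k * - (u / k) = - u by field.
    apply/max_idPl; have : u / k <= eta by rewrite ler_pdivrMr // mulrC kE.
    have : u = k * (u / k) by rewrite mulrC divfK.
    move: (u / k) => q uq qe; rewrite uq.
    have : 0 <= (k - 1) * (eta - q) by rewrite mulr_ge0 // subr_ge0.
    by clear; nra.
  have su : s (- u) = Num.max 0 (u - 3^-1).
    by rewrite /s opprK; congr Num.max; apply/min_idPr; rewrite lerBlDr addrC -cE.
  have E : ep * (de * (u / c)) = u / k.
    by rewrite -kE etaE; field; rewrite kn !gt_eqF.
  have zE : ep * zco ((de * (u / c)) *: vec3 sg 0 (-1)) = - (u / k).
    by rewrite -E !coE; ring.
  have W : w (- u) * (u / k) = if u <= 3^-1 then u else (1 - (u - 3^-1) / d) / 3.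
    rewrite /w su; have [u3|u3] := leP u 3^-1.
      rewrite (_ : Num.max _ _ = 0); last by apply/max_idPl; rewrite subr_le0.
      by rewrite mul0r subr0 mulr0 addr0 divr1 mulr1 mulrC divfK.
    rewrite (_ : Num.max _ _ = u - 3^-1); last by apply/max_idPr; rewrite subr_ge0 ltW.
    have -> : 1 + 3 * (u - 3^-1) = 3 * u by field.
    by field; rewrite kn dn gt_eqF // (lt_trans _ u3) // invr_gt0.
  rewrite /F zE st; apply: vec3P; rewrite !coE //.
    by rewrite -W -E; ring.
  by rewrite !mulr0.
move=> p pR pz.
have zp : - R0 <= zco p.
  by have := le_trans (zco_norm p) pR; rewrite ler_norml => /andP[].
have epz : ep * zco p <= - eta by rewrite etaE -mulrN ler_pM2l.
have epz' : - (d / 20) <= ep * zco p.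
  have : ep * - R0 <= ep * zco p by rewrite ler_pM2l.
  by move: epR; clear; lra.
have st : stretch k eta (ep * zco p) = ep * zco p + eta - c.
  rewrite /stretch -kE (_ : Num.max _ _ = ep * zco p - (k - 1) * eta); first by ring.
  apply/max_idPr.
  have : 0 <= (k - 1) * (- eta - ep * zco p) by rewrite mulr_ge0 // subr_ge0.
  by clear; nra.
have sd : s (ep * zco p + eta - c) = dd.
  rewrite /s (_ : Num.min _ _ = dd); first by apply/max_idPr/ltW.
  by apply/min_idPl; move: cE epz; clear; lra.
have w1 : w (ep * zco p + eta - c) = 1.
  rewrite /w sd; have -> : 1 - dd / d = 3 * eta by rewrite ddE; field.
  have -> : k * (3 * eta) = 3 * c by rewrite -kE; ring.
  have -> : 1 + 3 * dd = 3 * c by rewrite cE; field.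
  by rewrite divff // mulf_neq0.
have nle r : `|r| <= `|p| -> `|ep * r| <= d / 20.
  move=> rp; rewrite normrM gtr0_norm //; apply: le_trans epR.
  by rewrite ler_pM2l // (le_trans rp).
rewrite /F st w1 !mul1r !co_vec3 -ddE; split.
- exact/nle/xco_norm.
- exact/nle/yco_norm.
- by apply/andP; move: cE epz epz' eta0; clear; split; lra.
Qed.

(** Unit speed down to the base of the triangle, then the speed [6 * d], for which
    the horizontal coordinate of the bent edge becomes linear in time. *)
Definition depth (d t : R) : R := Num.min t 3^-1 + d * Num.max 0 (6 * t - 2).

Lemma depth_low d t : t <= 3^-1 -> depth d t = t.
Proof.
move=> t3; rewrite /depth (min_idPl t3) (_ : Num.max _ _ = 0) ?mulr0 ?addr0 //.
by apply/max_idPl; lra.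
Qed.

Lemma depth_high d t : 3^-1 <= t -> depth d t = 3^-1 + d * (6 * t - 2).
Proof.
by move=> t3; rewrite /depth (min_idPr t3); congr (_ + _ * _); apply/max_idPr; lra.
Qed.

Lemma depth_lt d : 0 < d -> {homo depth d : x y / x < y}.
Proof.
move=> d0 x y xy; have [y3|/ltW y3] := leP y 3^-1.
  by rewrite !depth_low //; lra.
rewrite (depth_high _ y3); have [x3|/ltW x3] := leP x 3^-1; last first.
  by rewrite depth_high // ltrD2l ltr_pM2l //; lra.
rewrite depth_low //; move: x3; rewrite le_eqVlt => /orP[/eqP x3|x3].
  have : 0 < d * (6 * y - 2) by rewrite mulr_gt0; lra.
  lra.
have : 0 <= d * (6 * y - 2) by apply: mulr_ge0; lra.
lra.
Qed.

Lemma continuous_depth d : continuous (depth d).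
Proof.
apply: continuous_real_add.
  by apply: continuous_real_min => t; [exact: cvg_id|exact: cvg_cst].
apply: continuous_real_mul; first exact: cst_continuous.
apply: continuous_real_max; first exact: cst_continuous.
apply: continuous_real_sub; last exact: cst_continuous.
by apply: continuous_real_mul => t; [exact: cvg_cst|exact: cvg_id].
Qed.

(** The clock that runs down the left edge, through the knotted part during a
    time [eta], and up the right edge. *)
Lemma hanging_clock (d eta c t1 t2 : R) : 0 < d -> 0 < eta <= 20^-1 ->
  c = 3^-1 + d * (1 - 3 * eta) -> 0 < t1 -> t1 < t2 -> t2 < 1 ->
  exists2 H, circle_lift H & [/\
    forall t, 0 <= t <= (1 - eta) / 2 -> H t = t1 * (depth d t / c),
    forall t, 1 - (1 - eta) / 2 <= t <= 1 -> H t = 1 - (1 - t2) * (depth d (1 - t) / c) &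
    forall t, (1 - eta) / 2 <= t <= 1 - (1 - eta) / 2 -> t1 <= H t <= t2].
Proof.
move=> d0 /andP[eta0 eta1] cE t10 t12 t21.
have c0 : 0 < c by rewrite cE ltr_wpDr // mulr_ge0 ?(ltW d0) //; lra.
have cn : c != 0 by rewrite gt_eqF.
have etan : eta != 0 by rewrite gt_eqF.
have [ts tsE] : exists ts, ts = (1 - eta) / 2 by exists ((1 - eta) / 2).
rewrite -tsE; have ts3 : 3^-1 < ts by rewrite tsE; lra.
have ts2 : ts < 2^-1 by rewrite tsE; lra.
have ze := depth_lt d0; have zele := ltW_homo ze.
have zets : depth d ts = c by rewrite depth_high ?(ltW ts3) // tsE cE; field.
have ze0 : depth d 0 = 0 by rewrite depth_low.
have tse : 1 - ts - ts = eta by rewrite tsE; field.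
pose cl (t : R) := Num.max ts (Num.min t (1 - ts)).
pose M t := t1 * (depth d (Num.min t ts) / c) + (t2 - t1) * ((cl t - ts) / eta)
  + (1 - t2) * (1 - depth d (Num.min (1 - t) ts) / c).
have M_left t : t <= ts -> M t = t1 * (depth d t / c).
  move=> tts; rewrite /M (min_idPl tts) /cl.
  rewrite (_ : Num.min t (1 - ts) = t); last by apply/min_idPl; lra.
  rewrite (max_idPl tts) subrr mul0r mulr0 addr0.
  rewrite (_ : Num.min (1 - t) ts = ts); last by apply/min_idPr; lra.
  by rewrite zets divff // subrr mulr0 addr0.
have M_right t : 1 - ts <= t -> M t = 1 - (1 - t2) * (depth d (1 - t) / c).
  move=> tts; rewrite /M /cl (min_idPr tts).
  rewrite (_ : Num.min t ts = ts); last by apply/min_idPr; lra.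
  rewrite (_ : Num.max ts (1 - ts) = 1 - ts); last by apply/max_idPr; lra.
  rewrite (_ : Num.min (1 - t) ts = 1 - t); last by apply/min_idPl; lra.
  by rewrite zets divff // tse divff //; ring.
have M_mid t : ts <= t <= 1 - ts -> M t = t1 + (t2 - t1) * ((t - ts) / eta).
  move=> /andP[tts tts']; rewrite /M /cl (min_idPl tts') (max_idPr tts).
  rewrite (min_idPr tts) (_ : Num.min (1 - t) ts = ts); last by apply/min_idPr; lra.
  by rewrite zets divff //; ring.
have cid : continuous (fun t : R => t) by move=> t; exact: cvg_id.
have cc (x : R) : continuous (fun _ : R => x) by exact: cst_continuous.
have cM : continuous M.
  apply: continuous_real_add; first apply: continuous_real_add.
  - apply: continuous_real_mul => //; apply: continuous_real_mul => //.
    exact: (continuous_comp_fun (continuous_real_min cid (cc ts)) (@continuous_depth d)).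
  - apply: continuous_real_mul => //; apply: continuous_real_mul => //.
    apply: continuous_real_sub => //; apply: continuous_real_max => //.
    exact: continuous_real_min.
  - apply: continuous_real_mul => //; apply: continuous_real_sub => //.
    apply: continuous_real_mul => //.
    exact: (continuous_comp_fun (continuous_real_min (continuous_real_sub (cc 1) cid) (cc ts))
      (@continuous_depth d)).
have M0 : M 0 = 0 by rewrite M_left ?ze0 ?mul0r ?mulr0 //; move: ts3; clear; lra.
have M1 : M 1 = 1 by rewrite M_right ?subrr ?ze0 ?mul0r ?mulr0 ?subr0 //; move: ts3; clear; lra.
have Mi x y : x < y -> M x < M y.
  move=> xy; pose p := depth d (Num.min y ts) - depth d (Num.min x ts).
  pose q := cl y - cl x.
  pose r := depth d (Num.min (1 - x) ts) - depth d (Num.min (1 - y) ts).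
  have E : M y - M x = t1 / c * p + (t2 - t1) / eta * q + (1 - t2) / c * r.
    by rewrite /M /p /q /r; field; rewrite ?etan ?cn.
  have p0 : 0 <= p.
    by rewrite subr_ge0; apply: zele; rewrite le_min !ge_min lexx orbT andbT (ltW xy).
  have r0 : 0 <= r.
    rewrite subr_ge0; apply: zele; rewrite le_min !ge_min lexx orbT andbT.
    by apply/orP; left; move: xy; clear; lra.
  have q0 : 0 <= q.
    rewrite subr_ge0 /cl ge_max !le_max lexx /=; apply/orP; right.
    by rewrite le_min !ge_min lexx orbT andbT (ltW xy).
  have a0 : 0 < t1 / c by rewrite divr_gt0.
  have b0 : 0 < (t2 - t1) / eta by rewrite divr_gt0 // subr_gt0.
  have e0 : 0 < (1 - t2) / c by rewrite divr_gt0 // subr_gt0.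
  rewrite -subr_gt0 E.
  have ap : 0 <= t1 / c * p by rewrite mulr_ge0 // ltW.
  have bq : 0 <= (t2 - t1) / eta * q by rewrite mulr_ge0 // ltW.
  have er : 0 <= (1 - t2) / c * r by rewrite mulr_ge0 // ltW.
  have [xts|tsx] := ltP x ts.
    have : 0 < t1 / c * p.
      rewrite mulr_gt0 // subr_gt0; apply: ze.
      by rewrite (min_idPl (ltW xts)) lt_min xy.
    by move: bq er; clear; lra.
  have [xts'|tsx'] := ltP x (1 - ts).
    have : 0 < (t2 - t1) / eta * q.
      rewrite mulr_gt0 // subr_gt0 /cl.
      by rewrite (min_idPl (ltW xts')) (max_idPr tsx) lt_max lt_min xy xts' orbT.
    by move: ap er; clear; lra.
  have : 0 < (1 - t2) / c * r.
    rewrite mulr_gt0 // subr_gt0; apply: ze.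
    rewrite (_ : Num.min (1 - y) ts = 1 - y); last first.
      by apply/min_idPl; move: xy tsx'; clear; lra.
    by rewrite lt_min; apply/andP; move: xy tsx'; clear; split; lra.
  by move: ap bq; clear; lra.
have [|//|//||H LH HM] := @circle_lift_of_bijection R M.
- by move=> x y _ xy _; exact: Mi.
- move=> y y01; have [||t tI tE] := @IVT R M 0 1 y (@ler01 R).
  + exact: continuous_subspaceT.
  + by rewrite M0 M1 minElt maxElt ltr01.
  by exists t => //; move: tI; rewrite in_itv.
exists H => //; split.
- by move=> t /andP[t0 tts]; rewrite HM ?M_left // t0 /=; move: tts ts2; clear; lra.
- by move=> t /andP[tts tu]; rewrite HM ?M_right // tu andbT; move: tts ts2; clear; lra.
move=> t tI; rewrite HM; last by move: tI ts2 ts3; clear; lra.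
rewrite M_mid //; set u := (t - ts) / eta.
have u0 : 0 <= u by rewrite divr_ge0 // ?(ltW eta0) // subr_ge0; case/andP: tI.
have u1 : u <= 1 by rewrite ler_pdivrMr // mul1r; move: tI tse; clear; lra.
rewrite lerDl mulr_ge0 ?subr_ge0 ?(ltW t12) //=.
have : (t2 - t1) * u <= (t2 - t1) * 1 by rewrite ler_pM2l // subr_gt0.
by rewrite mulr1; clear; lra.
Qed.

(** The bent edges lie at the depth [d * (1 - 3 * x)] below the base, where [x] is
    the distance from the axis, well inside the sector; the shrunk knot fits into
    a box of size [d / 20] at the lowest point of the sector. *)
Lemma hanging_deformation g de t1 t2 d : simple_curve g -> tent_curve g de t1 t2 ->
  0 < d <= 1 -> exists2 k, deforms g k & hanging d k.
Proof.
move=> Sg [[de0 t10 t12 t21] gL gR gM] d01.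
have [cg gp _] := Sg.
have [R0 R00 gR0] : exists2 R0 : R, 0 <= R0 & forall t, 0 <= t <= 1 -> `|g t| <= R0.
  have cn : {within `[0, 1], continuous (fun t => `|g t|)}.
    by apply: continuous_subspaceT => t; apply: cvg_norm; exact: cg.
  have [t0 t0I tmax] := EVT_max (@ler01 R) cn.
  by exists `|g t0| => // t t01; apply: tmax; rewrite in_itv.
have [eta [c [F [etad cE eF Fedge Flow]]]] := squeeze_map R00 de0 d01.
move: etad d01 => /andP[eta0 etad] /andP[d0 d1].
have eta1 : 0 < eta <= 20^-1 by move: eta0 etad d1; clear; lra.
have [H LH [HL HR HM]] := hanging_clock d0 eta1 cE t10 t12 t21.
have [ts tsE] : exists ts, ts = (1 - eta) / 2 by exists ((1 - eta) / 2).
rewrite -tsE in HL HR HM.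
have ts3 : 3^-1 < ts < 2^-1 by rewrite tsE; move: eta1; clear; lra.
have [dd ddE] : exists dd, dd = d * (1 - 3 * eta) by exists (d * (1 - 3 * eta)).
rewrite -ddE in cE Flow.
have dd0 : 0 < dd by rewrite ddE mulr_gt0 //; move: eta1; clear; lra.
have ddl : d * (17 / 20) <= dd by rewrite ddE ler_pM2l //; move: eta1; clear; lra.
have ddu : dd <= d by rewrite ddE -[leRHS]mulr1 ler_pM2l //; move: eta1; clear; lra.
have c0 : 0 < c by rewrite cE; move: dd0; clear; lra.
have cn : c != 0 by rewrite gt_eqF.
have t1n : t1 != 0 by rewrite gt_eqF.
have t2n : 1 - t2 != 0 by rewrite gt_eqF // subr_gt0.
have dn : d != 0 by rewrite gt_eqF.
have zets : depth d ts = c by rewrite depth_high; [rewrite tsE cE ddE; field|by case/andP: ts3 => /ltW].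
have zec t : 0 <= t <= ts -> 0 <= depth d t <= c.
  have zele := ltW_homo (depth_lt d0); have ze0 : depth d 0 = 0 by rewrite depth_low.
  by move=> /andP[t0 tts]; rewrite -{1}ze0 -zets !zele.
have shapeE t : (if depth d t <= 3^-1 then depth d t else (1 - (depth d t - 3^-1) / d) / 3) =
    if t <= 3^-1 then t else 1 - 2 * t.
  have [t3|t3] := leP t 3^-1; first by rewrite depth_low // t3.
  rewrite depth_high ?(ltW t3) // leNgt ltrDl mulr_gt0 //=; last by move: t3; clear; lra.
  by field.
have depth_c t : 0 <= t <= ts -> 0 <= depth d t / c <= 1.
  by move=> /zec /andP[h1 h2]; rewrite divr_ge0 ?(ltW c0) //= ler_pdivrMr // mul1r.
pose kap := F \o g \o H.
have kap_left t : 0 <= t <= ts ->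
    kap t = vec3 (- (if t <= 3^-1 then t else 1 - 2 * t)) 0 (- depth d t).
  move=> tI; rewrite /kap /= HL // gL; last first.
    have /andP[h1 h2] := depth_c _ tI.
    by rewrite mulr_ge0 ?(ltW t10) //= ler_piMr // ltW.
  have -> : de * (t1 * (depth d t / c)) / t1 = de * (depth d t / c) by field; rewrite cn.
  by rewrite Fedge ?zec // shapeE mulN1r.
have kap_right t : 1 - ts <= t <= 1 -> kap t =
    vec3 (if 1 - t <= 3^-1 then 1 - t else 1 - 2 * (1 - t)) 0 (- depth d (1 - t)).
  move=> tI; have tI' : 0 <= 1 - t <= ts by move: tI; clear; lra.
  have /andP[h1 h2] := depth_c _ tI'.
  rewrite /kap /= HR // gR; last first.
    have : (1 - t2) * (depth d (1 - t) / c) <= (1 - t2) * 1.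
      by rewrite ler_pM2l // subr_gt0.
    have : 0 <= (1 - t2) * (depth d (1 - t) / c) by rewrite mulr_ge0 // subr_ge0 ltW.
    by clear; lra.
  have -> : de * (1 - (1 - (1 - t2) * (depth d (1 - t) / c))) / (1 - t2)
    = de * (depth d (1 - t) / c) by field; rewrite cn.
  by rewrite Fedge ?zec // shapeE mul1r.
have kap_mid t : ts <= t <= 1 - ts ->
    [/\ `|xco (kap t)| <= d / 20, `|yco (kap t)| <= d / 20 &
      dd <= - 3^-1 - zco (kap t) <= dd + d / 20].
  move=> tI; have /andP[h1 h2] := HM _ tI; rewrite /kap /=; apply: Flow.
    by apply: gR0; move: h1 h2 t10 t21; clear; lra.
  by apply: gM; rewrite h1.
have dk : deforms g kap by exists F, H; split.
clearbody kap; move: dk kap_left kap_right kap_mid.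
clear -d0 d1 eta0 etad tsE ts3 dd0 ddl ddu zec zets cE => dk kap_left kap_right kap_mid.
have pos t : 3^-1 < t -> 0 < d * (6 * t - 2).
  by move=> t3; rewrite mulr_gt0 // subr_gt0; move: t3; clear; lra.
have bnd t : 3^-1 <= t <= ts -> 0 <= d * (6 * t - 2) <= dd.
  move=> /andP[t3 tts]; have := zec t; rewrite depth_high // => h.
  have := h ltac:(move: t3 tts; clear; lra); move: cE; clear -t3 d0 => cE /andP[_ h'].
  by rewrite mulr_ge0 ?(ltW d0) //=; move: cE h' t3; clear; lra.
have sector t : 3^-1 < t < 2^-1 ->
    3 / 4 * d * (1 - 3 * (1 - 2 * t)) < d * (6 * t - 2) < 3 / 2 * d * (1 - 3 * (1 - 2 * t)).
  move=> /andP[t3 _]; have := pos t t3.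
  by clear; move=> h; apply/andP; split; lra.
exists kap => //; split.
- move=> t /andP[t0 t3]; rewrite kap_left; last by move: t0 t3 ts3; clear; lra.
  by rewrite t3 depth_low.
- move=> t /andP[t3 t1']; have t3' : 1 - t <= 3^-1 by move: t3; clear; lra.
  rewrite kap_right; last by move: t1' t3 ts3; clear; lra.
  by rewrite t3' depth_low ?opprB.
- move=> t /andP[t3 t3']; have [tts|tts] := leP t ts.
    have tI : 0 <= t <= ts by move: t3 tts; clear; lra.
    have t2' : t < 2^-1 by move: tts ts3; clear; lra.
    rewrite kap_left // leNgt t3 /= !co_vec3 depth_high ?(ltW t3) //.
    rewrite normrN gtr0_norm; last by move: t2'; clear; lra.
    have -> : - 3^-1 - - (3^-1 + d * (6 * t - 2)) = d * (6 * t - 2) by ring.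
    by split; [move: t3; clear; lra|apply: sector; rewrite t3].
  have [tts'|tts'] := leP (1 - ts) t.
    have tI : 1 - ts <= t <= 1 by move: t3' tts'; clear; lra.
    have u3 : 3^-1 < 1 - t by move: t3'; clear; lra.
    have u2 : 1 - t < 2^-1 by move: tts' ts3; clear; lra.
    rewrite kap_right // leNgt u3 /= !co_vec3 depth_high ?(ltW u3) //.
    rewrite gtr0_norm; last by move: u2; clear; lra.
    have -> : - 3^-1 - - (3^-1 + d * (6 * (1 - t) - 2)) = d * (6 * (1 - t) - 2) by ring.
    by split; [move: u3; clear; lra|apply: sector; rewrite u3].
  have [hx _ /andP[hz1 hz2]] := kap_mid t (introT andP (conj (ltW tts) (ltW tts'))).
  have := normr_ge0 (xco (kap t)); move: (`|xco _|) hx => x hx x0.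
  have dx : d * x <= d * 20^-1 by rewrite ler_pM2l //; move: hx d1; clear; lra.
  have dx0 : 0 <= d * x by rewrite mulr_ge0 // ltW.
  split; first by move: hx d1; clear; lra.
  by move: hz1 hz2 dx dx0 ddl ddu d0; clear; move=> *; apply/andP; split; lra.
have d20 : 0 <= 2 * d by rewrite mulr_ge0 // ltW.
move=> t /andP[t3 t3']; have [tts|tts] := leP t ts.
  have tI : 0 <= t <= ts by move: t3 tts; clear; lra.
  have /andP[h0 h1] := bnd t ltac:(by rewrite t3).
  have -> : kap t = vec3 (2 * t - 1) 0 (- (3^-1 + d * (6 * t - 2))).
    rewrite kap_left // depth_high //; congr vec3.
    by case: leP => t3''; move: t3 t3''; clear; lra.
  apply: vec3_norm_le; rewrite ?coE ?subrr ?normr0 // ler_norml.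
  by move: h0 h1 ddu d0; clear; lra.
have [tts'|tts'] := leP (1 - ts) t.
  have tI : 1 - ts <= t <= 1 by move: t3' tts'; clear; lra.
  have u3 : 3^-1 <= 1 - t by move: t3'; clear; lra.
  have /andP[h0 h1] := bnd (1 - t) ltac:(rewrite u3 /=; move: tts'; clear; lra).
  have -> : kap t = vec3 (2 * t - 1) 0 (- (3^-1 + d * (6 * (1 - t) - 2))).
    rewrite kap_right // depth_high //; congr vec3.
    by case: leP => t3''; move: u3 t3''; clear; lra.
  apply: vec3_norm_le; rewrite ?coE ?subrr ?normr0 // ler_norml.
  by move: h0 h1 ddu d0; clear; lra.
have [hx hy /andP[hz1 hz2]] := kap_mid t (introT andP (conj (ltW tts) (ltW tts'))).
have tl : - (d / 20) <= 2 * t - 1 <= d / 20.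
  by move: tts tts' tsE etad; clear; lra.
apply: vec3_norm_le; rewrite ?coE //.
- by move: hx tl d0; rewrite !ler_norml; clear; lra.
- by rewrite subr0; move: hy d0; clear; lra.
- by rewrite ler_norml; move: hz1 hz2 dd0 ddu d0; clear; lra.
Qed.

End Hanging.

(** * Extension from a convergent family of curves *)

Section Extension.
Context {R : realType}.
Notation V := (space3 R).

Definition dyadic (m : nat) : R := 2^-1 ^+ m.

Lemma dyadic_gt0 m : 0 < dyadic m. Proof. by rewrite exprn_gt0 // invr_gt0. Qed.

Lemma dyadic_le1 m : dyadic m <= 1.
Proof. by rewrite exprn_ile1 ?invr_ge0 //; lra. Qed.

Lemma dyadic_small (e : R) : 0 < e -> exists N, forall m, (N <= m)%N -> dyadic m < e.
Proof.
move=> e0; have := @cvg_geometric R 1 2^-1; rewrite ger0_norm; last by lra.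
move=> /(_ ltac:(lra)) /cvgrPdist_lt /(_ e e0) [N _ HN]; exists N => m Nm.
have := HN m Nm; by rewrite /= /geometric /= mul1r sub0r normrN ger0_norm // ltW // dyadic_gt0.
Qed.

(** [None] is the index of the limit. *)
Definition amp (o : option nat) : R := if o is Some m then dyadic m else 0.

Variant converging_family (E : option nat -> R -> V) : Prop :=
  ConvergingFamily (C : R) of
    0 < C &
    forall o, continuous (E o) &
    forall o t, 0 <= t <= 1 -> `|E o t - E None t| <= C * amp o.

(** By compactness a point close to [p] has its parameters close to parameters of
    [p], where [G] takes the value [L]. *)
Lemma curve_nearness (E G : R -> V) p L (e : R) : continuous E -> continuous G ->
  (forall t, 0 <= t <= 1 -> E t = p -> G t = L) -> 0 < e ->
  exists2 d, 0 < d & forall t, 0 <= t <= 1 -> `|E t - p| < d -> `|G t - L| < e.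
Proof.
move=> cE cG EG e0.
have /compact_near_coveringP /near_covering_withinP cov := @segment_compact R 0 1.
pose P (d t : R) := `|E t - p| < d -> `|G t - L| < e.
have : \forall d \near 0^'+, `[0, 1]%classic `<=` P d.
  apply: cov => t; rewrite /= in_itv /= => t01.
  have [Ep|Ep] := eqVneq (E t) p.
    have [d d0 H] := (continuous_at_dist G t).1 (cG t) e e0.
    near=> t' d'; rewrite /P /= => _ _; rewrite -(EG t) // distrC; apply: H.
    by rewrite distrC; near: t'; exact: near_dist.
  have r0 : 0 < `|E t - p| by rewrite normr_gt0 subr_eq0.
  have [d d0 H] := (continuous_at_dist E t).1 (cE t) (`|E t - p| / 2) ltac:(lra).
  near=> t' d'; rewrite /P /= => _ h.
  have h1 : `|E t - E t'| < `|E t - p| / 2.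
    by apply: H; rewrite distrC; near: t'; exact: near_dist.
  have /andP[_ h2] : 0 < d' <= `|E t - p| / 2 by near: d'; apply: near_pos_le; lra.
  have := ler_normD (E t - E t') (E t' - p); rewrite addrA subrK; lra.
move=> Pn; have : \forall d \near (0 : R)^'+, 0 < d /\ `[0, 1]%classic `<=` P d.
  near=> c; split; first by near: c; exact: nbhs_right_gt.
  by near: c.
move=> /filter_ex[d [d0 Pd]]; by exists d => // t t01 Et; apply: Pd.
Unshelve. all: end_near. Qed.

(** All but finitely many curves of the family are handled by the limit curve. *)
Lemma family_nearness E G p L (e : R) :
  converging_family E -> converging_family G ->
  (forall o t, 0 <= t <= 1 -> E o t = p -> G o t = L) -> 0 < e ->
  exists2 d, 0 < d & forall o t, 0 <= t <= 1 -> `|E o t - p| < d -> `|G o t - L| < e.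
Proof.
move=> [C C0 cE EC] [C' C'0 cG GC] EG e0.
have nr o e' : 0 < e' -> exists2 d, 0 < d &
    forall t, 0 <= t <= 1 -> `|E o t - p| < d -> `|G o t - L| < e'.
  by move=> e'0; apply: curve_nearness => //; exact: EG.
have [d0 d00 H0] := nr None (e / 2) ltac:(lra).
have [N1 HN1] := dyadic_small (divr_gt0 d00 (mulr_gt0 (ltr0n R 2) C0)).
have [N2 HN2] := dyadic_small (divr_gt0 e0 (mulr_gt0 (ltr0n R 2) C'0)).
pose N := maxn N1 N2.
have fin (M : nat) : exists2 d, 0 < d & forall m, (m < M)%N -> forall t, 0 <= t <= 1 ->
    `|E (Some m) t - p| < d -> `|G (Some m) t - L| < e.
  elim: M => [|M [d dp H]]; first by exists 1.
  have [d' dp' H'] := nr (Some M) e e0.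
  exists (Num.min d d'); first by rewrite lt_min dp.
  move=> m; rewrite ltnS leq_eqVlt => /orP[/eqP -> t t01|mM t t01];
    rewrite lt_min => /andP[h1 h2]; first exact: H'.
  exact: H.
have [d1 d10 H1] := fin N.
exists (Num.min (d0 / 2) d1); first by rewrite lt_min d10 divr_gt0.
move=> o t t01; rewrite lt_min => /andP[h h'].
case: o h h' => [m|] h h'; last by have := H0 t t01 ltac:(lra); lra.
have [mN|Nm] := ltnP m N; first exact: H1 mN t t01 h'.
have m1 : (N1 <= m)%N by apply: leq_trans Nm; exact: leq_maxl.
have m2 : (N2 <= m)%N by apply: leq_trans Nm; exact: leq_maxr.
have := HN1 m m1; have := HN2 m m2; rewrite !ltr_pdivlMr ?mulr_gt0 // => e2 e1.
have := EC (Some m) t t01; have := GC (Some m) t t01; rewrite /amp => g1 g2.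
have n1 : `|E None t - p| < d0.
  have := ler_normD (E None t - E (Some m) t) (E (Some m) t - p).
  rewrite addrA subrK [`|E None t - E _ _|]distrC; nra.
have n2 := H0 t t01 n1.
have := ler_normD (G (Some m) t - G None t) (G None t - L).
rewrite addrA subrK; nra.
Qed.

(** The traces of a family with a limit form a closed set, on which a
    compatible assignment is continuous, and Tietze's theorem applies. *)
Lemma extend_family E G : converging_family E -> converging_family G ->
  (forall o o' t t', 0 <= t <= 1 -> 0 <= t' <= 1 -> E o t = E o' t' ->
     G o t = G o' t') ->
  exists2 f : V -> V, continuous f & forall o t, 0 <= t <= 1 -> f (E o t) = G o t.
Proof.
move=> fE fG EG.
pose Z := [set p | exists o t, 0 <= t <= 1 /\ E o t = p].
have exF p : exists L, forall o t, 0 <= t <= 1 -> E o t = p -> G o t = L.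
  have [[i [t [t01 <-]]]|nZ] := pselect (Z p).
    by exists (G i t) => o' t' t01' /EG; apply.
  by exists 0 => o t t01 Ep; exfalso; apply: nZ; exists o, t.
pose F p := projT1 (cid (exF p)).
have FE o t : 0 <= t <= 1 -> F (E o t) = G o t.
  by move=> t01; rewrite /F; case: cid => L /= H; rewrite -(H o t).
have near_p p (e : R) : 0 < e ->
    exists2 d, 0 < d & forall q, Z q -> `|q - p| < d -> `|F q - F p| < e.
  move=> e0; have Fp o t : 0 <= t <= 1 -> E o t = p -> G o t = F p.
    by move=> t01 <-; rewrite FE.
  have [d d0 H] := family_nearness fE fG Fp e0.
  exists d => // q [i [t [t01 <-]]]; rewrite FE //; exact: H.
(* off [Z] the previous estimate holds vacuously for every limit [L]; two distant
   choices of [L] exclude points of [Z] nearby *)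
have clZ : closed Z.
  rewrite -[Z]setCK; apply: open_closedC; rewrite openE => p nZ.
  have np L o t : 0 <= t <= 1 -> E o t = p -> G o t = L.
    by move=> t01 Ep; exfalso; apply: nZ; exists o, t.
  have [d1 d10 H1] := family_nearness fE fG (np (vec3 0 0 0)) ltr01.
  have [d2 d20 H2] := family_nearness fE fG (np (vec3 3 0 0)) ltr01.
  apply/nbhs_ballP; exists (Num.min d1 d2); first by rewrite /= lt_min d10.
  move=> q; rewrite -ball_normE /= /ball_ /= distrC lt_min => /andP[q1 q2] [i [t [t01 tq]]].
  rewrite -tq in q1 q2; have := H1 _ _ t01 q1; have := H2 _ _ t01 q2.
  have := xco_norm (G i t - vec3 3 0 0); have := xco_norm (G i t - vec3 0 0 0).
  by rewrite !coE !ler_norml; lra.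
have cF j : {within Z, continuous (fun p => F p 0 j)}.
  apply/subspace_continuousP => p Zp; apply/cvgrPdist_lt => e e0.
  have [d d0 H] := near_p p e e0.
  rewrite near_withinE; apply/nbhs_ballP; exists d => // q.
  rewrite -ball_normE /= /ball_ /= distrC => qp Zq.
  rewrite distrC; apply: le_lt_trans (H q Zq qp).
  by apply: le_trans (coord_norm_le _ j); rewrite !mxE.
have [M M0 FM] : exists2 M : R, 0 < M & forall p, Z p -> `|F p| <= M.
  case: fG FE => C' C'0 cG GC FE.
  have cn : {within `[0, 1], continuous (fun t => `|G None t|)}.
    by apply: continuous_subspaceT => t; apply: cvg_norm; exact: cG.
  have [t0 t0I tmax] := EVT_max (@ler01 R) cn.
  exists (`|G None t0| + C'); first by rewrite ltr_wpDl.
  move=> p [i [t [t01 <-]]]; rewrite FE //.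
  have h1 := tmax t; rewrite in_itv /= in h1; have {}h1 := h1 t01.
  have h2 := GC i t t01; have h3 := ler_normD (G i t - G None t) (G None t).
  rewrite subrK in h3.
  have : C' * amp i <= C' by rewrite ler_piMr ?(ltW C'0) //; case: (i) => //= m; exact: dyadic_le1.
  lra.
have ext j : exists f : V -> R, continuous f /\ forall p, Z p -> f p = F p 0 j.
  have [f [fE' cf _]] := @continuous_bounded_extension V R (@pseudometric_normal R V)
    Z clZ (fun p => F p 0 j) M M0 (cF j)
    (fun p Zp => le_trans (coord_norm_le _ _) (FM p Zp)).
  by exists f; split => // p Zp; rewrite fE' // inE.
pose f j := projT1 (cid (ext j)).
have cf j : continuous (f j) by rewrite /f; case: cid => ? cf /=; exact: cf.1.
have fF j p : Z p -> f j p = F p 0 j by rewrite /f; case: cid => ? cf' /=; exact: cf'.2.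
exists (fun p => \row_j f j p).
  apply: continuous_row => j; rewrite [X in continuous X](_ : _ = f j) //.
  by apply/funext => p; rewrite mxE.
move=> o t t01; apply/rowP => j; rewrite mxE fF; last by exists o, t.
by rewrite FE.
Qed.

End Extension.

(** * Wiggles *)

Section Codes.
Context {R : realType}.
Notation V := (space3 R).
Implicit Types (psi phi : nat -> nat) (u : R).

Lemma level_exists u : exists j, (u <= 0) || (dyadic j / 6 < u).
Proof.
have [u0|u0] := leP u 0; first by exists 0%N.
have [N HN] := @dyadic_small R u u0; exists N; rewrite orFb.
by have := HN N (leqnn N); have := @dyadic_gt0 R N; lra.
Qed.

(** A depth [0 < u <= 1 / 3] lies in one window, above [dyadic j / 6] and at most
    [dyadic j / 3], where [j = level u]. *)
Definition level u : nat := ex_minn (level_exists u).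

Lemma level_gt u : 0 < u -> dyadic (level u) / 6 < u.
Proof.
rewrite /level; case: ex_minnP => j /orP[u0|//] _.
by rewrite ltNge u0.
Qed.

Lemma level_le u j : dyadic j / 6 < u -> (level u <= j)%N.
Proof. by move=> h; rewrite /level; case: ex_minnP => k _; apply; rewrite h orbT. Qed.

Lemma dyadicS j : dyadic j.+1 = dyadic j / 2 :> R.
Proof. by rewrite /dyadic exprSr. Qed.

Lemma dyadic0 : dyadic 0 = 1 :> R. Proof. by rewrite /dyadic expr0. Qed.

Lemma level_top u : 0 < u -> (0 < level u)%N -> u <= dyadic (level u) / 3.
Proof.
move=> u0; case E : (level u) => [//|j] _; rewrite leNgt; apply/negP => h.
have : (level u <= j)%N by apply: level_le; rewrite dyadicS in h; lra.
by rewrite E ltnn.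
Qed.

Lemma level_window u j : dyadic j / 6 < u <= dyadic j / 3 -> level u = j.
Proof.
move=> /andP[h1 h2]; have u0 : 0 < u by have := @dyadic_gt0 R j; lra.
apply/eqP; rewrite eqn_leq (level_le h1) /= leqNgt; apply/negP => lj.
have := level_gt u0; suff : dyadic j <= dyadic (level u) / 2 :> R by lra.
rewrite -dyadicS /dyadic ler_wiXn2l //; lra.
Qed.

(** A tent over each window. Its slope [2^-1] makes the displacement of the edge a
    contraction. *)
Definition tooth u : R :=
  2^-1 * Num.max 0 (Num.min (u - dyadic (level u) / 6) (dyadic (level u) / 3 - u)).

Definition wiggle psi u : R := dyadic (psi (level u)) * tooth u.

Lemma tooth_ge0 u : 0 <= tooth u.
Proof. by rewrite mulr_ge0 // le_max lexx. Qed.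

Lemma wiggle_ge0 psi u : 0 <= wiggle psi u.
Proof. by rewrite mulr_ge0 // ?tooth_ge0 // ltW // dyadic_gt0. Qed.

Lemma wiggle_le_tooth psi u : wiggle psi u <= tooth u.
Proof. by rewrite ler_piMl ?tooth_ge0 // dyadic_le1. Qed.

Lemma tooth_high u : 3^-1 <= u -> tooth u = 0.
Proof.
move=> u3; have l0 : level u = 0%N.
  by apply/eqP; rewrite -leqn0; apply: level_le; rewrite dyadic0; lra.
rewrite /tooth l0 dyadic0 (_ : Num.max _ _ = 0) ?mulr0 //.
by apply/max_idPl; rewrite ge_min; apply/orP; right; lra.
Qed.

Lemma tooth_low u : u <= 0 -> tooth u = 0.
Proof.
move=> u0; rewrite /tooth (_ : Num.max _ _ = 0) ?mulr0 //.
apply/max_idPl; rewrite ge_min; apply/orP; left.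
by have := @dyadic_gt0 R (level u); lra.
Qed.

Lemma tooth_le u : 0 <= u -> tooth u <= u / 2.
Proof.
move=> u0; rewrite /tooth mulrC ler_pM2r ?invr_gt0 // ge_max u0 /= ge_min.
by apply/orP; left; have := @dyadic_gt0 R (level u); lra.
Qed.

Lemma tooth_le_above u w : 0 < u -> dyadic (level u) / 3 <= w -> u <= w ->
  tooth u <= (w - u) / 2.
Proof.
move=> u0 h uw; rewrite /tooth mulrC ler_pM2r ?invr_gt0 // ge_max subr_ge0 uw /= ge_min.
by apply/orP; right; lra.
Qed.

Lemma tooth_le_below u w : w <= dyadic (level u) / 6 -> w <= u -> tooth u <= (u - w) / 2.
Proof.
move=> h uw; rewrite /tooth mulrC ler_pM2r ?invr_gt0 // ge_max subr_ge0 uw /= ge_min.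
by apply/orP; left; lra.
Qed.

(** Within a window the wiggle is a multiple of a tent; between depths in
    different windows there is a zero of both tents. *)
Lemma lip_wiggle psi : lip 2^-1 (wiggle psi).
Proof.
move=> x y; wlog xy : x y / x <= y.
  move=> W; have [xy|/ltW yx] := leP x y; first exact: W.
  by rewrite distrC [`|x - y|]distrC; exact: W.
rewrite [`|x - y|]ler0_norm; last by lra.
have wx := wiggle_ge0 psi x; have wy := wiggle_ge0 psi y.
have wbx := wiggle_le_tooth psi x; have wby := wiggle_le_tooth psi y.
have [x0|x0] := leP x 0.
  have bx := tooth_low x0; have [y0|y0] := leP y 0.
    by have := tooth_low y0; rewrite ler_norml; lra.
  by have := tooth_le (ltW y0); rewrite ler_norml; lra.
have y0 : 0 < y by lra.
have [lxy|lxy] := eqVneq (level x) (level y).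
  have := dyadic_le1 (psi (level x)) : dyadic _ <= 1 :> R.
  have := @dyadic_gt0 R (psi (level x)); rewrite /wiggle /tooth -lxy => h0 h1.
  rewrite -mulrBr -mulrBr normrM normrM.
  rewrite (gtr0_norm h0) (ger0_norm (_ : 0 <= 2^-1)) //.
  set a := dyadic (level x).
  have T : `|Num.max 0 (Num.min (x - a / 6) (a / 3 - x)) -
            Num.max 0 (Num.min (y - a / 6) (a / 3 - y))| <= y - x.
    rewrite ler_norml !maxEle !minEle; clear -xy.
    by repeat case: ifPn; rewrite -?ltNge => *; lra.
  have n0 := normr_ge0 (Num.max 0 (Num.min (x - a / 6) (a / 3 - x)) -
            Num.max 0 (Num.min (y - a / 6) (a / 3 - y))).
  nra.
have lyx : (level y < level x)%N.
  rewrite ltn_neqAle eq_sym lxy /=; apply: level_le.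
  by apply: lt_le_trans xy; exact: level_gt.
have hx : dyadic (level x) / 3 <= dyadic (level y) / 6 :> R.
  have : dyadic (level x) <= dyadic (level y).+1 :> R.
    by rewrite /dyadic ler_wiXn2l //; lra.
  by rewrite dyadicS; lra.
have xt := level_top x0 (leq_ltn_trans (leq0n _) lyx).
have yg := level_gt y0.
have b1 := tooth_le_above x0 (le_trans hx (ltW yg)) xy.
have b2 := tooth_le_below (le_trans xt hx) xy.
by rewrite ler_norml; lra.
Qed.

End Codes.

(** * Curves that carry a code *)

Section Coded.
Context {R : realType}.
Notation V := (space3 R).
Implicit Types (psi phi : nat -> nat) (u : R) (o : option nat).

(** At depth [u] on the right edge the first coordinate is [u], and
    [tooth u <= u / 2] makes the minimum equal to the wiggle. On the left edge the
    first coordinate is negative and the minimum vanishes. *)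
Definition wiggle_shift psi (p : V) : V :=
  vec3 (Num.min (wiggle psi (- zco p)) (Num.max 0 (xco p) / 2)) 0 0.

Lemma lip_real_min (f g : V -> R) L : lip L f -> lip L g ->
  lip L (fun p => Num.min (f p) (g p)).
Proof.
move=> fL gL x y; have := fL x y; have := gL x y; rewrite !ler_norml !minElt.
by case: ltP => ?; case: ltP => ?; lra.
Qed.

Lemma isotopy_end_wiggle psi : isotopy_end (fun p => p + wiggle_shift psi p).
Proof.
apply: (@isotopy_end_lip _ _ 2^-1); first by apply/andP; split; lra.
have l1 : @lip R V R 2^-1 (fun p => Num.min (wiggle psi (- zco p)) (Num.max 0 (xco p) / 2)).
  apply: lip_real_min => x y.
    apply: le_trans (lip_wiggle _ _ _) _; rewrite ler_wpM2l ?invr_ge0 //.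
    have -> : - zco x - - zco y = - zco (x - y) by rewrite !coE; ring.
    by rewrite normrN; exact: zco_norm.
  rewrite -mulrBl normrM mulrC [`|2^-1|]ger0_norm ?invr_ge0 // ler_wpM2l ?invr_ge0 //.
  apply: le_trans (xco_norm _); rewrite !coE !maxElt.
  by rewrite ler_norml; case: ltP => ?; case: ltP => ?;
    have := ler_norm (xco x - xco y); have := ler_norm (- (xco x - xco y));
    rewrite normrN; lra.
move=> x y; apply: vec3_norm_le; rewrite ?coE /wiggle_shift ?coE.
- by rewrite mulr_ge0 ?invr_ge0.
- exact: l1.
- by rewrite subrr normr0 mulr_ge0 ?invr_ge0.
- by rewrite subrr normr0 mulr_ge0 ?invr_ge0.
Qed.

Context (kap : nat -> R -> V).
Context (kapH : forall m, hanging (dyadic m) (kap m)).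
Context (kapS : forall m, simple_curve (kap m)).

(** Entry 0 of the code selects the knotted part, entry [j + 1] the height of the
    wiggle in window [j]. *)
Definition coded phi t : V :=
  kap (phi 0%N) t + wiggle_shift (phi \o succn) (kap (phi 0%N) t).

Lemma coded_isotopic phi : isotopic_curves (kap (phi 0%N)) (coded phi).
Proof. by exists (fun p => p + wiggle_shift (phi \o succn) p) => //; exact: isotopy_end_wiggle. Qed.

Lemma coded_simple phi : simple_curve (coded phi).
Proof. exact: isotopic_curves_simple (coded_isotopic phi) _. Qed.

Lemma wiggle_high psi u : 3^-1 <= u -> wiggle psi u = 0.
Proof. by move=> /tooth_high u0; rewrite /wiggle u0 mulr0. Qed.

Lemma coded_left phi t : 0 <= t <= 3^-1 -> coded phi t = vec3 (- t) 0 (- t).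
Proof.
move=> t01; rewrite /coded; have [kl _ _ _] := kapH (phi 0%N); rewrite kl //.
rewrite /wiggle_shift !coE (_ : Num.max 0 (- t) = 0); last by apply/max_idPl; lra.
rewrite mul0r (_ : Num.min _ 0 = 0); last by apply/min_idPr; exact: wiggle_ge0.
by apply: vec3P; rewrite !coE addr0.
Qed.

Lemma hanging_middle_z m t : 3^-1 <= t <= 2 / 3 -> zco (kap m t) <= - 3^-1.
Proof.
move=> tI; have [kl kr km _] := kapH m.
have [t3|t3] := leP t 3^-1.
  by rewrite kl ?coE; lra.
have [t3'|t3'] := leP (2 / 3) t.
  by rewrite kr ?coE; lra.
have [|x3 /andP[s0 _]] := km t; first by lra.
have : 0 <= 3 / 4 * dyadic m * (1 - 3 * `|xco (kap m t)|); last by lra.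
by apply: mulr_ge0; [rewrite mulr_ge0 ?(ltW (dyadic_gt0 m))|]; lra.
Qed.

Lemma coded_middle phi t : 3^-1 <= t <= 2 / 3 -> coded phi t = kap (phi 0%N) t.
Proof.
move=> /(hanging_middle_z (phi 0%N)) z3; rewrite /coded /wiggle_shift wiggle_high; last by lra.
rewrite (_ : Num.min 0 _ = 0); last first.
  by apply/min_idPl; rewrite divr_ge0 // le_max lexx.
by apply: vec3P; rewrite !coE addr0.
Qed.

Lemma coded_right phi t : 2 / 3 <= t <= 1 ->
  coded phi t = vec3 (1 - t + wiggle (phi \o succn) (1 - t)) 0 (t - 1).
Proof.
move=> t01; rewrite /coded; have [_ kr _ _] := kapH (phi 0%N); rewrite kr //.
rewrite /wiggle_shift !coE opprB (_ : Num.max 0 (1 - t) = 1 - t); last first.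
  by apply/max_idPr; lra.
rewrite (_ : Num.min _ _ = wiggle (phi \o succn) (1 - t)); last first.
  apply/min_idPl; apply: le_trans (wiggle_le_tooth _ _) _.
  by apply: tooth_le; lra.
by apply: vec3P; rewrite !coE ?addr0.
Qed.

(** The limit is an unknotted triangle without wiggles. *)
Definition triangle (t : R) : V :=
  vec3 (Num.max (- t) (Num.min (2 * t - 1) (1 - t))) 0
    (- Num.min t (Num.min 3^-1 (1 - t))).

(** Constant codes suffice, as every point of a coded curve lies on one of these
    curves at the same parameter. *)
Definition model o : R -> V := if o is Some m then coded (fun=> m) else triangle.

Lemma model_left o t : 0 <= t <= 3^-1 -> model o t = vec3 (- t) 0 (- t).
Proof.
case: o => [m|] tI; first exact: coded_left.
rewrite /= /triangle; congr vec3.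
  by apply/max_idPl; rewrite ge_min; apply/orP; left; lra.
congr (- _); apply/min_idPl; rewrite le_min; lra.
Qed.

Lemma model_right o t : 2 / 3 <= t <= 1 ->
  model o t = vec3 (1 - t + amp o * tooth (1 - t)) 0 (t - 1).
Proof.
case: o => [m|] tI; first by rewrite /= coded_right.
rewrite /= /triangle mul0r addr0; congr vec3.
  rewrite (_ : Num.min _ _ = 1 - t); last by apply/min_idPr; lra.
  by apply/max_idPr; lra.
rewrite [Num.min 3^-1 _](_ : _ = 1 - t); last by apply/min_idPr; lra.
by rewrite (_ : Num.min _ _ = 1 - t) ?opprB //; apply/min_idPr; lra.
Qed.

Lemma model_middle_some m t : 3^-1 <= t <= 2 / 3 -> model (Some m) t = kap m t.
Proof. exact: coded_middle. Qed.

Lemma model_middle_none t : 3^-1 <= t <= 2 / 3 ->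
  model None t = vec3 (2 * t - 1) 0 (- 3^-1).
Proof.
move=> tI; rewrite /= /triangle; congr vec3.
  rewrite (_ : Num.min _ _ = 2 * t - 1); last by apply/min_idPl; lra.
  by apply/max_idPr; lra.
congr (- _); rewrite [Num.min 3^-1 _](_ : _ = 3^-1); last by apply/min_idPl; lra.
by apply/min_idPr; lra.
Qed.

Lemma converging_family_model : converging_family model.
Proof.
apply: (@ConvergingFamily _ _ 2) => //.
  case=> [m|]; first by have [] := coded_simple (fun=> m).
  have cid : continuous (fun t : R => t) by move=> t; exact: cvg_id.
  have cc (x : R) : continuous (fun _ : R => x) by exact: cst_continuous.
  apply: continuous_vec3 => //.
    apply: continuous_real_max; first exact: continuous_real_opp.
    apply: continuous_real_min; last exact: continuous_real_sub.
    by apply: continuous_real_sub => //; exact: continuous_real_mul.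
  apply: continuous_real_opp; apply: continuous_real_min => //.
  by apply: continuous_real_min => //; exact: continuous_real_sub.
case=> [m|] t t01; last by rewrite subrr normr0 mulr0.
have h0 := @dyadic_gt0 R m; rewrite [amp _]/=.
have [t3|t3] := leP t 3^-1.
  by rewrite !model_left ?subrr ?normr0; lra.
have [t3'|t3'] := leP t (2 / 3).
  rewrite model_middle_some; last by lra.
  rewrite model_middle_none; last by lra.
  by have [_ _ _] := kapH m; apply; lra.
rewrite !model_right; try lra.
rewrite /= mul0r addr0.
have b1 := tooth_ge0 (1 - t); have b2 := @tooth_le R (1 - t) ltac:(lra).
apply: vec3_norm_le; rewrite ?coE; first by lra.
- by rewrite ger0_norm; nra.
- by rewrite subrr normr0; lra.
- by rewrite subrr normr0; lra.
Qed.

(** Doubles the distance from the apex along the right edge and compresses the left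
    edge and the middle third into the left edge. *)
Definition zoom (t : R) : R := Num.max (t / 2) (2 * t - 1).

Lemma zoom_low t : t <= 2 / 3 -> zoom t = t / 2.
Proof. by move=> t3; apply/max_idPl; lra. Qed.

Lemma zoom_high t : 2 / 3 <= t -> zoom t = 2 * t - 1.
Proof. by move=> t3; apply/max_idPr; lra. Qed.

Lemma zoom_itv t : 0 <= t <= 1 -> 0 <= zoom t <= 1.
Proof. by move=> t01; rewrite /zoom le_max ge_max; lra. Qed.

(** An end of a window goes to an end of a window or to the lower end of the left
    edge, and the apex is fixed; these points are common to all indices. *)
Lemma model_zoom_tooth0 o o' t : 2 / 3 <= t <= 1 -> tooth (1 - t) = 0 ->
  model o (zoom t) = model o' (zoom t).
Proof.
move=> tI b0; have [t1|t1] := eqVneq t 1.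
  rewrite t1 zoom_high; last by lra.
  have e0 : 1 - (2 * 1 - 1) = 0 :> R by ring.
  have I1 : 2 / 3 <= (2 * 1 - 1 : R) <= 1 by lra.
  by rewrite (model_right o I1) (model_right o' I1) e0 tooth_low // !mulr0.
pose u := 1 - t; have u0 : 0 < u by move: t1; rewrite /u neq_lt; lra.
have gt := level_gt u0.
(* a zero of the tooth is the upper end of its window *)
have uE : dyadic (level u) / 3 <= u.
  rewrite leNgt; apply/negP => lu; move: b0; rewrite -/u /tooth.
  rewrite (_ : Num.max _ _ = Num.min (u - dyadic (level u) / 6) (dyadic (level u) / 3 - u)).
    by move=> /eqP; rewrite mulf_eq0 => /orP[|] /eqP; [lra|rewrite minElt; case: ltP; lra].
  by apply/max_idPr; rewrite le_min; lra.
rewrite zoom_high; last by case/andP: tI.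
have [l0|l0] := posnP (level u).
  have u3 : u = 3^-1 by rewrite l0 dyadic0 in uE; rewrite /u in uE *; lra.
  by rewrite !model_left //; rewrite /u in u3; lra.
have uT := level_top u0 l0.
have uE' : u = dyadic (level u) / 3 by lra.
case E : (level u) l0 uE' => [//|j] _; rewrite dyadicS => uE'.
have lj : level (2 * u) = j by apply: level_window; have := @dyadic_gt0 R j; lra.
have j1 := @dyadic_le1 R j.
have b2 : tooth (2 * u) = 0.
  rewrite /tooth lj (_ : Num.max _ _ = 0) ?mulr0 //.
  by apply/max_idPl; rewrite ge_min; apply/orP; right; lra.
have tE : 1 - (2 * t - 1) = 2 * u by rewrite /u; ring.
by rewrite !model_right ?tE ?b2 ?mulr0 //; rewrite /u in uE'; lra.
Qed.

Lemma hanging_middle_pos m t : 3^-1 < t < 2 / 3 -> zco (kap m t) < - 3^-1.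
Proof.
move=> tI; have [_ _ km _] := kapH m; have [x3 /andP[s0 _]] := km t tI.
have : 0 < 3 / 4 * dyadic m * (1 - 3 * `|xco (kap m t)|); last by lra.
by apply: mulr_gt0; [rewrite mulr_gt0 ?dyadic_gt0|]; lra.
Qed.

(** The middle arcs lie in disjoint sectors. *)
Lemma hanging_middle_inj m m' t t' : 3^-1 < t < 2 / 3 -> 3^-1 < t' < 2 / 3 ->
  kap m t = kap m' t' -> m = m' /\ t = t'.
Proof.
move=> tI tI' E.
have mm : m = m'.
  have [_ _ km _] := kapH m; have [x3 /andP[s1 s2]] := km t tI.
  have [_ _ km' _] := kapH m'; have [_ /andP[s1' s2']] := km' t' tI'.
  rewrite -E in s1' s2'; set s := - 3^-1 - _ in s1 s2 s1' s2'.
  set y := 1 - 3 * _ in s1 s2 s1' s2'; have y0 : 0 < y by rewrite /y; lra.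
  have H a b : 3 / 4 * dyadic a * y < s -> s < 3 / 2 * dyadic b * y -> (a < b)%N -> False.
    move=> h1 h2 ab; have : dyadic b <= dyadic a.+1 :> R.
      by rewrite /dyadic ler_wiXn2l //; lra.
    rewrite dyadicS => dab.
    have : dyadic b * y <= dyadic a / 2 * y by rewrite ler_pM2r.
    lra.
  by have [/(H _ _ s1 s2')|/(H _ _ s1' s2)|] := ltngtP m m'.
split=> //; rewrite -mm in E.
by have := simple_curve_lt1 (kapS m) E; rewrite ltr_norml => ->; lra.
Qed.

Lemma amp_inj : injective (@amp R).
Proof.
have d0 m := @dyadic_gt0 R m.
have dlt a b : (a < b)%N -> dyadic b < dyadic a :> R.
  move=> ab; have : dyadic b <= dyadic a.+1 :> R by rewrite /dyadic ler_wiXn2l //; lra.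
  by rewrite dyadicS; have := d0 a; lra.
move=> [a|] [b|] //= ab.
- by have [/dlt|/dlt|->//] := ltngtP a b; rewrite ab ltxx.
- by have := d0 a; rewrite ab ltxx.
- by have := d0 b; rewrite -ab ltxx.
Qed.

(** The shift is well defined on points. In the middle the sector reveals the
    index, and on the right edge the height of the wiggle does, except at its
    zeros. There, and on the left edge, the image is the same for all indices. *)
Lemma model_zoom o o' t t' : 0 <= t <= 1 -> 0 <= t' <= 1 ->
  model o t = model o' t' -> model o (zoom t) = model o' (zoom t').
Proof.
wlog tt' : o o' t t' / t <= t'.
  move=> W tI tI' E; have [h|/ltW h] := leP t t'; first exact: W.
  by symmetry; apply: W.
move=> tI tI' E; have [t3|t3] := leP t 3^-1.
  have Et := model_left o (ltac:(lra) : 0 <= t <= 3^-1).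
  have [t3'|t3'] := leP t' 3^-1.
    have Et' := model_left o' (ltac:(lra) : 0 <= t' <= 3^-1).
    have := congr1 xco E; rewrite Et Et' !coE => tE.
    have tt : t = t' by lra.
    rewrite -tt zoom_low; last by lra.
    by rewrite !model_left //; lra.
  have [t2'|t2'] := leP (2 / 3) t'.
    have Et' := model_right o' (ltac:(lra) : 2 / 3 <= t' <= 1).
    have := congr1 xco E; rewrite Et Et' !coE => tE.
    have ge0 : 0 <= amp o' * tooth (1 - t').
      by rewrite mulr_ge0 ?tooth_ge0 //; case: (o') => //= m; exact/ltW/dyadic_gt0.
    have t0 : t = 0 by lra.
    have t1 : t' = 1 by lra.
    rewrite t0 t1 zoom_low; last by lra.
    rewrite zoom_high; last by lra.
    rewrite model_left; last by lra.
    rewrite model_right; last by lra.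
    have -> : 1 - (2 * 1 - 1) = 0 :> R by ring.
    by rewrite tooth_low // mulr0; congr vec3; ring.
  exfalso; case: o' E => [m|] E.
    have := hanging_middle_pos m (ltac:(lra) : 3^-1 < t' < 2 / 3).
    rewrite -model_middle_some -?E ?Et ?coE; lra.
  have Et' := model_middle_none (ltac:(lra) : 3^-1 <= t' <= 2 / 3).
  have := congr1 xco E; have := congr1 zco E; rewrite Et Et' !coE; lra.
have [t2|t2] := leP (2 / 3) t.
  have Et := model_right o (ltac:(lra) : 2 / 3 <= t <= 1).
  have Et' := model_right o' (ltac:(lra) : 2 / 3 <= t' <= 1).
  have tE : t = t' by have := congr1 zco E; rewrite Et Et' !coE; lra.
  rewrite -tE in Et' E *; have [b0|b0] := eqVneq (tooth (1 - t)) 0.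
    by apply: model_zoom_tooth0 => //; lra.
  have := congr1 xco E; rewrite Et Et' !coE => /addrI /(mulIf b0) /amp_inj -> //.
have [t2'|t2'] := leP (2 / 3) t'.
  exfalso; have Et' := model_right o' (ltac:(lra) : 2 / 3 <= t' <= 1).
  case: o E => [m|] E.
    have := hanging_middle_pos m (ltac:(lra) : 3^-1 < t < 2 / 3).
    rewrite -model_middle_some ?E ?Et' ?coE; lra.
  have Et := model_middle_none (ltac:(lra) : 3^-1 <= t <= 2 / 3).
  have ge0 : 0 <= amp o' * tooth (1 - t').
    by rewrite mulr_ge0 ?tooth_ge0 //; case: (o') => //= m; exact/ltW/dyadic_gt0.
  have := congr1 xco E; have := congr1 zco E; rewrite Et Et' !coE; lra.
have tM : 3^-1 < t < 2 / 3 by lra.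
have tM' : 3^-1 < t' < 2 / 3 by lra.
have tm : 3^-1 <= t <= 2 / 3 by lra.
have tm' : 3^-1 <= t' <= 2 / 3 by lra.
case: o o' E => [m|] [m'|] E.
- rewrite !model_middle_some // in E.
  by have [-> ->] := hanging_middle_inj tM tM' E.
- exfalso; have := hanging_middle_pos m tM.
  by rewrite -model_middle_some // E model_middle_none // !coE ltxx.
- exfalso; have := hanging_middle_pos m' tM'.
  by rewrite -model_middle_some // -E model_middle_none // !coE ltxx.
- have := congr1 xco E; rewrite (model_middle_none tm) (model_middle_none tm') !coE => tE.
  by have -> : t = t' by lra.
Qed.

Lemma converging_family_zoom : converging_family (fun o => model o \o zoom).
Proof.
have [C C0 cE EC] := converging_family_model.
apply: (@ConvergingFamily _ _ C C0) => [i|i t t01]; last exact/EC/zoom_itv.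
apply: continuous_comp_fun => //.
have cid : continuous (fun t : R => t) by move=> t; exact: cvg_id.
have cc (x : R) : continuous (fun _ : R => x) by exact: cst_continuous.
apply: continuous_real_max; first exact: continuous_real_mul.
by apply: continuous_real_sub => //; exact: continuous_real_mul.
Qed.

(** The entry of the code that shapes the curve near the parameter [t]. *)
Definition active phi (t : R) : nat :=
  if t < 2 / 3 then phi 0%N else phi (level (1 - t)).+1.

Lemma coded_model phi t : 0 <= t <= 1 -> coded phi t = model (Some (active phi t)) t.
Proof.
move=> t01; rewrite /active; have [t2|t2] := ltP t (2 / 3).
  have [t3|t3] := leP t 3^-1; first by rewrite coded_left ?model_left //; lra.
  by rewrite coded_middle ?model_middle_some //; lra.
by rewrite coded_right ?model_right //; lra.
Qed.

Lemma coded_zoom phi t : 0 <= t <= 1 ->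
  coded (phi \o succn) (zoom t) = model (Some (active phi t)) (zoom t).
Proof.
move=> t01; rewrite /active; have [t2|t2] := ltP t (2 / 3).
  by rewrite zoom_low ?coded_left ?model_left //; lra.
rewrite zoom_high //; have [t1|t1] := eqVneq t 1.
  have I1 : 2 / 3 <= (2 * 1 - 1 : R) <= 1 by lra.
  rewrite t1 coded_right // model_right //.
  have -> : 1 - (2 * 1 - 1) = 0 :> R by ring.
  by rewrite /wiggle tooth_low // !mulr0.
pose u := 1 - t; have u0 : 0 < u by move: t1; rewrite /u neq_lt; lra.
have gt := level_gt u0; rewrite -/u.
case E : (level u) gt => [|j] gt.
  rewrite dyadic0 in gt.
  by rewrite coded_middle ?model_middle_some //; rewrite /u in gt; lra.
have := level_top u0; rewrite E => /(_ isT); rewrite dyadicS in gt *; move=> uT.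
have j1 := @dyadic_le1 R j.
have lj : level (2 * u) = j by apply: level_window; lra.
have tE : 1 - (2 * t - 1) = 2 * u by rewrite /u; ring.
rewrite coded_right; last by rewrite /u in uT; lra.
rewrite model_right; last by rewrite /u in uT; lra.
by rewrite tE /wiggle /= lj.
Qed.

Lemma shifting_map_exists : exists2 f : V -> V, continuous f &
  forall phi t, 0 <= t <= 1 -> f (coded phi t) = coded (phi \o succn) (zoom t).
Proof.
have [f cf fE] := extend_family converging_family_model converging_family_zoom
  (fun o o' t t' => @model_zoom o o' t t').
by exists f => // phi t t01; rewrite coded_model // fE // coded_zoom.
Qed.

Lemma zoom_lift : exists2 Z, circle_lift Z & forall t, 0 <= t <= 1 -> Z t = zoom t.
Proof.
apply: circle_lift_of_bijection.
- move=> s t _ st _; have [t2|/ltW t2] := leP t (2 / 3).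
    by rewrite !zoom_low; lra.
  rewrite (zoom_high t2); have [s2|/ltW s2] := leP s (2 / 3).
    by rewrite zoom_low //; lra.
  by rewrite zoom_high //; lra.
- by rewrite zoom_low; lra.
- by rewrite zoom_high; lra.
- move=> y y01; have [y3|/ltW y3] := leP y 3^-1.
    by exists (2 * y); [lra|rewrite zoom_low; lra].
  by exists ((y + 1) / 2); [lra|rewrite zoom_high; lra].
Qed.

Lemma shifting_map_iter (f : V -> V) :
  (forall phi t, 0 <= t <= 1 -> f (coded phi t) = coded (phi \o succn) (zoom t)) ->
  forall n phi, exists2 Z, circle_lift Z &
    iter n f \o coded phi = coded (fun k => phi (k + n)%N) \o Z.
Proof.
move=> fE; have [Z0 LZ0 Z0E] := zoom_lift.
have fc phi : f \o coded phi = coded (phi \o succn) \o Z0.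
  have [_ p1 _] := coded_simple phi; have [_ p2 _] := coded_simple (phi \o succn).
  apply: periodic1_eq.
  - by move=> t /=; rewrite p1.
  - by move=> t /=; have [_ _ ->] := LZ0; rewrite p2.
  - by move=> t t01 /=; rewrite fE ?Z0E //; lra.
elim=> [|n IH] phi.
  exists (fun t => t + 0); first exact: circle_lift_addr.
  apply/funext => t /=; rewrite addr0; congr coded.
  by apply/funext => k; rewrite addn0.
have [Z LZ E] := IH phi; exists (Z0 \o Z); first exact: circle_lift_comp.
apply/funext => t; rewrite /= -[iter n f _]/((iter n f \o coded phi) t) E /=.
have := fc (fun k => phi (k + n)%N) => /(congr1 (fun h => h (Z t))) /= ->.
by congr coded; apply/funext => k /=; rewrite addSnnS.
Qed.

End Coded.

(** * The knot types of the coded curves *)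

Section Conclusion.
Context {R : realType}.
Notation V := (space3 R).

Definition embedded_code (s : seq (rat * rat * rat)) :=
  (0 < size s)%N /\ simple_curve (rat_curve s : R -> V).

(** One hanging curve for every isotopy class of rational polygons; the other
    indices repeat the class of [s0]. *)
Lemma hanging_curves (s0 : seq (rat * rat * rat)) : embedded_code s0 ->
  exists kap : nat -> R -> V,
    [/\ forall m, hanging (dyadic m) (kap m), forall m, simple_curve (kap m) &
      forall s, embedded_code s -> exists m, deforms (rat_curve s) (kap m)].
Proof.
move=> e0.
have H m : exists k : R -> V, hanging (dyadic m) k /\ simple_curve k /\
    forall s, embedded_code s -> unpickle m = Some s -> deforms (rat_curve s) k.
  have [s es sm] : exists2 s, embedded_code s &
      forall s', embedded_code s' -> unpickle m = Some s' -> s' = s.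
    case E : (unpickle m) => [s|]; last by exists s0.
    have [es|nes] := pselect (embedded_code s); first by exists s => // s' _ [].
    by exists s0 => // s' es' [ss']; rewrite ss' in nes.
  have [ss Ss] := es.
  have [g [de [t1 [t2 [dg tg]]]]] := deforms_tent ss (is_pl_pl_curve _ ss) Ss.
  have Sg := deforms_simple dg Ss.
  have [k dk hk] := hanging_deformation Sg tg
    (introT andP (conj (@dyadic_gt0 R m) (@dyadic_le1 R m))).
  exists k; split => //; split; first exact: deforms_simple dk Sg.
  by move=> s' es' /(sm _ es') ->; exact: deforms_trans dg dk.
exists (fun m => projT1 (cid (H m))); split.
- by move=> m; case: cid => k /= [].
- by move=> m; case: cid => k /= [_ []].
move=> s es; exists (pickle s); case: cid => k /= [_ [_ dk]].
by apply: dk => //; rewrite pickleK.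
Qed.

Lemma ambient_isotopic_end (k k' : oriented_set R) Phi :
  ambient_isotopic k k' -> isotopy_end Phi ->
  ambient_isotopic k (oriented_image Phi k').
Proof.
move=> [F [[cF hF F0] <-]] [G [G' [[cG cG'] GK G'K G0 G1]]].
exists (fun t => G t \o F t); split; last first.
  rewrite /oriented_image /=; congr OrientedSet.
    apply/seteqP; split => x /=.
      by move=> [y ky <-]; exists (F 1 y); [exists y|rewrite G1].
    by move=> [_ [y ky <-] <-]; exists y => //; rewrite G1.
  apply/seteqP; split => x /=.
    move=> [p kp <-]; exists (F 1 \o p); first by exists p.
    by apply/funext => z /=; rewrite G1.
  by move=> [_ [p kp <-] <-]; exists p => //; apply/funext => z /=; rewrite G1.
split.
- apply/subspace_continuousP => z zI.
  have cFz : (F w.1 w.2) @[w --> within (`[0 : R, 1] `*` [set: V]) (nbhs z)] --> F z.1 z.2.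
    by move/subspace_continuousP : cF; apply.
  apply: (@cvg_comp _ _ _ (fun w : R * V => (w.1, F w.1 w.2)) (fun w : R * V => G w.1 w.2)
    _ (nbhs (z.1, F z.1 z.2))); last exact: (cG (z.1, F z.1 z.2)).
  apply: (@cvg_pair _ _ _ _ (nbhs z.1) (nbhs (F z.1 z.2))) => //.
  by apply: cvg_within_filter; exact: cvg_fst.
- move=> t tI; apply: homeomorphism_comp; first exact: hF.
  split; first exact: continuous_slice.
  by exists (G' t); split => //; exact: continuous_slice.
- by move=> x /=; rewrite F0 G0.
Qed.

Lemma oriented_image_comp (F G : V -> V) (k : oriented_set R) :
  oriented_image G (oriented_image F k) = oriented_image (G \o F) k.
Proof.
rewrite /oriented_image /=; congr OrientedSet.
  apply/seteqP; split => x /=; first by move=> [_ [y ky <-] <-]; exists y.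
  by move=> [y ky <-]; exists (F y) => //; exists y.
apply/seteqP; split => x /=; first by move=> [_ [p kp <-] <-]; exists p.
by move=> [p kp <-]; exists (F \o p) => //; exists p.
Qed.

Lemma tame_type_member (C : set (oriented_set R)) k0 Phi g :
  tame_oriented_knot_type C -> C k0 ->
  smooth_knot (carrier k0) \/ polygonal_knot (carrier k0) ->
  isotopy_end Phi -> oriented_image Phi k0 = knot_of g -> simple_curve g ->
  tame_knot (carrier (knot_of g)) /\ C (knot_of g).
Proof.
move=> [[k [_ ->]] _] [ok0 kk0] sp ePhi Phig Sg; split; last first.
  by split; [exact: is_oriented_knot_of|rewrite -Phig; exact: ambient_isotopic_end].
split.
  by have [h [hh _]] := parametrizes_on_circle Sg; exists h.
have [Psi ePsi [PhiK _]] := isotopy_end_inverse ePhi.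
have [F [aF F1]] := isotopy_end_ambient ePsi; exists F; split => //.
rewrite F1 (_ : Psi @` _ = carrier k0) //.
rewrite -Phig /=; apply/seteqP; split => x /=.
  by move=> [_ [y ky <-] <-]; rewrite PhiK.
by move=> kx; exists (Phi x); [exists x|rewrite PhiK].
Qed.

End Conclusion.

Theorem theorem4p10 (R : realType) :
  exists f : space3 R -> space3 R,
    continuous f /\
    forall phi : nat -> set (oriented_set R),
      (forall n : nat, (0 < n)%N -> tame_oriented_knot_type (phi n)) ->
      exists k : oriented_set R,
        [/\ is_oriented_knot k,
            tame_knot (carrier k),
            iteratively_injective f (carrier k) &
            forall n : nat, (0 < n)%N ->
              tame_knot (iter n.-1 f @` carrier k) /\
              phi n (oriented_image (iter n.-1 f) k)].
Proof.
have [[s0 es0]|none] := pselect (exists s, @embedded_code R s); last first.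
  (* without embedded rational polygons there is no tame type to realize *)
  exists id; split; first by move=> x; exact: cvg_id.
  move=> phi /(_ 1%N isT) [[k [_ E]] [k0 [Ck0 sp]]]; exfalso; apply: none.
  rewrite E in Ck0; have [s [s0 Ss _]] := tame_rat_curve Ck0.1 sp.
  by exists s.
have [kap [kapH kapS kapE]] := hanging_curves es0.
have [f cf fE] := shifting_map_exists kapH kapS.
exists f; split => // phi tphi.
have ex n : exists m, forall code, code 0%N = m ->
    tame_knot (carrier (knot_of (coded kap code))) /\
    phi n.+1 (knot_of (coded kap code)).
  have [[k [ok E]] [k0 [Ck0 sp]]] := tphi n.+1 isT.
  have ok0 : is_oriented_knot k0 by rewrite E in Ck0; exact: Ck0.1.
  have [s [s1 Ss [Phi ePhi PhiE]]] := tame_rat_curve ok0 sp.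
  have [m [Psi [H [ePsi LH kE]]]] := kapE s (conj s1 Ss).
  exists m => code c0; have [Om eOm OmE] := coded_isotopic kap code.
  apply: (@tame_type_member _ _ k0 (Om \o Psi \o Phi)) => //; [exact: tphi| | |].
  - by apply: isotopy_end_comp => //; exact: isotopy_end_comp.
  - rewrite -(oriented_image_comp Phi (Om \o Psi)) PhiE oriented_image_knot_of OmE c0 kE.
    have [_ rp _] := Ss.
    have -> : Om \o ((Psi \o rat_curve s) \o H) = (Om \o (Psi \o rat_curve s)) \o H by [].
    by apply/esym/knot_of_lift => // t /=; rewrite rp.
  - exact: coded_simple.
(* the sequence of indices of the given types; the knot that carries it as its code
   is the required one *)
pose code n := projT1 (cid (ex n)).
have codeE n c : c 0%N = code n -> tame_knot (carrier (knot_of (coded kap c))) /\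
    phi n.+1 (knot_of (coded kap c)).
  by rewrite /code; case: cid => m /= H /H.
have Sc := coded_simple kapS code.
have it := shifting_map_iter kapS fE.
have itE n : oriented_image (iter n f) (knot_of (coded kap code)) =
    knot_of (coded kap (fun k => code (k + n)%N)).
  have [Z LZ E] := it n code; rewrite oriented_image_knot_of E knot_of_lift //.
  by have [] := coded_simple kapS (fun k => code (k + n)%N).
exists (knot_of (coded kap code)); split.
- exact: is_oriented_knot_of.
- by have [] := codeE 0%N code erefl.
- move=> n x y; rewrite !inE => -[s _ <-] [t _ <-] /= st.
  have [Z LZ E] := it n code.
  have SZ : simple_curve (iter n f \o coded kap code).
    by rewrite E; apply: simple_curve_lift => //; exact: coded_simple.
  have [k ->] := simple_curve_eq SZ st.
  by have [_ gp _] := Sc; rewrite periodic1_int.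
- case=> [//|n] _ /=; rewrite -[_ @` _]/(carrier (oriented_image (iter n f) (knot_of (coded kap code)))).
  by rewrite itE; apply: codeE; rewrite add0n.
Qed.
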